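(* Let $n>1$ be an integer, let $q$ be an odd prime power, and let $P$ be a maximal parabolic subgroup of $GL_n(q)$ with Levi subgroup $GL_{n-1}(q)\times GL_1(q)$. Then $P$ is a $2$-restriction good subgroup of $GL_n(q)$. Moreover, if $n$ is odd, then $P$ is a $2$-restriction canonical subgroup of $GL_n(q)$.
   Context: For a finite group $X$ and a prime $p$, $\mathrm{Irr}_{p'}(X)$ is the set of complex irreducible characters of $X$ of degree not divisible by $p$; $\chi_H$ denotes the restriction of $\chi$ to $H$. A subgroup $H\le G$ of a finite group $G$ is called $p$-restriction good if for every $\chi\in\mathrm{Irr}_{p'}(G)$ there exists a unique $\chi^*\in\mathrm{Irr}_{p'}(H)$ such that $\chi_H=\chi^*+\Delta$, where either $\Delta=0$ or $\Delta$ is a character of $H$ all of whose irreducible constituents have degree divisible by $p$. A $p$-restriction good subgroup $H\le G$ is called $p$-restriction canonical if the map $\chi\mapsto\chi^*$ is a bijection $\mathrm{Irr}_{p'}(G)\to\mathrm{Irr}_{p'}(H)$. *)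

(* Defs.v *)
From mathcomp Require Import all_boot all_order all_algebra all_fingroup.
From mathcomp Require Import all_solvable all_field all_character.

Set Implicit Arguments.
Unset Strict Implicit.
Unset Printing Implicit Defensive.

Import GroupScope GRing.Theory.
Local Open Scope ring_scope.

Section RestrictionGood.

Variables (p : nat) (gT : finGroupType).
Implicit Types G H : {group gT}.

Definition Irr_p' G : {set Iirr G} := [set i | ~~ (p %| 'chi_i 1%g)%C].

(* Irreducible characters are handled through their index in irr, so 'chi_j
   plays the part of the character chi^* attached to chi = 'chi_i. *)
Definition is_star G H (i : Iirr G) (j : Iirr H) : Prop :=
  j \in Irr_p' H /\
  exists Delta : 'CF(H),
    'Res[H] 'chi_i = 'chi_j + Delta /\
    (Delta = 0 \/
     Delta \is a character /\
     forall k : Iirr H, k \in irr_constt Delta -> (p %| 'chi_k 1%g)%C).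

Definition restriction_good G H : Prop :=
  H \subset G /\
  forall i : Iirr G, i \in Irr_p' G -> exists! j : Iirr H, is_star i j.

(* On Irr_p' G, star below is the map chi |-> chi^*, uniquely determined by
   restriction_good. *)
Definition restriction_canonical G H : Prop :=
  restriction_good G H /\
  exists star : Iirr G -> Iirr H,
    [/\ forall i, i \in Irr_p' G -> is_star i (star i),
        {in Irr_p' G &, injective star}
      & star @: Irr_p' G = Irr_p' H].

End RestrictionGood.

Section Parabolic.

Variables (F : finFieldType) (n : nat).
Implicit Types P L : {group {'GL_n[F]}}.

(* 'GL_n[F] consists of matrices of size n.-1.+1 (which is n when 0 < n); they
   act on row vectors by right multiplication, a subspace being the row space of
   a matrix U. Each g is invertible, so U g <= U means U g = U. *)
Definition GLstab (U : 'M[F]_(n.-1.+1)) : {set {'GL_n[F]}} :=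
  [set g | (U *m GLval g <= U)%MS].

(* Parabolic subgroups of GL_n are the stabilisers of flags; the maximal ones
   are the stabilisers of a single proper nonzero subspace. *)
Definition maximal_parabolic P : Prop :=
  exists U : 'M[F]_(n.-1.+1),
    (0 < \rank U < n.-1.+1)%N /\ P :=: GLstab U.

(* The Levi subgroups of the stabiliser of U are the stabilisers of the
   decompositions U (+) W of the whole space. *)
Definition levi_subgroup P L : Prop :=
  exists U W : 'M[F]_(n.-1.+1),
    [/\ (0 < \rank U < n.-1.+1)%N,
        (U + W :=: 1%:M)%MS, mxdirect (U + W),
        P :=: GLstab U
      & L :=: GLstab U :&: GLstab W].

End Parabolic.

(* Main.v *)
Require Import Defs.
From HB Require Import structures.
From mathcomp Require Import all_boot all_order all_algebra all_fingroup.
From mathcomp Require Import all_solvable all_field all_character.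
From mathcomp Require Import zify ring lra.

Set Implicit Arguments.
Unset Strict Implicit.
Unset Printing Implicit Defensive.

Import Order.TTheory GRing.Theory Num.Theory.
Local Open Scope ring_scope.

(* Write G_n = GL_n(q) and let a range over the characters of F^*. Harish-Chandra
   induction of f (x) (a o det) from G_m x GL_r(q) and its adjoint satisfy a Mackey
   formula in which different a do not interact, so the Jacobi-Trudi determinants in
   the functions induced from the a o det are, up to sign, irreducible characters; they
   are indexed by one partition for each a, encoded by beads b. Restricting such a
   character to P and taking the fixed points of the unipotent radical U removes a box.

   Since U has odd order and its elements are inverted by an involution of P,
   chi(1) = <chi_U, 1> mod 2. Hence every odd degree character of P is trivial on U,
   every odd degree character of G_n is one of the determinants, and the parity d(b) of
   its degree satisfies d(b) = sum of d(b - box) mod 2. Squaring mod 2, d(b) is also the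
   sum of d over all ways of sliding one bead down by K = 2^k. For K <= n < 2K at most
   one such slide is possible, and an induction shows that an odd b has exactly one odd
   child, which is goodness, and for n odd at most one odd parent of each colour, which
   is injectivity; surjectivity holds because [G_n : P] is then odd.

   Comparing q-parts of orders, the Levi factor forces the stabilised subspace to be a
   hyperplane or a line, and transpose-inverse exchanges the two. *)

(** Functions are families over matrices of all sizes, because induction and its adjoint change the
    size. Identities between families are not checked on elements: adjunction yields inner products,
    and a difference of norm zero vanishes. The determinants have norm 1, hence are irreducible up
    to sign. That they exhaust the irreducible characters of odd degree follows by induction on n:
    if chi is odd, the U-fixed points have odd dimension, so for some colour a their a-isotypic part
    is an odd character of the smaller group. It pairs nontrivially with a determinant, and by
    adjunction and the Pieri rule chi pairs nontrivially with a determinant having one more box. The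
    Pieri rule needs an empty last row in the colour concerned, which dictates the number of rows.
    Beads are used instead of partitions because removing a box slides a bead down by 1, and modulo
    2 the 2^k-th power of a sum of commuting slides is the sum of their 2^k-th powers. *)

(* Locked because [mulmxA] would otherwise see through [pinvmx], itself a product. *)
HB.lock Definition frinv (F : fieldType) p n (Z : 'M[F]_(p, n)) : 'M_(n, p) := pinvmx Z.

(** * Frames and characters of the multiplicative group *)

Section Frames.

Variable F : finFieldType.

(* An invertible matrix whose sizes p = n need only be propositionally equal: conjugation
   by frames transports matrices between such sizes without casts. *)
Definition frame p n (Z : 'M[F]_(p, n)) := row_free Z && row_full Z.

Definition conj_mx p n (Z : 'M[F]_(p, n)) (A : 'M_n) : 'M_p := Z *m A *m frinv Z.

Lemma frame_dim p n (Z : 'M_(p, n)) : frame Z -> p = n.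
Proof. by case/andP=> /eqP rZ /eqP cZ; rewrite -[LHS]rZ cZ. Qed.

Lemma frameV p n (Z : 'M_(p, n)) : frame Z -> Z *m frinv Z = 1%:M.
Proof. by rewrite frinv.unlock => /andP[/mulmxVp]. Qed.

Lemma frameK p n (Z : 'M_(p, n)) : frame Z -> frinv Z *m Z = 1%:M.
Proof. by rewrite frinv.unlock => /andP[_ /mulVpmx]. Qed.

Lemma frame_square n (Z : 'M_n) : frame Z = (Z \in unitmx).
Proof. by rewrite /frame row_full_unit row_free_unit andbb. Qed.

Lemma frame_frinv p n (Z : 'M_(p, n)) : frame Z -> frame (frinv Z).
Proof. by case/andP=> fZ FZ; rewrite frinv.unlock /frame pinvmx_free ?pinvmx_full. Qed.

Lemma frame_mul p n k (Z : 'M_(p, n)) (Y : 'M_(n, k)) :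
  frame Z -> frame Y -> frame (Z *m Y).
Proof.
move=> fZ fY; have e := frame_dim fZ; have e' := frame_dim fY; subst p k.
by rewrite frame_square unitmx_mul -!frame_square fZ.
Qed.

Lemma frame1 n : frame (1%:M : 'M_n).
Proof. by rewrite frame_square unitmx1. Qed.

Lemma frame_inv_unique p n (Z : 'M_(p, n)) (Y : 'M_(n, p)) :
  frame Z -> Z *m Y = 1%:M -> Y = frinv Z.
Proof. by move=> fZ ZY; rewrite -[Y]mul1mx -(frameK fZ) -mulmxA ZY mulmx1. Qed.

Lemma frinv_mul p n k (Z : 'M_(p, n)) (Y : 'M_(n, k)) :
  frame Z -> frame Y -> frinv (Z *m Y) = frinv Y *m frinv Z.
Proof.
move=> fZ fY; apply/esym/frame_inv_unique; first exact: frame_mul.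
by rewrite mulmxA -(mulmxA Z) frameV // mulmx1 frameV.
Qed.

Lemma frinvK p n (Z : 'M_(p, n)) : frame Z -> frinv (frinv Z) = Z.
Proof.
by move=> fZ; apply/esym/frame_inv_unique; rewrite ?frame_frinv ?frameK.
Qed.

Lemma conj_mxM p n k (Z : 'M_(p, n)) (Y : 'M_(n, k)) A :
  frame Z -> frame Y -> conj_mx (Z *m Y) A = conj_mx Z (conj_mx Y A).
Proof. by move=> fZ fY; rewrite /conj_mx frinv_mul // !mulmxA. Qed.

Lemma conj_mx1 n (A : 'M_n) : conj_mx 1%:M A = A.
Proof.
by rewrite /conj_mx mul1mx -(frame_inv_unique (frame1 n) (mulmx1 _)) mulmx1.
Qed.

Lemma conj_mxK p n (Z : 'M_(p, n)) : frame Z -> cancel (conj_mx Z) (conj_mx (frinv Z)).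
Proof. by move=> fZ A; rewrite -conj_mxM ?frame_frinv // frameK ?conj_mx1. Qed.

Lemma conj_mxKV p n (Z : 'M_(p, n)) : frame Z -> cancel (conj_mx (frinv Z)) (conj_mx Z).
Proof. by move=> fZ A; rewrite -conj_mxM ?frame_frinv // frameV ?conj_mx1. Qed.

Lemma conj_mx_mul p n (Z : 'M_(p, n)) A B :
  frame Z -> conj_mx Z (A *m B) = conj_mx Z A *m conj_mx Z B.
Proof.
move=> fZ; rewrite /conj_mx !mulmxA -(mulmxA _ (frinv Z) Z) frameK //.
by rewrite mulmx1.
Qed.

Lemma conj_mx_id p n (Z : 'M_(p, n)) : frame Z -> conj_mx Z 1%:M = 1%:M.
Proof. by move=> fZ; rewrite /conj_mx mulmx1 frameV. Qed.

Lemma conj_mx_unit p n (Z : 'M_(p, n)) A :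
  frame Z -> (conj_mx Z A \in unitmx) = (A \in unitmx).
Proof.
have imp p' n' (Y : 'M_(p', n')) B :
    frame Y -> B \in unitmx -> conj_mx Y B \in unitmx.
  move=> fY uB; rewrite -frame_square /conj_mx.
  apply: frame_mul; last exact: frame_frinv.
  by apply: frame_mul; rewrite ?frame_square.
move=> fZ; apply/idP/idP => [uA|]; last exact: imp.
by rewrite -(conj_mxK fZ A) imp ?frame_frinv.
Qed.

Lemma conj_mx_det p n (Z : 'M_(p, n)) A : frame Z -> \det (conj_mx Z A) = \det A.
Proof.
move=> fZ; have e := frame_dim fZ; subst p.
rewrite /conj_mx !det_mulmx mulrAC -det_mulmx frameV // det1 mul1r //.
Qed.

Lemma sum_frame_mulr (R : nmodType) k p n (Y : 'M_(p, n)) (f : 'M_(k, n) -> R) :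
  frame Y ->
  \sum_(Z : 'M_(k, p) | frame Z) f (Z *m Y) = \sum_(Z : 'M_(k, n) | frame Z) f Z.
Proof.
move=> fY; rewrite [RHS](reindex_onto (mulmx^~ Y) (mulmx^~ (frinv Y))) /=.
  apply: eq_bigl => Z; rewrite -mulmxA frameV // mulmx1 eqxx andbT.
  apply/idP/idP=> [fZ|fZY]; first exact: frame_mul.
  by rewrite -[Z]mulmx1 -(frameV fY) mulmxA frame_mul ?frame_frinv.
by move=> Z _; rewrite -mulmxA frameK ?mulmx1.
Qed.

Lemma sum_frame_frinv (R : nmodType) p n (f : 'M_(n, p) -> R) :
  \sum_(Z : 'M_(p, n) | frame Z) f (frinv Z) = \sum_(Z : 'M_(n, p) | frame Z) f Z.
Proof.
rewrite [RHS](reindex_onto (@frinv _ _ _) (@frinv _ _ _)) /=; last first.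
  by move=> Z; apply: frinvK.
apply: eq_bigl => Z; apply/idP/andP=> [fZ|[fZ /eqP <-]]; last exact: frame_frinv.
by rewrite frame_frinv ?frinvK.
Qed.

Lemma sum_conj_mx (R : nmodType) p n (Z : 'M_(p, n)) (f : 'M_p -> R) :
  frame Z ->
  \sum_(A : 'M_n | A \in unitmx) f (conj_mx Z A) = \sum_(A in unitmx) f A.
Proof.
move=> fZ; rewrite [RHS](reindex_onto (conj_mx Z) (conj_mx (frinv Z))) /=.
  by apply: eq_bigl => A; rewrite conj_mx_unit ?conj_mxK ?eqxx ?andbT.
by move=> A _; rewrite conj_mxKV.
Qed.

End Frames.

Section Colours.

Variable F : finFieldType.

Definition colour := Iirr [set: {unit F}].

Implicit Types (a b : colour) (x y : F).

(** As [insubd] sends 0 to the unit 1, [ch a 0] is 1. Hence [ch_norm] holds for every x, while the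
    character sums are restricted to nonzero arguments. *)
Definition ch a x : algC := 'chi_a (insubd (1%g : {unit F}) x).

Let abU : abelian [set: {unit F}].
Proof. exact/cyclic_abelian/field_unit_group_cyclic. Qed.

Let lin a : 'chi_a \is a linear_char.
Proof. exact: (char_abelianP _ abU). Qed.

Lemma val_insubd_unit x : x != 0 -> \val (insubd (1%g : {unit F}) x) = x.
Proof. by move=> x0; rewrite insubdK // -topredE /= unitfE. Qed.

Lemma chM a x y : x != 0 -> y != 0 -> ch a (x * y) = ch a x * ch a y.
Proof.
move=> x0 y0; rewrite /ch -lin_charM ?inE //; congr ('chi_a _).
by apply: val_inj; rewrite FinRing.val_unitM !val_insubd_unit ?mulf_neq0.
Qed.

Lemma ch1 a : ch a 1 = 1.
Proof.
rewrite /ch -(lin_char1 (lin a)); congr ('chi_a _).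
by apply: val_inj; rewrite val_insubd_unit ?oner_neq0.
Qed.

Lemma ch_norm a x : ch a x * (ch a x)^* = 1.
Proof. by rewrite -normCK normC_lin_char ?inE ?expr1n. Qed.

Lemma sum_ch a b :
  \sum_(x | x != 0) ch a x * (ch b x)^* = (#|F|.-1)%:R *+ (a == b).
Proof.
have /(congr1 ( *%R (#|F|.-1)%:R)) := cfdot_irr a b.
rewrite cfdotE card_finField_unit mulrA mulfV ?mul1r; last first.
  by rewrite pnatr_eq0 -lt0n -subn1 subn_gt0 finNzRing_gt1.
rewrite mulr_natr => <-.
rewrite (reindex_onto val (insubd (1%g : {unit F}))) /=; last first.
  by move=> x; apply: val_insubd_unit.
apply: eq_big => [u|u _]; last by rewrite /ch valKd.
by rewrite valKd eqxx andbT inE -unitfE (valP u).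
Qed.

Lemma sum_ch_colour x :
  x != 0 -> \sum_a ch a x = (#|F|.-1)%:R *+ (x == 1).
Proof.
move=> x0; have := second_orthogonality_relation (insubd (1%g : {unit F}) x) (in_setT 1%g).
rewrite (eq_bigr (fun a => ch a x)) => [->|a _]; last first.
  by rewrite lin_char1 ?lin // conjC1 mulr1.
rewrite -card_finField_unit.
have /abelian_classP cl : abelian [set: {unit F}] := abU.
rewrite cl ?inE // -val_eqE /= val_insubd_unit //.
congr (_%:R *+ _); congr #|pred_of_set _|; apply/setIidPl.
by rewrite -cent_set1; apply: subset_trans abU _; rewrite centS ?sub1set ?inE.
Qed.

(* At n = 0 there is one (empty) invertible matrix, unlike in [GL_0[F]], which is GL_1. *)
Definition gl n : nat := #|[pred A : 'M[F]_n | A \in unitmx]|.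

Lemma gl_gt0 n : (0 < gl n)%N.
Proof. by rewrite lt0n -lt0n; apply/card_gt0P; exists 1%:M; rewrite inE unitmx1. Qed.

Lemma gl_neq0 n : (gl n)%:R != 0 :> algC.
Proof. by rewrite pnatr_eq0 -lt0n gl_gt0. Qed.

(** Translation by a matrix of determinant x multiplies the sum by [ch a x * (ch b x)^*], which
    differs from 1 for some x when the colours differ. In size 0 every determinant is 1 and colours
    are invisible; this is the origin of the clause [E == 0] in the Mackey formula. *)
Lemma sum_gl_ch n a b :
  \sum_(A : 'M[F]_n | A \in unitmx) ch a (\det A) * (ch b (\det A))^* =
  (gl n)%:R *+ ((n == 0) || (a == b)).
Proof.
case: eqVneq => [n0|n_gt0].
  subst n; rewrite (eq_bigr (fun=> 1)) => [|A _]; first by rewrite sumr_const.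
  by rewrite det_mx00 !ch1 conjC1 mulr1.
case: eqVneq => [->|neq_ab].
  by rewrite (eq_bigr (fun=> 1)) => [|A _]; rewrite ?sumr_const // ch_norm.
have [x x0 nx]: exists2 x, x != 0 & ch a x * (ch b x)^* != 1.
  have [/existsP[x /andP[]]|] := boolP [exists x, (x != 0) && (ch a x * (ch b x)^* != 1)].
    by exists x.
  rewrite negb_exists => /forallP ab1.
  have := sum_ch a b; rewrite (negPf neq_ab) mulr0n (eq_bigr (fun=> 1)).
    move/eqP; rewrite sumr_const pnatr_eq0 -leqn0 leqNgt; case/negP.
    by apply/card_gt0P; exists 1; exact: oner_neq0.
  by move=> x x0; have := ab1 x; rewrite x0 /= negbK => /eqP.
have [i0] : exists i : 'I_n, True.
  by case: n n_gt0 => // n _; exists ord0.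
move=> _; pose d := diag_mx (\row_(i < n) if i == i0 then x else 1).
have dd : \det d = x.
  rewrite det_diag (bigD1 i0) //= mxE eqxx big1 ?mulr1 // => i /negPf.
  by rewrite mxE => ->.
have ud : d \in unitmx by rewrite unitmxE dd unitfE.
set S := \sum_(A | _) _; have: S * (1 - ch a x * (ch b x)^*) = 0.
  apply/eqP; rewrite mulrBr mulr1 subr_eq0; apply/eqP.
  rewrite /S {1}(reindex_onto (mulmx d) (mulmx (invmx d))) /=; last first.
    by move=> A _; rewrite mulKVmx.
  rewrite mulr_suml; apply: eq_big => [A|A].
    by rewrite mulKmx // eqxx andbT unitmx_mul ud.
  rewrite mulKmx // eqxx andbT unitmx_mul ud /= unitmxE unitfE => uA.
  rewrite det_mulmx dd !chM // rmorphM /= mulrACA mulrC //.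
by move/eqP; rewrite mulf_eq0 subr_eq0 eq_sym [1 == _]eq_sym (negPf nx) orbF eq_sym => /eqP.
Qed.

End Colours.

(** * Harish-Chandra induction and the Mackey formula *)

Section HarishChandra.

Variable F : finFieldType.
Local Notation colour := (colour F).
Local Notation fam := (forall n, 'M[F]_n -> algC).

Implicit Types (a b : colour).

Definition ip n (f g : 'M[F]_n -> algC) : algC :=
  (gl F n)%:R^-1 * \sum_(A : 'M[F]_n | A \in unitmx) f A * (g A)^*.

(** Class functions. Frames exist only for p = n, but allowing two names for one size lets a value
    at size [m + r] be compared with one at size n. *)
Definition cls (f : fam) := forall p n (Z : 'M[F]_(p, n)) A,
  frame Z -> A \in unitmx -> f p (conj_mx Z A) = f n A.

Definition Psize m r : nat := gl F m * gl F r * #|F| ^ (r * m).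

(** Inflation of f (x) (a o det) to the block lower triangular matrices, extended by 0. With row
    vectors these matrices stabilise the span of the first m coordinates. *)
Definition pfun m r a (f : 'M[F]_m -> algC) (Y : 'M[F]_(m + r)) : algC :=
  if ursubmx Y == 0 then f (ulsubmx Y) * ch a (\det (drsubmx Y)) else 0.

(** The formula for an induced character, with frames in place of conjugating elements. The sum is
    empty unless [m + r = n], so no condition on sizes has to be carried along. *)
Definition hc_ind_at m r a (f : 'M[F]_m -> algC) n (A : 'M[F]_n) : algC :=
  (Psize m r)%:R^-1 * \sum_(Z : 'M[F]_(m + r, n) | frame Z) pfun a f (conj_mx Z A).

(* Harish-Chandra induction from GL_(n - r) x GL_r of f (x) (a o det). *)
Definition hc_ind r a (f : fam) : fam := fun n => hc_ind_at r a (f (n - r)%N) (n := n).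

(* The (a o det)-isotypic part on GL_r of the invariants of the unipotent radical. *)
Definition hc_res r a (f : fam) : fam := fun m (A : 'M[F]_m) =>
  (gl F r * #|F| ^ (r * m))%:R^-1 *
  \sum_(B : 'M[F]_r | B \in unitmx) \sum_(X : 'M[F]_(r, m))
    (ch a (\det B))^* * f (m + r)%N (block_mx A 0 X B).

Lemma hc_indE r a (f : fam) m n (A : 'M_n) : (m + r)%N = n -> hc_ind r a f A = hc_ind_at r a (f m) A.
Proof. by move=> e; have -> : m = (n - r)%N by rewrite -e addnK. Qed.

Lemma hc_ind_neg r a (f : fam) n (A : 'M_n) : (n < r)%N -> hc_ind r a f A = 0.
Proof.
move=> ltnr; rewrite /hc_ind /hc_ind_at big_pred0 ?mulr0 // => Z.
apply/negP => /frame_dim e; move: ltnr; rewrite -e ltnNge.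
by rewrite leq_addl.
Qed.

Lemma q_gt0 : (0 < #|F|)%N. Proof. by apply/card_gt0P; exists 0. Qed.

Lemma Psize_neq0 m r : (Psize m r)%:R != 0 :> algC.
Proof. by rewrite pnatr_eq0 -lt0n !muln_gt0 !gl_gt0 expn_gt0 q_gt0. Qed.

Lemma hc_ind_cls r a f : cls (hc_ind r a f).
Proof.
move=> p n Z A fZ uA; have e := frame_dim fZ; subst p.
rewrite /hc_ind /hc_ind_at; congr (_ * _).
rewrite -(sum_frame_mulr (fun Y => pfun a (f (n - r)%N) (conj_mx Y A)) fZ).
by apply: eq_bigr => Y fY; rewrite conj_mxM.
Qed.

Lemma unitmx_lblock m r (A : 'M[F]_m) (X : 'M_(r, m)) (B : 'M_r) :
  (block_mx A 0 X B \in unitmx) = (A \in unitmx) && (B \in unitmx).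
Proof. by rewrite !unitmxE det_lblock unitrM. Qed.

Lemma sum_parabolic (R : nmodType) m r (f : 'M[F]_(m + r) -> R) :
  \sum_(Y : 'M[F]_(m + r) | (Y \in unitmx) && (ursubmx Y == 0)) f Y =
  \sum_(A : 'M[F]_m | A \in unitmx) \sum_(B : 'M[F]_r | B \in unitmx)
    \sum_(X : 'M[F]_(r, m)) f (block_mx A 0 X B).
Proof.
rewrite pair_big pair_big_dep /=.
pose h (u : 'M[F]_m * 'M[F]_r * 'M[F]_(r, m)) := block_mx u.1.1 0 u.2 u.1.2.
pose k (Y : 'M[F]_(m + r)) := (ulsubmx Y, drsubmx Y, dlsubmx Y).
rewrite (reindex_onto h k) /=; last first.
  by move=> Y /andP[_ /eqP ur0]; rewrite /h /k /= -ur0 submxK.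
apply: eq_bigl => -[[A B] X]; rewrite /h /k /=.
by rewrite unitmx_lblock block_mxKur eqxx block_mxKul block_mxKdr block_mxKdl eqxx !andbT.
Qed.

Lemma pfun_lblock m r a (f : 'M[F]_m -> algC) A X B :
  pfun a f (block_mx A 0 X B : 'M_(m + r)) = f A * ch a (\det B).
Proof. by rewrite /pfun block_mxKur eqxx block_mxKul block_mxKdr. Qed.

Lemma sum_pfun m r a (f : 'M[F]_m -> algC) (g : 'M[F]_(m + r) -> algC) :
  \sum_(Y : 'M[F]_(m + r) | Y \in unitmx) pfun a f Y * g Y =
  \sum_(A : 'M[F]_m | A \in unitmx) \sum_(B : 'M[F]_r | B \in unitmx)
    \sum_(X : 'M[F]_(r, m)) f A * ch a (\det B) * g (block_mx A 0 X B).
Proof.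
rewrite (bigID (fun Y : 'M_(m + r) => ursubmx Y == 0)) /= [X in _ + X]big1 ?addr0.
  rewrite sum_parabolic; apply: eq_bigr => A _; apply: eq_bigr => B _.
  by apply: eq_bigr => X _; rewrite pfun_lblock.
by move=> Y /andP[_ /negPf ur]; rewrite /pfun ur mul0r.
Qed.

(** All frames Z contribute equally: conjugation by Z is a change of variable that moves Z from
    [pfun] onto g, where invariance removes it. The number of frames cancels the factor [gl F n]. *)
Lemma ip_hc_indE m r a (f : 'M[F]_m -> algC) (g : fam) n : cls g -> (m + r)%N = n ->
  ip (hc_ind_at r a f (n := n)) (@g n) =
  (Psize m r)%:R^-1 *
    \sum_(Y : 'M[F]_(m + r) | Y \in unitmx) pfun a f Y * (g (m + r)%N Y)^*.
Proof.
move=> cg e; subst n; rewrite /ip /hc_ind_at.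
transitivity ((gl F (m + r))%:R^-1 * \sum_(Z : 'M[F]_(m + r) | Z \in unitmx)
  ((Psize m r)%:R^-1 * \sum_(Y : 'M[F]_(m + r) | Y \in unitmx)
     pfun a f Y * (g (m + r)%N Y)^*)); last first.
  by rewrite sumr_const mulrnAr -mulrnAl -[_ *+ _]mulr_natr mulVf ?mul1r ?gl_neq0.
congr (_ * _); under eq_bigr do rewrite -mulrA mulr_suml mulr_sumr.
rewrite exchange_big /=; apply: eq_big => [Z|Z fZ]; first exact: frame_square.
rewrite -[in RHS](sum_conj_mx _ fZ) mulr_sumr; apply: eq_bigr => A uA.
by rewrite cg.
Qed.

Lemma frobenius m r a (f g : fam) : cls g ->
  ip (@hc_ind r a f (m + r)) (@g (m + r)%N) = ip (@f m) (@hc_res r a g m).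
Proof.
move=> cg; transitivity (ip (hc_ind_at r a (f m) (n := (m + r)%N)) (@g (m + r)%N)).
  by congr (_ * _); apply: eq_bigr => A _; rewrite (hc_indE _ _ _ erefl).
rewrite ip_hc_indE // sum_pfun /ip /hc_res /Psize -mulnA natrM invfM -mulrA; congr (_ * _).
rewrite mulr_sumr; apply: eq_bigr => A _.
rewrite [(_ * _)^*]rmorphM /= fmorphV /= rmorph_nat mulrCA; congr (_ * _).
rewrite rmorph_sum /= mulr_sumr; apply: eq_bigr => B _.
rewrite rmorph_sum /= mulr_sumr; apply: eq_bigr => X _.
by rewrite rmorphM /= conjCK mulrA.
Qed.

End HarishChandra.

(** * Double cosets of maximal parabolic subgroups *)

Section DoubleCosets.

Variable F : finFieldType.
Local Notation colour := (colour F).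
Local Notation fam := (forall n, 'M[F]_n -> algC).

Implicit Types (a b : colour) (f g : fam).

Definition para m r (Y : 'M[F]_(m + r)) := (Y \in unitmx) && (ursubmx Y == 0).

Lemma para_frame m r (Y : 'M_(m + r)) : para Y -> frame Y.
Proof. by case/andP; rewrite frame_square. Qed.

Lemma paraP m r (Y : 'M_(m + r)) : para Y ->
  exists (A : 'M_m) (X : 'M_(r, m)) (B : 'M_r),
    [/\ A \in unitmx, B \in unitmx & Y = block_mx A 0 X B].
Proof.
case/andP=> uY /eqP ur0; have eY : Y = block_mx (ulsubmx Y) 0 (dlsubmx Y) (drsubmx Y).
  by rewrite -ur0 submxK.
exists (ulsubmx Y), (dlsubmx Y), (drsubmx Y).
by move: uY; rewrite {1}eY unitmx_lblock => /andP[].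
Qed.

Lemma para_lblock m r (A : 'M[F]_m) X (B : 'M[F]_r) :
  para (block_mx A 0 X B) = (A \in unitmx) && (B \in unitmx).
Proof. by rewrite /para unitmx_lblock block_mxKur eqxx andbT. Qed.

Lemma frinv_lblock m r (A : 'M[F]_m) X (B : 'M[F]_r) :
  A \in unitmx -> B \in unitmx ->
  frinv (block_mx A 0 X B) = block_mx (frinv A) 0 (- (frinv B *m X *m frinv A)) (frinv B).
Proof.
move=> uA uB; apply/esym/frame_inv_unique.
  by rewrite frame_square unitmx_lblock uA.
have [fA fB] : frame A /\ frame B by rewrite !frame_square.
rewrite mulmx_block !mul0mx !mulmx0 !addr0 !add0r (frameV fA) (frameV fB).
rewrite mulmxN !mulmxA (frameV fB) mul1mx subrr.
by rewrite -scalar_mx_block.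
Qed.

Lemma conj_para m r (p Y : 'M[F]_(m + r)) : para p -> para Y ->
  exists W, conj_mx p Y = block_mx (conj_mx (ulsubmx p) (ulsubmx Y)) 0 W
                                   (conj_mx (drsubmx p) (drsubmx Y)).
Proof.
case/paraP=> [A [X [B [uA uB ->]]]] /paraP[A' [X' [B' [uA' uB' ->]]]].
rewrite !block_mxKul !block_mxKdr /conj_mx frinv_lblock //.
by rewrite !mulmx_block !(mul0mx, mulmx0, addr0, add0r); eexists.
Qed.

Lemma para_frinv m r (p : 'M[F]_(m + r)) : para p -> para (frinv p).
Proof.
case/paraP=> [A [X [B [uA uB ->]]]]; rewrite frinv_lblock // para_lblock.
by rewrite -!frame_square !frame_frinv ?frame_square.
Qed.

Lemma para_mul m r (p p' : 'M[F]_(m + r)) : para p -> para p' -> para (p *m p').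
Proof.
case/paraP=> [A [X [B [uA uB ->]]]] /paraP[A' [X' [B' [uA' uB' ->]]]].
by rewrite mulmx_block !(mul0mx, mulmx0, addr0, add0r) para_lblock !unitmx_mul uA uA' uB.
Qed.

Lemma para1 m r : para (1%:M : 'M[F]_(m + r)).
Proof. by rewrite scalar_mx_block para_lblock !unitmx1. Qed.

Lemma pfun_conj m r a f (p Y : 'M[F]_(m + r)) : cls f -> para p -> Y \in unitmx ->
  pfun a (@f m) (conj_mx p Y) = pfun a (@f m) Y.
Proof.
move=> cf; have key (p' Y' : 'M[F]_(m + r)) : para p' -> para Y' ->
    pfun a (@f m) (conj_mx p' Y') = pfun a (@f m) Y'.
  move=> pp pY; have [W ->] := conj_para pp pY; rewrite pfun_lblock.
  case/paraP: pp => [A [X [B [uA uB ->]]]]; case/paraP: pY => [A' [X' [B' [uA' uB' ->]]]].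
  by rewrite !block_mxKul !block_mxKdr pfun_lblock cf ?conj_mx_det ?frame_square.
move=> pp uY; have fp := para_frame pp.
have [pY|npY] := boolP (para Y); first exact: key.
have [pY'|npY'] := boolP (para (conj_mx p Y)).
  by rewrite -(key (frinv p) _ (para_frinv pp) pY') (conj_mxK fp).
have ur0 Y' : Y' \in unitmx -> ~~ para Y' -> pfun a (@f m) Y' = 0.
  by rewrite /para /pfun => -> /= /negPf ->.
by rewrite !ur0 // conj_mx_unit.
Qed.

Section Mackey.

Variables (f f' : fam).
Hypotheses (cf : cls f) (cf' : cls f').

(** The contribution of one frame Z to the inner product of two induced functions; by [Psi_para] it
    depends only on the double coset of Z. *)
Definition Psi m r b m' s a (Z : 'M[F]_(m' + s, m + r)) : algC :=
  \sum_(Y : 'M[F]_(m + r) | Y \in unitmx)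
     pfun b (@f m) Y * (pfun a (@f' m') (conj_mx Z Y))^*.

Lemma ip_hc_ind m r b m' s a : (m + r = m' + s)%N ->
  ip (@hc_ind _ r b f (m + r)) (@hc_ind _ s a f' (m + r)) =
  (Psize F m r)%:R^-1 * (Psize F m' s)%:R^-1 *
  \sum_(Z : 'M[F]_(m' + s, m + r) | frame Z) Psi b a Z.
Proof.
move=> e; transitivity (ip (hc_ind_at r b (@f m) (n := (m + r)%N)) (@hc_ind _ s a f' (m + r))).
  by congr (_ * _); apply: eq_bigr => A _; rewrite (hc_indE _ _ _ erefl).
rewrite ip_hc_indE //; last exact: hc_ind_cls.
rewrite -mulrA; congr (_ * _); rewrite exchange_big mulr_sumr /=.
apply: eq_bigr => Y uY; rewrite -mulr_sumr mulrCA; congr (_ * _).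
rewrite (hc_indE _ _ _ (esym e)) /hc_ind_at rmorphM /= fmorphV /= rmorph_nat; congr (_ * _).
by rewrite rmorph_sum.
Qed.

Lemma Psi_para m r b m' s a (Z : 'M[F]_(m' + s, m + r)) p' p :
  frame Z -> para p' -> para p -> Psi b a (p' *m Z *m p) = Psi b a Z.
Proof.
move=> fZ pp' pp; have [fp' fp] := (para_frame pp', para_frame pp).
rewrite /Psi -[RHS](sum_conj_mx _ fp); apply: eq_bigr => Y uY.
rewrite (pfun_conj b cf pp uY); congr (_ * _^*).
rewrite !conj_mxM ?frame_mul // pfun_conj //.
by rewrite !conj_mx_unit.
Qed.

End Mackey.

Section Representative.

Variables A B C E : nat.

(* The representatives of P' \ G / P for maximal parabolics of shapes (A + C, B + E) and
   (A + B, C + E). *)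
Definition rep : 'M[F]_((A + C) + (B + E), (A + B) + (C + E)) :=
  block_mx (block_mx 1%:M 0 0 0) (block_mx 0 0 1%:M 0)
           (block_mx 0 1%:M 0 0) (block_mx 0 0 0 1%:M).

End Representative.

Lemma repV A B C E : rep A B C E *m rep A C B E = 1%:M.
Proof.
rewrite /rep !mulmx_block !(mul0mx, mulmx0, addr0, add0r, mul1mx, mulmx1).
by rewrite !block_mx0 !(addr0, add0r, add_block_mx) -!scalar_mx_block.
Qed.

Lemma frame_rep A B C E : frame (rep A B C E).
Proof.
by rewrite /frame; apply/andP; split; [apply/row_freeP | apply/row_fullP];
  exists (rep A C B E); rewrite repV.
Qed.

Lemma frinv_rep A B C E : frinv (rep A B C E) = rep A C B E.
Proof. by apply/esym/frame_inv_unique; rewrite ?repV ?frame_rep. Qed.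

(** [rep] exchanges the two middle blocks of four. The conjugate is again block lower triangular
    exactly when a12, x12 and y12 vanish, and this is how [sum_stab] reads off the intersection of
    the two parabolics. *)
Lemma conj_rep A B C E
    (a11 : 'M[F]_A) (a12 : 'M[F]_(A, B)) (a21 : 'M[F]_(B, A)) (a22 : 'M[F]_B)
    (x11 : 'M[F]_(C, A)) (x12 : 'M[F]_(C, B)) (x21 : 'M[F]_(E, A)) (x22 : 'M[F]_(E, B))
    (y11 : 'M[F]_C) (y12 : 'M[F]_(C, E)) (y21 : 'M[F]_(E, C)) (y22 : 'M[F]_E) :
  conj_mx (rep A B C E) (block_mx (block_mx a11 a12 a21 a22) 0
     (block_mx x11 x12 x21 x22) (block_mx y11 y12 y21 y22)) =
  block_mx (block_mx a11 0 x11 y11) (block_mx a12 0 x12 y12)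
           (block_mx a21 0 x21 y21) (block_mx a22 0 x22 y22).
Proof.
rewrite /conj_mx frinv_rep /rep !mulmx_block.
do 2![rewrite ?mulmx_block !(mul0mx, mulmx0, addr0, add0r, mul1mx, mulmx1, add_block_mx, block_mx0)].
by [].
Qed.

End DoubleCosets.

Section Classification.

Variable F : finFieldType.

Lemma frame_full p n (Z : 'M[F]_(p, n)) : p = n -> row_full Z -> frame Z.
Proof. by move=> e; subst p; rewrite frame_square -row_full_unit. Qed.

Lemma row_base_rank m n k (M : 'M[F]_(m, n)) : \rank M = k ->
  exists2 K : 'M_(k, n), row_free K & (K :=: M)%MS.
Proof.
by move=> e; subst k; exists (row_base M); [apply: row_base_free | apply: eq_row_base].
Qed.

Lemma frame_completion k l (N : 'M[F]_(k, k + l)) :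
  row_free N -> exists N' : 'M_(l, k + l), frame (col_mx N N').
Proof.
move=> /eqP rN; have rC : \rank (N^C)%MS = l by rewrite mxrank_compl rN addKn.
have [N' _ eN'] := row_base_rank rC; exists N'; apply: frame_full => //.
by rewrite -sub1mx -addsmxE (adds_eqmx (eqmx_refl N) eN') sub1mx addsmx_compl_full.
Qed.

Lemma kernel_frame k l n (U : 'M[F]_(k + l, n)) : \rank U = l ->
  exists2 K : 'M_(k, k + l), row_free K & K *m U = 0.
Proof.
move=> rU; have rK : \rank (kermx U) = k by rewrite mxrank_ker rU addnK.
have [K fK eK] := row_base_rank rK.
by exists K => //; apply/sub_kermxP; rewrite eK.
Qed.

(** Row reduction in the upper half (U1, U2) of Z. The rows of [KA] span the left kernel of U2, and
    [KC] completes them; [KA *m U1] and [KC *m U2] are then free, and their completions to bases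
    form the diagonal blocks of T. By construction the upper half of [rep *m T] is [Kf] times that
    of Z, so Z times the inverse of [rep *m T] is block lower triangular. *)
Lemma double_cosetP A B C E (Z : 'M[F]_((A + C) + (B + E), (A + B) + (C + E))) :
  frame Z -> \rank (ursubmx Z) = C ->
  exists p' p, [/\ para p', para p & Z = p' *m rep F A B C E *m p].
Proof.
move=> fZ rU; pose U1 := ulsubmx Z; pose U2 := ursubmx Z.
have [KA fKA KA0] := kernel_frame rU.
have [KC fK] := frame_completion fKA.
set Kf := col_mx KA KC in fK.
have eZu : usubmx Z = row_mx U1 U2 by rewrite /U1 /U2 hsubmxK.
have fNA : row_free (KA *m U1).
  have /andP[freeZ _] := fZ.
  have e : row_mx KA 0 *m Z = row_mx (KA *m U1) 0.
    by rewrite -{1}[Z]vsubmxK mul_row_col mul0mx addr0 eZu mul_mx_row KA0.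
  have := mxrankMfree (row_mx KA 0 : 'M_(A, A + C + (B + E))) freeZ.
  by rewrite e !rank_row_mx0 (eqP fKA) => /eqP.
have [NB fT1] := frame_completion fNA.
have fNC : row_free (KC *m U2).
  have /andP[freeK fullK] := fK.
  have := rank_col_0mx A (KC *m U2).
  have -> : col_mx 0 (KC *m U2) = Kf *m U2 by rewrite mul_col_mx KA0.
  by rewrite (eqmxMfull U2 fullK) rU => /esym/eqP.
have [NE fT4] := frame_completion fNC.
pose T := block_mx (col_mx (KA *m U1) NB) 0 (col_mx (KC *m U1) 0) (col_mx (KC *m U2) NE).
have pT : para T by rewrite para_lblock -!frame_square fT1.
have fT := para_frame pT.
pose Y := rep F A B C E *m T; have fY : frame Y by rewrite frame_mul ?frame_rep.
have eY : usubmx Y = Kf *m usubmx Z.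
  rewrite /Y /rep /T mulmx_block block_mxEv col_mxKu eZu mul_mx_row !mulmx0 add0r.
  congr row_mx; rewrite !mul_block_col !(mul1mx, mul0mx, addr0, add0r).
    by rewrite mul_col_mx add_col_mx addr0 add0r.
  by rewrite mul_col_mx KA0.
exists (Z *m frinv Y), T; split=> //; last first.
  by rewrite -mulmxA -/Y -mulmxA (frameK fY) mulmx1.
rewrite /para -frame_square frame_mul ?frame_frinv //=.
rewrite /ursubmx -mul_usub_mx; have -> : usubmx Z = frinv Kf *m usubmx Y.
  by rewrite eY mulmxA (frameK fK) mul1mx.
rewrite -mulmxA mul_usub_mx (frameV fY) scalar_mx_block block_mxEv col_mxKu.
by rewrite mul_mx_row row_mxKr mulmx0.
Qed.

Lemma rank_ursub_para m r m' s (Z : 'M[F]_(m' + s, m + r)) p' p :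
  para p' -> para p -> \rank (ursubmx (p' *m Z *m p)) = \rank (ursubmx Z).
Proof.
case/paraP=> [A [X [B [uA uB ->]]]] /paraP[A' [X' [B' [uA' uB' ->]]]].
rewrite -[Z]submxK !mulmx_block !block_mxKur !(mul0mx, mulmx0, addr0, add0r).
by rewrite mxrankMfree ?row_free_unit // (eqmxMfull _) // row_full_unit.
Qed.

Lemma ursub_rep A B C E : ursubmx (rep F A B C E) = block_mx 0 0 1%:M 0.
Proof. by rewrite block_mxKur. Qed.

Lemma rank_ursub_rep A B C E : \rank (ursubmx (rep F A B C E)) = C.
Proof.
by rewrite ursub_rep block_mxEv row_mx0 rank_col_0mx rank_row_mx0 mxrank1.
Qed.

End Classification.

Section Counting.

Variable F : finFieldType.
Local Notation colour := (colour F).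
Local Notation fam := (forall n, 'M[F]_n -> algC).

Implicit Types (f g : fam).

Lemma sum_para (R : nmodType) m r (G : 'M[F]_(m + r) -> R) :
  \sum_(Y | para Y) G Y =
  \sum_(A : 'M[F]_m | A \in unitmx) \sum_(B : 'M[F]_r | B \in unitmx)
    \sum_(X : 'M[F]_(r, m)) G (block_mx A 0 X B).
Proof. exact: sum_parabolic. Qed.

Lemma card_para m r : #|[pred Y : 'M[F]_(m + r) | para Y]| = Psize F m r.
Proof.
have := @sum_para nat m r (fun=> 1%N).
rewrite -sum1_card => ->; rewrite (eq_bigr (fun=> (gl F r * #|F| ^ (r * m))%N)).
  by rewrite sum_nat_const mulnA.
move=> A _; rewrite (eq_bigr (fun=> (#|F| ^ (r * m))%N)) ?sum_nat_const //.
by move=> B _; rewrite -card_mx muln1.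
Qed.

Lemma sum_dlblock (R : nmodType) m m' r s (G : 'M[F]_(m + m', r + s) -> R) :
  \sum_(X | ursubmx X == 0) G X =
  \sum_(X : 'M[F]_(m, r)) \sum_(Y : 'M[F]_(m', r)) \sum_(Z : 'M[F]_(m', s))
    G (block_mx X 0 Y Z).
Proof.
rewrite pair_big pair_big_dep /=.
pose h (u : 'M[F]_(m, r) * 'M[F]_(m', r) * 'M[F]_(m', s)) := block_mx u.1.1 0 u.1.2 u.2.
pose k (Y : 'M[F]_(m + m', r + s)) := (ulsubmx Y, dlsubmx Y, drsubmx Y).
rewrite (reindex_onto h k) /=; last by move=> Y /eqP ur0; rewrite /h /k /= -ur0 submxK.
apply: eq_bigl => -[[X Y] Z]; rewrite /h /k /=.
by rewrite block_mxKur eqxx block_mxKul block_mxKdr block_mxKdl eqxx.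
Qed.

Section Stabiliser.

Variables A B C E : nat.

Definition stab : pred 'M[F]_((A + B) + (C + E)) :=
  [pred Y | para Y && para (conj_mx (rep F A B C E) Y)].

Lemma sum_stab (R : nmodType) (G : 'M[F]_((A + B) + (C + E)) -> R) :
  \sum_(Y | stab Y) G Y =
  \sum_(gA : 'M[F]_A | gA \in unitmx) \sum_(gB : 'M[F]_B | gB \in unitmx)
  \sum_(gBA : 'M[F]_(B, A))
  \sum_(gC : 'M[F]_C | gC \in unitmx) \sum_(gE : 'M[F]_E | gE \in unitmx)
  \sum_(gEC : 'M[F]_(E, C))
  \sum_(gCA : 'M[F]_(C, A)) \sum_(gEA : 'M[F]_(E, A)) \sum_(gEB : 'M[F]_(E, B))
    G (block_mx (block_mx gA 0 gBA gB) 0 (block_mx gCA 0 gEA gEB) (block_mx gC 0 gEC gE)).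
Proof.
rewrite big_mkcondr sum_para /=.
transitivity (\sum_(Y1 : 'M[F]_(A + B) | para Y1) \sum_(Y2 : 'M[F]_(C + E) | para Y2)
   \sum_(X : 'M[F]_(C + E, A + B) | ursubmx X == 0) G (block_mx Y1 0 X Y2)).
  rewrite [RHS]big_mkcondr; apply: eq_bigr => Y1 uY1.
  case: eqP => [ur1|nur1]; last first.
    rewrite big1 // => Y2 uY2; rewrite big1 // => X _; case: ifP => // /andP[_].
    rewrite -[Y1]submxK -[Y2]submxK -[X]submxK conj_rep block_mxKur.
    by rewrite block_mx_eq0 => /and4P[/eqP/nur1].
  rewrite [RHS]big_mkcondr; apply: eq_bigr => Y2 uY2.
  case: eqP => [ur2|nur2]; last first.
    rewrite big1 // => X _; case: ifP => // /andP[_].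
    rewrite -[Y1]submxK -[Y2]submxK -[X]submxK conj_rep block_mxKur.
    by rewrite block_mx_eq0 => /and4P[_ _ _ /eqP/nur2].
  rewrite [RHS]big_mkcond; apply: eq_bigr => X _.
  rewrite /para conj_mx_unit ?frame_rep // unitmx_lblock uY1 uY2 /=.
  rewrite -[in conj_mx _ _](submxK Y1) -[in conj_mx _ _](submxK Y2) -[in conj_mx _ _](submxK X).
  rewrite conj_rep block_mxKur ur1 ur2.
  by rewrite block_mx_eq0 !eqxx andbT.
rewrite sum_para; apply: eq_bigr => gA _; apply: eq_bigr => gB _.
apply: eq_bigr => gBA _; rewrite sum_para; apply: eq_bigr => gC _.
apply: eq_bigr => gE _; apply: eq_bigr => gEC _.
exact: sum_dlblock.
Qed.

Lemma card_stab :
  #|stab| = (gl F A * (gl F B * #|F| ^ (B * A)) * (gl F C * #|F| ^ (C * A)) *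
             (gl F E * (#|F| ^ (E * C) * #|F| ^ (E * A) * #|F| ^ (E * B))))%N.
Proof.
have csum (I : finType) (k : nat) : (\sum_(i : I) k = #|I| * k)%N by rewrite sum_nat_const.
have gsum p k : (\sum_(g : 'M[F]_p | g \in unitmx) k = gl F p * k)%N.
  by rewrite sum_nat_const.
rewrite -sum1_card (sum_stab (fun=> 1%N)).
do !under eq_bigr => ? _ do rewrite ?csum ?gsum.
rewrite !card_mx muln1 gsum; set q := #|F|.
by nia.
Qed.

Lemma card_stab_neq0 : #|stab|%:R != 0 :> algC.
Proof.
rewrite pnatr_eq0 -lt0n; apply/card_gt0P; exists 1%:M.
by rewrite inE para1 conj_mx_id ?frame_rep // para1.
Qed.

Section Value.

Variables (f f' : fam) (a b : colour).

Lemma Psi_stab :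
  Psi f f' b a (rep F A B C E) =
  \sum_(Y | stab Y) pfun b (@f _) Y * (pfun a (@f' _) (conj_mx (rep F A B C E) Y))^*.
Proof.
rewrite /Psi [LHS](bigID (fun Y => (ursubmx Y == 0) &&
  (ursubmx (conj_mx (rep F A B C E) Y) == 0))) /= [X in _ + X]big1 ?addr0.
  apply: eq_bigl => Y; rewrite /stab /= /para conj_mx_unit ?frame_rep //.
  by case: (Y \in unitmx).
move=> Y /andP[_]; rewrite negb_and /pfun.
by case/orP => /negPf ->; rewrite ?mul0r ?conjC0 ?mulr0.
Qed.

(** On [stab] the summand factors through the diagonal blocks. The sum over block B turns f into
    [hc_res B a f], the sum over block C turns f' into [hc_res C b f'], and block E, where the two
    colours meet, gives the orthogonality relation [sum_gl_ch]. The remaining blocks below E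
    contribute only their number. *)
Lemma Psi_rep :
  Psi f f' b a (rep F A B C E) =
  #|stab|%:R * (ip (hc_res B a f (n := A)) (hc_res C b f' (n := A)) *+ ((E == 0) || (a == b))%N).
Proof.
rewrite Psi_stab sum_stab.
pose u (gA : 'M[F]_A) (gB : 'M[F]_B) (gBA : 'M[F]_(B, A)) :=
  (ch a (\det gB))^* * f (block_mx gA 0 gBA gB).
pose v (gA : 'M[F]_A) (gC : 'M[F]_C) (gCA : 'M[F]_(C, A)) :=
  (ch b (\det gC))^* * f' (block_mx gA 0 gCA gC).
pose w (gE : 'M[F]_E) := ch b (\det gE) * (ch a (\det gE))^*.
transitivity (\sum_(gA : 'M[F]_A | gA \in unitmx) \sum_(gB : 'M[F]_B | gB \in unitmx)
  \sum_(gBA : 'M[F]_(B, A))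
  \sum_(gC : 'M[F]_C | gC \in unitmx) \sum_(gE : 'M[F]_E | gE \in unitmx)
  \sum_(gEC : 'M[F]_(E, C))
  \sum_(gCA : 'M[F]_(C, A)) \sum_(gEA : 'M[F]_(E, A)) \sum_(gEB : 'M[F]_(E, B))
    (u gA gB gBA * ((v gA gC gCA)^* * w gE))).
  apply: eq_bigr => gA _; apply: eq_bigr => gB uB; apply: eq_bigr => gBA _.
  apply: eq_bigr => gC uC; apply: eq_bigr => gE uE; apply: eq_bigr => gEC _.
  apply: eq_bigr => gCA _; apply: eq_bigr => gEA _; apply: eq_bigr => gEB _.
  rewrite conj_rep block_mx0 !pfun_lblock !det_lblock !chM -?unitfE -?unitmxE //.
  rewrite /u /v /w !rmorphM /= conjCK; ring.
have card_const (I : finType) (x : algC) : \sum_(i : I) x = #|I|%:R * x.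
  by rewrite sumr_const mulr_natl.
pose S := \sum_(gA : 'M[F]_A | gA \in unitmx)
  (\sum_(gB | gB \in unitmx) \sum_gBA u gA gB gBA) *
  (\sum_(gC | gC \in unitmx) \sum_gCA v gA gC gCA)^*.
transitivity (S * (\sum_(gE | gE \in unitmx) w gE) *
  (#|F| ^ (E * C) * #|F| ^ (E * A) * #|F| ^ (E * B))%:R).
  have [W eW] : {W | W = \sum_(gE | gE \in unitmx) w gE} by eexists.
  rewrite -eW; set K := _%:R.
  rewrite /S !mulr_suml; apply: eq_bigr => gA _.
  rewrite !mulr_suml; apply: eq_bigr => gB _.
  rewrite !mulr_suml; apply: eq_bigr => gBA _.
  rewrite rmorph_sum /= mulr_sumr !mulr_suml; apply: eq_bigr => gC _.
  rewrite eW mulr_sumr mulr_suml; apply: eq_bigr => gE _.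
  rewrite card_const rmorph_sum /= !mulr_sumr !mulr_suml; apply: eq_bigr => gCA _.
  by rewrite !card_const !card_mx /K !natrM; ring.
have -> : S = (gl F A * (gl F B * #|F| ^ (B * A)) * (gl F C * #|F| ^ (C * A)))%:R *
   ip (hc_res B a f (n := A)) (hc_res C b f' (n := A)).
  rewrite /S /ip mulr_sumr mulr_sumr; apply: eq_bigr => gA _.
  rewrite /hc_res [((_%:R)^-1 * _)^*]rmorphM /= fmorphV /= rmorph_nat /u /v !natrM.
  have nz p : (#|F| ^ p)%:R != 0 :> algC by rewrite pnatr_eq0 -lt0n expn_gt0 q_gt0.
  by field; rewrite !nz !gl_neq0.
rewrite /w sum_gl_ch card_stab !natrM [b == a]eq_sym.
by case: (_ || _); rewrite ?mulr1n ?mulr0n; ring.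
Qed.

End Value.

End Stabiliser.

End Counting.

Section Mackey.

Variable F : finFieldType.
Local Notation colour := (colour F).
Local Notation fam := (forall n, 'M[F]_n -> algC).

Variables (f f' : fam) (a b : colour).
Hypotheses (cf : cls f) (cf' : cls f').

Lemma sum_para_const m r (c : algC) :
  \sum_(Y : 'M[F]_(m + r) | para Y) c = (Psize F m r)%:R * c.
Proof. by rewrite sumr_const mulr_natl -card_para; congr (_ *+ _); apply: eq_card. Qed.

Section OneCoset.

Variables A B C E : nat.
Let x := rep F A B C E.
Arguments para : simpl never.

(** Double counting: among the products p' x p, every Z of the double coset occurs [#|stab|]
    times. *)
Lemma sum_double_coset :
  #|@stab F A B C E|%:R *
  (\sum_(Z : 'M[F]_((A + C) + (B + E), (A + B) + (C + E)) |
      frame Z && (\rank (ursubmx Z) == C)) Psi f f' b a Z) =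
  (Psize F (A + B) (C + E))%:R * (Psize F (A + C) (B + E))%:R * Psi f f' b a x.
Proof.
have fx : frame x := frame_rep F A B C E.
transitivity (\sum_(p : 'M[F]_((A + B) + (C + E)) | para p)
  \sum_(p' : 'M[F]_((A + C) + (B + E)) | para p') Psi f f' b a (p' *m x *m p)); last first.
  rewrite (eq_bigr (fun=> (Psize F (A + C) (B + E))%:R * Psi f f' b a x)).
    by rewrite sum_para_const mulrA.
  move=> p pp; rewrite (eq_bigr (fun=> Psi f f' b a x)).
    by rewrite sum_para_const.
  by move=> p' pp'; apply: Psi_para.
transitivity (\sum_(p : 'M[F]_((A + B) + (C + E)) | para p)
  \sum_(Z : 'M[F]_((A + C) + (B + E), (A + B) + (C + E)) |
     frame Z && para (Z *m frinv (x *m p))) Psi f f' b a Z); last first.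
  apply: eq_bigr => p pp; have fxp := frame_mul fx (para_frame pp).
  rewrite [LHS](reindex_onto (fun p' => p' *m x *m p) (fun Z => Z *m frinv (x *m p))) /=.
    apply: eq_bigl => p'; rewrite -mulmxA -(mulmxA p') (frameV fxp) mulmx1 eqxx andbT.
    by apply: andb_idl => /para_frame fp'; apply: frame_mul.
  by move=> Z _; rewrite -mulmxA -(mulmxA Z) (frameK fxp) mulmx1.
rewrite mulr_sumr (exchange_big_dep (fun Z => frame Z)) /=; last by move=> p Z _ /andP[].
rewrite [RHS](bigID (fun Z => \rank (ursubmx Z) == C)) /= [X in _ = _ + X]big1 ?addr0.
  apply: eq_bigr => Z /andP[fZ /eqP rZ].
  rewrite sumr_const mulr_natl; congr (_ *+ _).
  have [p0' [p0 [pp0' pp0 eZ]]] := double_cosetP fZ rZ.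
  have fp0 := para_frame pp0.
  (* With Z = p0' x p0 fixed, the factorisations Z = p' x p correspond to the elements t = p0 p^-1
     of [stab]. *)
  rewrite -!sum1_card (reindex_onto (fun p => p0 *m frinv p) (fun t => frinv t *m p0)) /=.
    apply: eq_bigl => p; rewrite /stab !inE fZ /=.
    transitivity (para p && para (Z *m frinv (x *m p))); last by [].
    have [pp|npp] := boolP (para p); last first.
      apply/negbTE/negP => /andP[/andP[pt _] /eqP e].
      by case/negP: npp; rewrite -e; apply: para_mul => //; apply: para_frinv.
    have fp := para_frame pp; have pip := para_frinv pp.
    have fip := frame_frinv fp.
    rewrite (para_mul pp0 pip) /= frinv_mul // frinvK // -mulmxA (frameK fp0) mulmx1 eqxx andbT.
    have -> : Z *m frinv (x *m p) = p0' *m conj_mx x (p0 *m frinv p).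
      by rewrite eZ /conj_mx frinv_mul // !mulmxA.
    have fp0' := para_frame pp0'.
    apply/idP/idP => [|pW]; first exact: para_mul.
    rewrite -[conj_mx _ _]mul1mx -(frameK fp0') -mulmxA.
    by apply: para_mul pW; apply: para_frinv.
  move=> t; rewrite inE => /andP[/para_frame ft _].
  by rewrite frinv_mul ?frame_frinv // frinvK // mulmxA (frameV fp0) mul1mx.
move=> Z /andP[fZ nr]; rewrite big_pred0 // => p; rewrite fZ /=.
apply/negP => /andP[pp pp']; case/negP: nr.
have -> : Z = (Z *m frinv (x *m p)) *m x *m p.
  by rewrite -mulmxA -mulmxA (frameK (frame_mul fx (para_frame pp))) mulmx1.
by rewrite rank_ursub_para // rank_ursub_rep.
Qed.

Lemma double_coset_value :
  (Psize F (A + B) (C + E))%:R^-1 * (Psize F (A + C) (B + E))%:R^-1 *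
  (\sum_(Z : 'M[F]_((A + C) + (B + E), (A + B) + (C + E)) |
      frame Z && (\rank (ursubmx Z) == C)) Psi f f' b a Z) =
  ip (hc_res B a f (n := A)) (hc_res C b f' (n := A)) *+ ((E == 0) || (a == b))%N.
Proof.
have := sum_double_coset; rewrite Psi_rep; set S := \sum_(Z | _) _; set v := _ *+ _.
have := card_stab_neq0 F A B C E; have := Psize_neq0 F (A + B) (C + E).
have := Psize_neq0 F (A + C) (B + E) => nz1 nz2 nz3 e.
apply: (mulfI nz3); rewrite mulrCA e.
by field; rewrite nz1 nz2.
Qed.

End OneCoset.

Lemma rank_ursub_ge m r m' s (Z : 'M[F]_(m' + s, m + r)) :
  frame Z -> (r <= \rank (ursubmx Z) + s)%N.
Proof.
move=> fZ; have rr : \rank (rsubmx Z) = r.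
  have -> : rsubmx Z = Z *m col_mx 0 1%:M.
    by rewrite -{2}[Z]hsubmxK mul_row_col mulmx0 mulmx1 add0r.
  by case/andP: (fZ) => _ fu; rewrite (eqmxMfull _ fu) rank_col_0mx mxrank1.
rewrite -{1}rr -[rsubmx Z]vsubmxK -addsmxE; apply: leq_trans (mxrank_adds_leqif _ _) _.
rewrite leq_add ?rank_leq_row //.
by rewrite /ursubmx; apply/eq_leq; congr (\rank _); apply/matrixP => i j; rewrite !mxE.
Qed.

(** The double coset whose upper right block has rank C gives the term j = r - C, with A = m' - C
    and B = s - j. Here j is the size of the diagonal block on which the two colours meet, so they
    must agree when j > 0. *)
Lemma mackey_ip m r m' s : (m + r = m' + s)%N ->
  ip (@hc_ind _ r b f (m + r)) (@hc_ind _ s a f' (m + r)) =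
  \sum_(j < s.+1 | [&& j <= r, r - j <= m' & (j == 0 :> nat) || (a == b)]%N)
    ip (hc_res (s - j) a f (n := m' - (r - j))) (hc_res (r - j) b f' (n := m' - (r - j))).
Proof.
move=> e; rewrite (ip_hc_ind _ _ _ _ e).
rewrite (partition_big (fun Z : 'M_(_, _) => inord (r - \rank (ursubmx Z)) : 'I_s.+1)
   (fun j => (j <= r) && (r - j <= m'))%N) /=; last first.
  move=> Z fZ; have := rank_ursub_ge fZ; have := rank_leq_row (ursubmx Z).
  have := rank_leq_col (ursubmx Z); set c := \rank _ => lec lec' le.
  by rewrite inordK ?leq_subr ?subKn ?lec' // ltnS leq_subLR.
rewrite mulr_sumr [LHS]big_mkcond [RHS]big_mkcond; apply: eq_bigr => -[j /= ltj] _.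
case: leqP => //= lejr; case: leqP => //= lerj.
have [A eA] : exists A, A = (m' - (r - j))%N by exists (m' - (r - j))%N.
have [B eB] : exists B, B = (s - j)%N by exists (s - j)%N.
have [C eC] : exists C, C = (r - j)%N by exists (r - j)%N.
rewrite -eA -eB -eC.
have em : m = (A + B)%N by lia.
have er : r = (C + j)%N by lia.
have em' : m' = (A + C)%N by lia.
have es : s = (B + j)%N by lia.
subst m r m' s; rewrite -mulrb -double_coset_value; congr (_ * _).
apply: eq_bigl => Z; have [fZ|//] := boolP (frame Z).
have := rank_ursub_ge fZ; have := rank_leq_col (ursubmx Z) => h1 h2 /=.
rewrite -val_eqE /= inordK; last by rewrite ltnS; lia.
by apply/eqP/eqP; lia.
Qed.

End Mackey.

Section InnerProduct.

Variable F : finFieldType.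
Local Notation colour := (colour F).
Local Notation fam := (forall n, 'M[F]_n -> algC).

Implicit Types (f g : fam).

Lemma eq_ip n (f f' g g' : 'M[F]_n -> algC) :
  (forall A, A \in unitmx -> f A = f' A) -> (forall A, A \in unitmx -> g A = g' A) ->
  ip f g = ip f' g'.
Proof.
by move=> ef eg; congr (_ * _); apply: eq_bigr => A uA; rewrite ef ?eg.
Qed.

Lemma ipC n (f g : 'M[F]_n -> algC) : ip f g = (ip g f)^*.
Proof.
rewrite /ip rmorphM /= fmorphV /= rmorph_nat rmorph_sum; congr (_ * _).
by apply: eq_bigr => A _; rewrite rmorphM /= conjCK mulrC.
Qed.

Lemma ip_suml n (I : Type) (r : seq I) (P : pred I) (c : I -> algC)
    (f : I -> 'M[F]_n -> algC) (g : 'M[F]_n -> algC) :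
  ip (fun A => \sum_(i <- r | P i) c i * f i A) g = \sum_(i <- r | P i) c i * ip (f i) g.
Proof.
rewrite /ip; under eq_bigr do rewrite mulr_suml.
rewrite exchange_big mulr_sumr; apply: eq_bigr => i _ /=.
by rewrite [RHS]mulrCA [in RHS]mulr_sumr; congr (_ * _); apply: eq_bigr => A _; rewrite mulrA.
Qed.

Lemma ip_sumr n (I : Type) (r : seq I) (P : pred I) (c : I -> algC)
    (f : I -> 'M[F]_n -> algC) (g : 'M[F]_n -> algC) :
  ip g (fun A => \sum_(i <- r | P i) c i * f i A) =
  \sum_(i <- r | P i) (c i)^* * ip g (f i).
Proof.
rewrite ipC ip_suml rmorph_sum; apply: eq_bigr => i _ /=.
by rewrite rmorphM /= -ipC.
Qed.

Lemma ipZl n (x : algC) (f g : 'M[F]_n -> algC) : ip (fun A => x * f A) g = x * ip f g.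
Proof. rewrite /ip [RHS]mulrCA [in RHS]mulr_sumr; congr (_ * _); by apply: eq_bigr => A _; rewrite mulrA. Qed.

Lemma ipBl n (f f' g : 'M[F]_n -> algC) :
  ip (fun A => f A - f' A) g = ip f g - ip f' g.
Proof.
by rewrite /ip -mulrBr -sumrB; congr (_ * _); apply: eq_bigr => A _; rewrite mulrBl.
Qed.

Lemma ipBr n (f g g' : 'M[F]_n -> algC) :
  ip f (fun A => g A - g' A) = ip f g - ip f g'.
Proof. by rewrite ipC ipBl rmorphB /= -!ipC. Qed.

(** Positive definiteness. Identities between families are proved by applying it to the difference
    of the two sides. *)
Lemma ip_eq0 n (f : 'M[F]_n -> algC) :
  ip f f = 0 -> forall A, A \in unitmx -> f A = 0.
Proof.
move/eqP; rewrite mulf_eq0 invr_eq0 (negPf (gl_neq0 F n)) /=.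
rewrite psumr_eq0 => [/allP z0 A uA|A _]; last exact: mul_conjC_ge0.
by have := z0 A; rewrite mem_index_enum uA /= mul_conjC_eq0 => /(_ isT)/eqP.
Qed.

Lemma ip0l n (f g : 'M[F]_n -> algC) :
  (forall A, A \in unitmx -> f A = 0) -> ip f g = 0.
Proof. by move=> f0; rewrite /ip big1 ?mulr0 // => A uA; rewrite f0 ?mul0r. Qed.

Lemma ip0r n (f g : 'M[F]_n -> algC) :
  (forall A, A \in unitmx -> g A = 0) -> ip f g = 0.
Proof. by move=> g0; rewrite ipC ip0l ?conjC0. Qed.

Lemma cls_sum (I : Type) (r : seq I) (P : pred I) (c : I -> algC) (f : I -> fam) :
  (forall i, cls (f i)) -> cls (fun n (A : 'M_n) => \sum_(i <- r | P i) c i * f i n A).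
Proof. by move=> cf p n Z A fZ uA; apply: eq_bigr => i _; rewrite cf. Qed.

Lemma hc_res_cls r (a : colour) f : cls f -> cls (hc_res r a f).
Proof.
move=> cf p n Z A fZ uA; have e := frame_dim fZ; subst p.
rewrite /hc_res; congr (_ * _); apply: eq_bigr => B uB.
have fiZ := frame_frinv fZ; rewrite -[LHS]/(\sum_X _).
rewrite (reindex_onto (fun X => X *m frinv Z) (fun X => X *m Z)) /=; last first.
  by move=> X _; rewrite -mulmxA (frameV fZ) mulmx1.
apply: eq_big => [X|X _]; first by rewrite -mulmxA (frameK fZ) mulmx1 eqxx.
congr (_ * _).
have fZ1 : frame (block_mx Z 0 0 (1%:M : 'M_r)).
  by rewrite frame_square unitmx_lblock -frame_square fZ unitmx1.
rewrite -[RHS](cf _ _ _ _ fZ1) ?unitmx_lblock ?uA //.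
rewrite /conj_mx frinv_lblock ?unitmx1 // -?frame_square //.
rewrite !mulmx_block !(mul0mx, mulmx0, addr0, add0r, mul1mx, mulmx1, oppr0).
congr (f _ (block_mx _ _ _ _)).
have -> : frinv (1%:M : 'M[F]_r) = 1%:M.
  by apply/esym/frame_inv_unique; rewrite ?mulmx1 ?frame1.
by rewrite mulmx1.
Qed.

Lemma frobenius_l m r (a : colour) f g : cls f ->
  ip (@hc_res _ r a f m) (@g m) = ip (@f (m + r)%N) (@hc_ind _ r a g (m + r)).
Proof. by move=> cf; rewrite ipC -frobenius // -ipC. Qed.

(** The trivial character of the trivial group, in size 0: the empty product for Harish-Chandra
    induction. *)
Definition unit_fam : fam := fun n _ => (n == 0)%:R.

Lemma unit_fam_cls : cls unit_fam.
Proof. by move=> p n Z A fZ _; rewrite /unit_fam (frame_dim fZ). Qed.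

Lemma hc_res0 (a : colour) f n (A : 'M_n) : cls f -> A \in unitmx -> hc_res 0 a f A = f n A.
Proof.
move=> cf uA; have fZ : frame (col_mx 1%:M 0 : 'M[F]_(n + 0, n)).
  apply: frame_full; first by rewrite addn0.
  apply/row_fullP; exists (row_mx 1%:M 0).
  by rewrite mul_row_col mulmx1 mulmx0 addr0.
have eZ : frinv (col_mx 1%:M 0 : 'M[F]_(n + 0, n)) = row_mx 1%:M 0.
  apply/esym/frame_inv_unique => //; rewrite mul_col_row !mulmx0 mul0mx mulmx1.
  by rewrite scalar_mx_block; congr block_mx; apply/matrixP => -[].
rewrite /hc_res (bigD1 1%:M) ?unitmx1 //= [X in _ + X]big_pred0 ?addr0; last first.
  by move=> B; rewrite [B]flatmx0 [1%:M]flatmx0 eqxx andbF.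
rewrite (bigD1 0) //= [X in _ + X]big_pred0 ?addr0; last first.
  by move=> B; rewrite [B]flatmx0 eqxx.
rewrite det_mx00 ch1 conjC1 mul1r mul0n expn0 muln1.
have -> : gl F 0 = 1%N.
  have -> : 1%N = #|'M[F]_0| by rewrite card_mx.
  by apply: eq_card => B; rewrite !inE unitmxE det_mx00 unitr1.
rewrite invr1 mul1r -(cf _ _ _ _ fZ uA); congr (f _ _).
rewrite /conj_mx eZ mul_col_mx mul1mx mul0mx mul_col_row mulmx1 !mulmx0 mul0mx.
by congr block_mx; apply/matrixP => -[].
Qed.

End InnerProduct.

(** * Jacobi-Trudi determinants *)

Section Rows.

Variable F : finFieldType.
Local Notation colour := (colour F).
Local Notation fam := (forall n, 'M[F]_n -> algC).

Variables (I : finType) (c : I -> colour).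
Implicit Types (gam : I -> int) (L : seq I).

(** The convention of Jacobi-Trudi determinants that complete symmetric functions of negative index
    vanish. *)
Definition hc_indz (z : int) (a : colour) (f : fam) : fam :=
  match z with Posz r => hc_ind r a f | Negz _ => fun n _ => 0 end.

(** The analogue of a product of complete symmetric functions h_(gam i), the factor i having colour
    c i. *)
Definition hrow L gam : fam := foldr (fun i => hc_indz (gam i) (c i)) (@unit_fam F) L.

Lemma hc_indz_cls z a f : cls (hc_indz z a f).
Proof. by case: z => [r|r] //; apply: hc_ind_cls. Qed.

Lemma hrow_cls L gam : cls (hrow L gam).
Proof. by case: L => [|i L]; [apply: unit_fam_cls | apply: hc_indz_cls]. Qed.

Lemma eq_hrow L gam gam' : {in L, gam =1 gam'} -> hrow L gam = hrow L gam'.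
Proof.
elim: L => //= i L IH e; rewrite IH => [|j Lj]; last by rewrite e // inE Lj orbT.
by rewrite e // inE eqxx.
Qed.

Lemma hrow_neg L gam i n (A : 'M_n) : i \in L -> (gam i < 0)%R -> hrow L gam A = 0.
Proof.
move=> Li gi; elim: L Li n A => //= j L IH; rewrite inE.
case/orP => [/eqP <-|Li] n A; first by move: gi; case: (gam i).
case: (gam j) => [r|r] //=; rewrite /hc_ind /hc_ind_at big1 ?mulr0 // => Z _.
by rewrite /pfun IH // mul0r if_same.
Qed.

Variable K : nat.
Local Notation kap := {ffun I -> 'I_K.+1}.

(** x i is the number of boxes taken from row i. No interlacing is imposed; the unwanted terms
    cancel once the rows are antisymmetrised. K bounds the entries so that the x form a finite
    type. *)
Definition strip L a k : pred kap := fun x =>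
  [forall i, (x i != ord0) ==> (i \in L) && (c i == a)] && (\sum_i x i == k)%N.

Definition lower gam (x : kap) : I -> int := fun i => gam i - (x i)%:Z.

Definition set_at (i : I) (j : 'I_K.+1) (x : kap) : kap :=
  [ffun i' => if i' == i then j else x i'].

Lemma strip_cons i L a k (x : kap) (j : 'I_K.+1) : i \notin L -> (k <= K)%N ->
  (j <= k)%N -> x i = ord0 ->
  strip (i :: L) a k (set_at i j x) =
    ((j == ord0) || (c i == a)) && strip L a (k - j)%N x.
Proof.
move=> nL lekK lejk xi; rewrite /strip [in RHS]andbA; congr (_ && _); last first.
  rewrite (bigD1 i) //= [in RHS](bigD1 i) //= ffunE eqxx xi add0n.
  rewrite -{1}(subnKC lejk) eqn_add2l; congr (_ == _).
  by apply: eq_bigr => i' /negPf ne; rewrite ffunE ne.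
apply/forallP/andP => [all_x|[cj /forallP all_x] i'].
  split.
    have := all_x i; rewrite ffunE !eqxx inE eqxx /=.
    by case: (j == ord0).
  apply/forallP => i'; case: (eqVneq i' i) => [->|ne]; first by rewrite xi eqxx.
  by have := all_x i'; rewrite ffunE (negPf ne) inE (negPf ne).
rewrite ffunE inE; case: (eqVneq i' i) => [->|ne] /=; last exact: all_x.
by move: cj; case: (j == ord0).
Qed.

Lemma sum_strip_cons (R : nmodType) i L a k (G : kap -> R) :
  i \notin L -> (k <= K)%N ->
  \sum_(x | strip (i :: L) a k x) G x =
  \sum_(j < K.+1 | (j <= k)%N && ((j == ord0) || (c i == a)))
     \sum_(x | strip L a (k - j)%N x) G (set_at i j x).
Proof.
move=> nL lekK.
have strip0 k' (x : kap) : strip L a k' x -> x i = ord0.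
  by case/andP => /forallP/(_ i); rewrite (negPf nL) /= implybF negbK => /eqP.
rewrite (partition_big (fun x : kap => x i)
   (fun j => (j <= k)%N && ((j == ord0) || (c i == a)))) /=; last first.
  move=> x /andP[/forallP/(_ i)]; rewrite inE eqxx /= => xi /eqP <-.
  rewrite (bigD1 i) //= leq_addr /=; move: xi.
  by case: (x i == ord0).
apply: eq_bigr => j /andP[lejk cj].
rewrite (reindex_onto (set_at i j) (set_at i ord0)) /=; last first.
  move=> x /andP[_ /eqP xj]; apply/ffunP => i'; rewrite !ffunE.
  by case: eqP => // ->.
apply: eq_bigl => x; rewrite !ffunE eqxx eqxx andbT.
have [e|ne] := eqVneq (x i) ord0; last first.
  have -> : strip L a (k - j)%N x = false by apply/negP => /strip0/eqP; rewrite (negPf ne).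
  apply/negP => /andP[_ /eqP/ffunP/(_ i)]; rewrite !ffunE eqxx => /esym/eqP.
  by rewrite (negPf ne).
rewrite strip_cons // cj /=; case: strip => //=.
by apply/eqP/ffunP => i'; rewrite !ffunE; case: eqP => // ->.
Qed.

Lemma lower_set_at i gam (j : 'I_K.+1) (x : kap) : x i = ord0 -> forall i',
  lower gam (set_at i j x) i' = if i' == i then gam i - j%:Z else lower gam x i'.
Proof. by move=> xi i'; rewrite /lower ffunE; case: eqP => [->|]. Qed.

Lemma strip_nil a k (G : kap -> algC) :
  \sum_(x | strip [::] a k x) G x = G [ffun=> ord0] *+ (k == 0)%N.
Proof.
have s0 x : strip [::] a k x = (x == [ffun=> ord0]) && (k == 0)%N.
  rewrite /strip; apply/andP/andP => [[/forallP x0 /eqP <-]|[/eqP-> /eqP->]].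
    have xE : x = [ffun=> ord0].
      by apply/ffunP => i; have := x0 i; rewrite ffunE implybF negbK => /eqP.
    by rewrite xE eqxx big1 // => i _; rewrite ffunE.
  split; first by apply/forallP => i; rewrite ffunE eqxx.
  by rewrite big1 // => i _; rewrite ffunE.
rewrite (eq_bigl _ _ s0); case: (k =P 0%N) => [_|_].
  by rewrite (eq_bigl (pred1 [ffun=> ord0])) ?big_pred1_eq // => x; rewrite andbT.
by rewrite big_pred0 // => x; rewrite andbF.
Qed.

(** The adjoint of multiplication by h_k distributes over a product as h_k does under the coproduct:
    in the Mackey formula for the first row, the term j takes j boxes from that row and leaves k - j
    to be taken from the others. The induction hypothesis is applied to [hc_res (r - j) (c i) g],
    hence the quantification over g. *)
Lemma hrow_adjoint L gam a k (g : fam) n : uniq L -> (k <= K)%N -> cls g ->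
  ip (@hrow L gam (n + k)) (@hc_ind _ k a g (n + k)) =
  \sum_(x | strip L a k x) ip (@hrow L (lower gam x) n) (@g n).
Proof.
elim: L gam k g n => [|i L IH] gam k g n /=.
  move=> _ lekK cg; rewrite strip_nil /=; case: eqP => [->|/eqP k0].
    rewrite mulr1n -frobenius_l; last exact: unit_fam_cls.
    apply: eq_ip => // A uA; rewrite hc_res0 //; exact: unit_fam_cls.
  by rewrite ip0l // => A _; rewrite /unit_fam addn_eq0 (negPf k0) andbF.
case/andP => nL uL lekK cg; rewrite sum_strip_cons //.
case gi: (gam i) => [r|r]; last first.
  rewrite ip0l // big1 // => j _; rewrite big1 // => x _.
  rewrite ip0l // => A _; rewrite /lower ffunE eqxx gi.
  have -> : (Negz r - j%:Z)%R = Negz (r + j) by lia.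
  by [].
have strip0 k' (x : kap) : strip L a k' x -> x i = ord0.
  by case/andP => /forallP/(_ i); rewrite (negPf nL) /= implybF negbK => /eqP.
have [ltnr|lern] := ltnP (n + k) r.
  rewrite ip0l => [|A _]; last by rewrite /= hc_ind_neg.
  rewrite big1 // => j /andP[lejk _]; rewrite big1 // => x sx.
  rewrite ip0l // => A _; rewrite lower_set_at ?(strip0 _ _ sx) // eqxx gi.
  have -> : (Posz r - Posz j)%R = Posz (r - j) by lia.
  by rewrite /= hc_ind_neg //; lia.
have [m em] : exists m, (m + r = n + k)%N by exists (n + k - r)%N; rewrite subnK.
rewrite -em /= (mackey_ip _ _ _ _ em) //; last exact: hrow_cls.
transitivity (\sum_(j < K.+1 | [&& (j <= k)%N, (j <= r)%N, (r - j <= n)%N & (j == ord0) || (a == c i)])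
  ip (hc_res (k - j) a (hrow L gam) (n := n - (r - j))) (hc_res (r - j) (c i) g (n := n - (r - j)))).
  rewrite [LHS](big_ord_widen_cond K.+1 (fun j : nat => [&& (j <= r)%N, (r - j <= n)%N & (j == 0%N) || (a == c i)])
    (fun j : nat => ip (hc_res (k - j) a (hrow L gam) (n := n - (r - j))) (hc_res (r - j) (c i) g (n := n - (r - j))))) ?ltnS //.
  by apply: eq_bigl => j; rewrite ltnS /= andbC.
rewrite [LHS]big_mkcond [RHS]big_mkcond; apply: eq_bigr => j _.
rewrite [c i == a]eq_sym; have [lejk|//] /= := leqP j k.
case: ifP => [/and3P[lejr lern' ->]|]; last first.
  case: (_ || _); rewrite ?andbT ?andbF //= => nrn.
  rewrite big1 // => x sx; rewrite ip0l // => A _.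
  rewrite lower_set_at ?(strip0 _ _ sx) // eqxx gi.
  have [lejr|ltrj] := leqP j r; last first.
    by have [p ->] : exists p, (Posz r - Posz j)%R = Negz p by exists (j - r - 1)%N; lia.
  have -> : (Posz r - Posz j)%R = Posz (r - j) by lia.
  by rewrite /= hc_ind_neg //; move: nrn; rewrite lejr /=; lia.
have en : n = (n - (r - j) + (r - j))%N by rewrite subnK.
rewrite frobenius_l; last exact: hrow_cls.
rewrite IH //; [|exact: leq_trans (leq_subr _ _) lekK|exact: hc_res_cls].
apply: eq_bigr => x sx.
rewrite -frobenius // lower_set_at ?(strip0 _ _ sx) // eqxx gi.
have -> : (Posz r - Posz j)%R = Posz (r - j) by lia.
rewrite -en /=; congr (ip (hc_ind (r - j) (c i) _ (n := n)) _).
apply: eq_hrow => i' Li'; rewrite lower_set_at ?(strip0 _ _ sx) //.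
by case: eqP => // e; rewrite -e Li' in nL.
Qed.

End Rows.

Section RowSymmetry.

Variable F : finFieldType.
Local Notation colour := (colour F).
Local Notation fam := (forall n, 'M[F]_n -> algC).

Variables (I : finType) (c : I -> colour).
Implicit Types (gam : I -> int) (L : seq I).
Local Notation hrow := (hrow c).

Lemma hc_ind0 a (f : fam) n (A : 'M_n) : cls f -> A \in unitmx -> hc_ind 0 a f A = f n A.
Proof.
move=> cf uA; apply/eqP; rewrite -subr_eq0; apply/eqP.
pose d : fam := fun n A => hc_ind 0 a f A - f n A.
have cd : cls d by move=> p k Z B fZ uB; rewrite /d (hc_ind_cls _ _ _ fZ uB) (cf _ _ _ _ fZ uB).
apply: (ip_eq0 (f := @d n)) => //; rewrite [LHS]ipBl.
have := @frobenius F n 0 a f d cd; rewrite addn0 => ->.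
apply/eqP; rewrite subr_eq0; apply/eqP/eq_ip => // B uB.
by rewrite hc_res0.
Qed.

Lemma hrow_level0 L gam (A : 'M_0) : hrow L gam A = (all (fun i => gam i == 0) L)%:R.
Proof.
have uA : A \in unitmx by rewrite unitmxE det_mx00 unitr1.
elim: L => //= i L IH; case gi: (gam i) => [[|r]|r] //=.
  by rewrite hc_ind0 //; apply: hrow_cls.
by rewrite hc_ind_neg.
Qed.

Variable L : seq I.
Hypotheses (uL : uniq L) (fullL : forall i, i \in L).
Variable s : {perm I}.
Hypothesis cs : forall i, c (s i) = c i.

(** Commutativity of the product, obtained by adjunction: each row of the second product turns into
    a sum over strips, which s merely permutes, until in size 0 only the vanishing of all entries of
    gam matters. Taking [L2 := L] yields [hrow_perm] by positive definiteness. *)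
Lemma ip_hrow_perm gam L2 gam2 n :
  ip (hrow L (gam \o s) (n := n)) (hrow L2 gam2 (n := n)) =
  ip (hrow L gam (n := n)) (hrow L2 gam2 (n := n)).
Proof.
elim: L2 gam n => [|i L2 IH] gam n.
  case: n => [|n]; last by rewrite !ip0r.
  apply: eq_ip => // A uA; rewrite !hrow_level0; congr (_ : bool)%:R.
  apply/allP/allP => g0 i _; last exact: g0.
  by have := g0 (s^-1%g i) (fullL _); rewrite /= permKV.
rewrite /=; case: (gam2 i) => [r|r] /=; last by rewrite !ip0r.
have [ltnr|lern] := ltnP n r; first by rewrite !ip0r // => A _; rewrite hc_ind_neg.
rewrite -(subnK lern); have cg := hrow_cls c L2 gam2.
rewrite !(@hrow_adjoint F I c r L _ _ r _ _ uL (leqnn r) cg).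
pose ss (t : {perm I}) (x : {ffun I -> 'I_r.+1}) := [ffun i => x (t i)].
rewrite (reindex_onto (ss s) (ss s^-1%g)) /=; last first.
  by move=> x _; apply/ffunP => j; rewrite !ffunE permK.
apply: eq_big => [x|x _].
  have -> : ss s^-1%g (ss s x) == x by apply/eqP/ffunP => j; rewrite !ffunE permKV.
  rewrite andbT /strip. congr (_ && _).
    apply/forallP/forallP => x0 j; rewrite fullL /=.
      have <- : c (s^-1%g j) = c j by rewrite -cs permKV.
      by have := x0 (s^-1%g j); rewrite ffunE permKV fullL.
    by have := x0 (s j); rewrite ffunE fullL cs.
  rewrite [in RHS](reindex_inj (@perm_inj _ s)); congr (_ == _); apply: eq_bigr => j _.
  by rewrite ffunE.
have e : hrow L (lower (gam \o s) (ss s x)) = hrow L (lower gam x \o s).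
  by apply: eq_hrow => j _; rewrite /lower /= ffunE.
by rewrite e IH.
Qed.

Lemma hrow_perm gam n (A : 'M_n) : A \in unitmx -> hrow L (gam \o s) A = hrow L gam A.
Proof.
move=> uA; apply/eqP; rewrite -subr_eq0; apply/eqP.
pose d : fam := fun n A => hrow L (gam \o s) A - hrow L gam A.
apply: (ip_eq0 (f := @d n)) => //; rewrite [LHS]ipBl !ipBr.
by rewrite !ip_hrow_perm subrr.
Qed.

End RowSymmetry.

Section Determinant.

Variable F : finFieldType.
Local Notation colour := (colour F).
Local Notation fam := (forall n, 'M[F]_n -> algC).

Variable l : nat.

(* Row [(a, p)]: the [p]-th of the [l.+1] rows of colour [a]. *)
Definition bead := (colour * 'I_l.+1)%type.

Implicit Types (b : bead -> int) (i j : bead) (s w : {perm bead}).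

Definition pos i : nat := l - i.2.

Definition rows : seq bead := [seq (a, p) | a <- enum {: colour}, p <- enum 'I_l.+1].

Lemma rows_uniq : uniq rows.
Proof. by apply: allpairs_uniq => [||[? ?] [? ?]]; rewrite ?enum_uniq. Qed.

Lemma mem_rows i : i \in rows.
Proof. by case: i => a p; apply/allpairsP; exists (a, p); rewrite !mem_enum. Qed.

Definition colp s := [forall i, (s i).1 == i.1].

Lemma colpP s : reflect (forall i, (s i).1 = i.1) (colp s).
Proof. exact: 'forall_eqP. Qed.

Lemma colpM s w : colp s -> colp w -> colp (s * w)%g.
Proof. by move=> /colpP cs /colpP cw; apply/colpP => i; rewrite permM cw cs. Qed.

Lemma colpV s : colp s -> colp s^-1%g.
Proof. by move=> /colpP cs; apply/colpP => i; rewrite -{2}(permKV s i) cs. Qed.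

(* The Jacobi-Trudi determinant [det (h_(b_i - j))]; the strictly decreasing
   [b] in each colour stands for the partition with parts [b i - pos i]. *)
Definition schur b : fam := fun n A =>
  \sum_(w | colp w) (-1) ^+ w * hrow fst rows (fun i => b i - (pos (w i))%:Z) A.

Lemma eq_schur b b' : b =1 b' -> forall n (A : 'M_n), schur b A = schur b' A.
Proof.
move=> e n A; apply: eq_bigr => w _; congr (_ * _).
by congr (_ A); congr (_ n); apply: eq_hrow => i _; rewrite e.
Qed.

Lemma schur_cls b : cls (schur b).
Proof. exact: (cls_sum _ _ _ (fun w => @hrow_cls F _ _ _ _)). Qed.

Lemma schur_adjoint K b a k (g : fam) n : (k <= K)%N -> cls g ->
  ip (schur b (n := n + k)) (hc_ind k a g (n := n + k)) =
  \sum_(x : {ffun bead -> 'I_K.+1} | strip fst rows a k x)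
     ip (schur (lower b x) (n := n)) (@g n).
Proof.
move=> lekK cg; rewrite [LHS]ip_suml; under [RHS]eq_bigr do rewrite [ip _ _]ip_suml.
rewrite exchange_big; apply: eq_bigr => w _ /=; rewrite -mulr_sumr; congr (_ * _).
rewrite (@hrow_adjoint F bead fst K rows _ _ _ _ _ rows_uniq lekK cg).
apply: eq_bigr => x _; congr (ip _ _); congr (_ n).
by apply: eq_hrow => i _; rewrite /lower addrAC.
Qed.

(** The determinant alternates in its rows because the factors of each term commute, by
    [hrow_perm]. *)
Lemma schur_perm b s n (A : 'M_n) : colp s -> A \in unitmx ->
  schur (b \o s) A = (-1) ^+ s * schur b A.
Proof.
move=> cs uA; rewrite /schur mulr_sumr.
rewrite (reindex_inj (mulgI s)) /=; apply: eq_big => [w|w cw].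
  apply/idP/idP => [csw|]; last exact: colpM.
  by rewrite -[w](mulKg s) colpM ?colpV.
rewrite odd_permM signr_addb -mulrA; congr (_ * (_ * _)).
have cs' i : (s i).1 = i.1 by apply/colpP.
rewrite -(hrow_perm rows_uniq mem_rows cs' (fun i => b i - (pos (w i))%:Z) uA).
by congr (_ A); congr (_ n); apply: eq_hrow => i _; rewrite /= permM.
Qed.

Lemma schur_neg b i n (A : 'M_n) : (b i < 0)%R -> schur b A = 0.
Proof.
move=> bi; rewrite /schur big1 // => w _; rewrite (@hrow_neg _ _ _ _ _ i) ?mulr0 ?mem_rows //.
by move: bi; case: (b i) => // r _; lia.
Qed.

Lemma colp_tperm i j : i.1 = j.1 -> colp (tperm i j).
Proof. by move=> ij; apply/colpP => x; case: tpermP => [->|->|]. Qed.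

Lemma schur_tperm b i j n (A : 'M_n) : i != j -> i.1 = j.1 -> A \in unitmx ->
  schur (b \o tperm i j) A = - schur b A.
Proof.
by move=> nij ij uA; rewrite schur_perm ?colp_tperm // odd_tperm nij expr1 mulN1r.
Qed.

Lemma schur_rep b i j n (A : 'M_n) : i != j -> i.1 = j.1 -> b i = b j ->
  A \in unitmx -> schur b A = 0.
Proof.
move=> nij ij bij uA; have := schur_tperm b nij ij uA.
rewrite (@eq_schur _ b) => [|x /=]; last by case: tpermP => [->|->|].
by move/eqP; rewrite -addr_eq0 -mulr2n mulrn_eq0 => /eqP.
Qed.

End Determinant.

(** * Sign-reversing cancellation in sums over strips *)

Section Cancellation.

Variable F : finFieldType.
Local Notation colour := (colour F).
Variable l : nat.
Local Notation bead := (bead F l).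
Implicit Types (b : bead -> int).

Variable g : (bead -> int) -> algC.
Hypothesis eq_g : forall b b', b =1 b' -> g b = g b'.
Hypothesis g_neg : forall b i, (b i < 0)%R -> g b = 0.
Hypothesis g_tperm : forall b i j, i != j -> i.1 = j.1 -> g (b \o tperm i j) = - g b.

Variables (a : colour) (b : bead -> int) (beta : 'I_l.+1 -> nat).
Hypothesis b_beta : forall p, b (a, p) = beta p.
Hypothesis beta_dec : forall p q : 'I_l.+1, (p < q)%N -> (beta q < beta p)%N.

(** In terms of partitions this deletes the first part of colour a: the other beads move up by one
    position, where the same part is encoded by a value one larger, and an empty part enters at the
    end with value 0. *)
Definition shift_bead : bead -> int := fun i =>
  if i.1 == a then (if unlift ord_max i.2 is Some p then (beta (lift ord0 p)).+1 else 0)%N%:Z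
  else b i.

Variables (K k : nat).
Hypotheses (lekK : (k <= K)%N) (lek : (beta ord0 <= k + l)%N).

Let M := (beta ord0).
Let Y := {ffun 'I_l.+1 -> 'I_M.+1}.

Let leM p : (beta p <= M)%N.
Proof.
case: (posnP p) => [p0|p_gt0]; last exact/ltnW/beta_dec.
by rewrite /M; have -> : p = ord0 by apply: val_inj.
Qed.

Definition insert (y : Y) : bead -> int := fun i => if i.1 == a then (y i.2)%:Z else b i.

Definition below (y : Y) :=
  [forall p, (y p <= beta p)%N] && (\sum_p y p + k == \sum_p beta p)%N.

Lemma strip_below :
  \sum_(x : {ffun bead -> 'I_K.+1} | strip fst (rows F l) a k x) g (lower b x) =
  \sum_(y | below y) g (insert y).
Proof.
rewrite (bigID (fun x : {ffun bead -> 'I_K.+1} => [forall p, (x (a, p) <= beta p)%N])) /=.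
rewrite [X in _ + X]big1 ?addr0; last first.
  move=> x /andP[_ /forallPn[p]]; rewrite -ltnNge => ltp.
  by rewrite (@g_neg _ (a, p)) // /lower b_beta subr_lt0 ltz_nat.
pose h (y : Y) : {ffun bead -> 'I_K.+1} :=
  [ffun i => if i.1 == a then inord (beta i.2 - y i.2) else ord0].
pose h' (x : {ffun bead -> 'I_K.+1}) : Y := [ffun p => inord (beta p - x (a, p))].
have supp (x : {ffun bead -> 'I_K.+1}) i : strip fst (rows F l) a k x -> i.1 != a -> x i = ord0.
  case/andP => /forallP/(_ i); rewrite mem_rows /= => + _ ne.
  by rewrite (negPf ne) implybF negbK => /eqP.
have sumx (x : {ffun bead -> 'I_K.+1}) : strip fst (rows F l) a k x -> (\sum_p x (a, p) = k)%N.
  move=> sx; have /andP[_ /eqP <-] := sx.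
  rewrite (eq_bigr (fun i : bead => x (i.1, i.2) : nat)) => [|[? ?] //].
  rewrite -(pair_bigA _ (fun a p => x (a, p) : nat)) /= (bigD1 a) //=.
  rewrite [X in (_ + X)%N]big1 ?addn0 // => a' ne.
  by rewrite big1 // => p _; rewrite supp.
rewrite (reindex_onto h h') /=; last first.
  move=> x /andP[sx /forallP lex]; apply/ffunP => -[a' p]; rewrite !ffunE /=.
  case: eqVneq => [->|ne]; last by rewrite (supp x).
  apply: val_inj; rewrite /= inordK; rewrite ?inordK ?subKn ?lex // ltnS.
    exact: leq_trans (leq_subr _ _) (leM p).
  by rewrite (leq_trans (leq_subr _ _) (leM p)).
have hE y p : (h y (a, p) = inord (beta p - y p) :> 'I_K.+1)%N.
  by rewrite ffunE /= eqxx.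
apply: eq_big => [y|y].
  apply/idP/idP => [/andP[/andP[sh /forallP lex] /eqP eh]|].
    have le_y p : (y p <= beta p)%N.
      rewrite -eh ffunE inordK ?leq_subr // ltnS.
      exact: leq_trans (leq_subr _ _) (leM p).
    apply/andP; split; first exact/forallP.
    rewrite -(sumx _ sh) -big_split /=; apply/eqP/eq_bigr => p _.
    by rewrite -{1}eh ffunE inordK ?subnK // ltnS (leq_trans (leq_subr _ _) (leM p)).
  case/andP=> /forallP ley /eqP sy.
  have sub : (\sum_p (beta p - y p) = k)%N.
    apply/eqP; rewrite -(eqn_add2l (\sum_p y p)) sy -big_split /=; apply/eqP/eq_bigr => p _.
    by rewrite subnKC.
  have hK p : h y (a, p) = (beta p - y p)%N :> nat.
    rewrite hE inordK // ltnS; apply: leq_trans lekK; rewrite -sub.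
    by rewrite (bigD1 p) //= leq_addr.
  rewrite -andbA; apply/and3P; split.
  - apply/andP; split.
      apply/forallP => i; rewrite ffunE mem_rows /=.
      by case: (eqVneq i.1 a) => _; rewrite ?implybT ?eqxx.
    rewrite (eq_bigr (fun i : bead => h y (i.1, i.2) : nat)) => [|[? ?] //].
    rewrite -(pair_bigA _ (fun a p => h y (a, p) : nat)) /= (bigD1 a) //=.
    rewrite [X in (_ + X)%N]big1 ?addn0 => [|a' ne].
      by rewrite -sub; apply/eqP/eq_bigr => p _.
    by rewrite big1 // => p _; rewrite ffunE /= (negPf ne).
  - by apply/forallP => p; rewrite hK leq_subr.
  apply/eqP/ffunP => p; rewrite ffunE; apply: val_inj.
  by rewrite /= inordK hK subKn // ltnS leM.
case/andP => /andP[sh /forallP lex] /eqP eh; apply: eq_g => -[a' p].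
rewrite /lower /insert /=; case: eqVneq => [->|ne].
  have -> : y p = (beta p - h y (a, p))%N :> nat.
    by rewrite -{1}eh ffunE inordK // ltnS (leq_trans (leq_subr _ _) (leM p)).
  by rewrite b_beta -subzn.
by rewrite ffunE /= (negPf ne) subr0.
Qed.

Definition good t (y : Y) :=
  [forall p : 'I_l, (p < t)%N ==> (beta (lift ord0 p) < y (lift ord_max p))%N].

Lemma lift_maxE (p : 'I_l) : lift ord_max p = p :> nat.
Proof. exact: lift_max. Qed.

(** A violation at t means y_t <= beta_(t+1). Since y_(t+1) <= beta_(t+1) <= beta_t as well,
    exchanging y_t and y_(t+1) stays below beta, keeps the violation, and does not touch the
    conditions at p < t. As g changes sign, the violating terms sum to zero. *)
Lemma good_step t : (t < l)%N ->
  \sum_(y | below y && good t y) g (insert y) =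
  \sum_(y | below y && good t.+1 y) g (insert y).
Proof.
move=> ltl; pose p0 := Ordinal ltl.
pose i0 : 'I_l.+1 := lift ord_max p0; pose i1 : 'I_l.+1 := lift ord0 p0.
have v0 : i0 = t :> nat by rewrite lift_maxE.
have v1 : i1 = t.+1 :> nat by rewrite /i1 lift0.
have neq_val (p q : 'I_l.+1) : (p : nat) != q -> p != q by rewrite val_eqE.
have n01 : i0 != i1 by apply: neq_val; rewrite v0 v1 neq_ltn ltnSn.
have b10 : (beta i1 <= beta i0)%N by apply: ltnW; apply: beta_dec; rewrite v0 v1.
rewrite (bigID (fun y : Y => (beta i1 < y i0)%N)) /= [X in _ + X = _](_ : _ = 0) ?addr0.
  apply: eq_bigl => y; rewrite -andbA; congr (_ && _).
  apply/andP/forallP => [[/forallP gy lty] p|gy].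
    apply/implyP; rewrite ltnS leq_eqVlt => /orP[/eqP ep|]; last exact/implyP.
    by have -> : p = p0 by apply: val_inj.
  split; last by have := gy p0; rewrite ltnSn.
  by apply/forallP => p; apply/implyP => lt; apply: (implyP (gy p)); rewrite ltnS ltnW.
set S := \sum_(y | _) _.
have : S = - S.
  rewrite {1}/S /S -sumrN; pose tau (y : Y) : Y := [ffun p => y (tperm i0 i1 p)].
  have tauK : involutive tau by move=> y; apply/ffunP => p; rewrite !ffunE tpermK.
  rewrite (reindex_inj (inv_inj tauK)) /=; apply: eq_big => [y|y _].
    have imp z : [&& below z, good t z & ~~ (beta i1 < z i0)%N] ->
                 [&& below (tau z), good t (tau z) & ~~ (beta i1 < tau z i0)%N].
      case/and3P => /andP[/forallP lez /eqP sz] /forallP gz nz; rewrite -leqNgt in nz.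
      apply/and3P; split.
      - apply/andP; split.
          apply/forallP => p; rewrite ffunE; case: tpermP => [->|->|_ _]; [|exact: nz|exact: lez].
          exact: leq_trans (lez _) b10.
        rewrite -sz; apply/eqP; congr (_ + _)%N.
        rewrite [RHS](reindex_inj (@perm_inj _ (tperm i0 i1))); apply: eq_bigr => p _.
        by rewrite ffunE.
      - apply/forallP => p; apply/implyP => ltp; rewrite ffunE tpermD.
        + exact: (implyP (gz p)).
        + by apply: neq_val; rewrite v0 lift_maxE neq_ltn ltp orbT.
        by apply: neq_val; rewrite v1 lift_maxE gtn_eqF // ltnS ltnW.
      by rewrite ffunE tpermL -leqNgt.
    rewrite -[LHS]andbA -[RHS]andbA; apply/idP/idP => [h|]; last exact: imp.
    by rewrite -[y]tauK imp.
  rewrite -(@g_tperm _ (a, i0) (a, i1)) //; last by rewrite xpair_eqE eqxx.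
  apply: eq_g => -[a' p]; rewrite /insert /= ffunE.
  case: eqVneq => [->|ne]; last by rewrite !tpermD ?xpair_eqE ?(negPf ne) 1?eq_sym ?(negPf ne) //=; rewrite (negPf ne).
  case: tpermP => [->|->|n0 n1]; rewrite ?tpermL ?tpermR ?eqxx //.
  by rewrite tpermD ?eqxx //; apply/eqP => -[]; [move/esym/n0|move/esym/n1].
by move/eqP; rewrite -addr_eq0 -mulr2n mulrn_eq0 => /eqP.
Qed.

(* Sign-reversing involution: two rows whose values could be exchanged cancel, so only
   the rows with y_p > beta_(p+1) for all p survive. *)
Lemma strip_cancel :
  \sum_(x : {ffun bead -> 'I_K.+1} | strip fst (rows F l) a k x) g (lower b x) =
  g shift_bead *+ (k + l == beta ord0)%N.
Proof.
rewrite strip_below.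
have -> : \sum_(y | below y) g (insert y) = \sum_(y | below y && good l y) g (insert y).
  transitivity (\sum_(y | below y && good 0 y) g (insert y)).
    by apply: eq_bigl => y; rewrite (_ : good 0 y) ?andbT //; apply/forallP.
  have step t : (t <= l)%N -> \sum_(y | below y && good 0 y) g (insert y) =
                              \sum_(y | below y && good t y) g (insert y).
    by elim: t => // t IH ltl; rewrite -good_step // IH // ltnW.
  exact: step.
have sumb : (\sum_p beta p = beta ord0 + \sum_(p < l) beta (lift ord0 p))%N by rewrite big_ord_recl.
have sumy (y : Y) : (\sum_p y p = \sum_(p < l) y (lift ord_max p) + y ord_max)%N.
  rewrite big_ord_recr /=; congr (_ + _)%N; apply: eq_bigr => p _.
  by congr (y _ : nat); apply: val_inj; rewrite /= /bump leqNgt ltn_ord.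
(* Summing y_p >= beta_(p+1) + 1 over p < l and comparing with [below] gives y_l + k + l <= beta_0
   <= k + l, so y_l = 0 and all these inequalities are equalities. *)
have key y : below y -> good l y -> (k + l == beta ord0)%N /\ insert y =1 shift_bead.
  case/andP => _ /eqP; rewrite sumy sumb => e /forallP gy.
  have gy' (p : 'I_l) : ((beta (lift ord0 p)).+1 <= y (lift ord_max p))%N.
    exact: (implyP (gy p)).
  pose Sy := (\sum_(p < l) y (lift ord_max p))%N.
  pose Sb := (\sum_(p < l) beta (lift ord0 p))%N.
  have es : (\sum_(p < l) (beta (lift ord0 p)).+1 = Sb + l)%N.
    under eq_bigr do rewrite -addn1.
    by rewrite big_split /= sum1_card card_ord.
  have lif := leqif_sum (fun (p : 'I_l) (_ : true) => leqif_eq (gy' p)).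
  have le : (Sb + l <= Sy)%N by rewrite -es; exact: lif.1.
  have eqs : (Sb + l == Sy)%N = [forall (i : 'I_l | true), (beta (lift ord0 i)).+1 == y (lift ord_max i) :> nat].
    by rewrite -es; exact: lif.2.
  rewrite -/Sy -/Sb in e.
  have ymax : (y ord_max = 0 :> nat)%N by move: e le lek; clear; lia.
  have eqk : (k + l = beta ord0)%N by move: e le lek; clear; lia.
  split; first exact/eqP.
  have /forall_inP eqp : [forall (i | true), (beta (lift ord0 i)).+1 == y (lift ord_max i) :> nat].
    by rewrite -eqs; apply/eqP; move: e le lek; clear; lia.
  case=> a' p; rewrite /insert /shift_bead /=; case: eqP => // _.
  by case: unliftP => [p'|] -> /=; rewrite ?ymax // -(eqP (eqp p' _)).
have [ek|nek] := eqP; last first.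
  by rewrite big_pred0 // => y; apply/negP => /andP[/key + gy] => /(_ gy)[/eqP].
have b0 (p : 'I_l) : ((beta (lift ord0 p)).+1 <= M)%N by rewrite beta_dec.
pose y0 : Y := [ffun p => if unlift ord_max p is Some p' then inord (beta (lift ord0 p')).+1 else ord0].
have y0E (p : 'I_l) : y0 (lift ord_max p) = (beta (lift ord0 p)).+1 :> nat.
  by rewrite ffunE liftK inordK ?ltnS.
have y0m : y0 ord_max = 0%N :> nat by rewrite ffunE unlift_none.
have gy0 : good l y0 by apply/forallP => p; rewrite y0E ltnSn implybT.
have by0 : below y0.
  apply/andP; split.
    apply/forallP => p; case: (unliftP ord_max p) => [p' ->|->]; last by rewrite y0m.
    by rewrite y0E beta_dec // lift_maxE lift0.
  rewrite sumy sumb y0m addn0 (eq_bigr (fun p => (beta (lift ord0 p) + 1)%N)) => [|p _].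
    by rewrite big_split /= sum1_card card_ord -ek; apply/eqP; lia.
  by rewrite y0E addn1.
rewrite (big_pred1 y0) => [|y]; first by apply: eq_g; case: (key _ by0 gy0).
apply/andP/eqP => [[by_ gy]|->//].
have [_ ey] := key _ by_ gy; have [_ ey0] := key _ by0 gy0.
apply/ffunP => p; apply: val_inj; have := ey (a, p); rewrite -ey0 /insert /= eqxx.
by case.
Qed.

End Cancellation.

Fixpoint lexle (s t : seq int) : bool :=
  match s, t with
  | x :: s', y :: t' => (x < y) || (x == y) && lexle s' t'
  | [::], _ => true
  | _, _ => false
  end.

Lemma lexle_trans t s u : lexle s t -> lexle t u -> lexle s u.
Proof.
elim: s t u => [|x s IH] [|y t] [|z u] //=.
case/orP => [xy|/andP[/eqP -> st]]; case/orP => [yz|/andP[/eqP <- tu]].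
- by rewrite (lt_trans xy yz).
- by rewrite xy.
- by rewrite yz.
by rewrite eqxx (IH _ _ st tu) orbT.
Qed.

Lemma lexle_anti s t : lexle s t -> lexle t s -> s = t.
Proof.
elim: s t => [|x s IH] [|y t] //=.
case/orP => [xy|/andP[/eqP -> st]]; case/orP => [yx|/andP[/eqP e ts]].
- by have := lt_trans xy yx; rewrite ltxx.
- by rewrite e ltxx in xy.
- by rewrite ltxx in yx.
by rewrite (IH _ st ts).
Qed.

(** * Triangularity and orthonormality of the determinants *)

Section Orthonormality.

Variable F : finFieldType.
Local Notation colour := (colour F).
Local Notation fam := (forall n, 'M[F]_n -> algC).
Variable l : nat.
Local Notation bead := (bead F l).
Implicit Types (b : bead -> int) (a : colour) (p q : 'I_l.+1).

Definition srt b := (forall i, 0 <= b i) /\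
  (forall a p q, (p < q)%N -> b (a, q) < b (a, p)).

Definition lam b : bead -> int := fun i => b i - (pos i)%:Z.

Definition shiftc a b : bead -> int := fun i =>
  if i.1 == a then (if unlift ord_max i.2 is Some p then b (a, lift ord0 p) + 1 else 0)
  else b i.

(** When k is at least the first part of colour a, [strip_cancel] leaves at most one term: the
    pairing deletes the first part if it equals k, and is zero otherwise. *)
Lemma schur_head a b k n (g : fam) : srt b -> cls g -> b (a, ord0) <= (k + l)%N%:Z ->
  ip (schur b (n := n + k)) (hc_ind k a g (n := n + k)) =
  ip (schur (shiftc a b) (n := n)) (@g n) *+ (b (a, ord0) == (k + l)%N%:Z).
Proof.
case=> b_ge0 b_dec cg lek; rewrite (schur_adjoint _ _ _ (leqnn k) cg).
pose beta p := absz (b (a, p)).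
have b_beta p : b (a, p) = beta p by rewrite /beta gez0_abs.
have beta_dec p q : (p < q)%N -> (beta q < beta p)%N.
  by move=> lt; rewrite -ltz_nat -!b_beta b_dec.
have lek' : (beta ord0 <= k + l)%N by rewrite -lez_nat -b_beta.
pose gg b' := ip (schur b' (n := n)) (@g n).
rewrite (_ : \sum_(x | _) _ = \sum_(x : {ffun bead -> 'I_k.+1} | strip fst (rows F l) a k x) gg (lower b x)) //.
rewrite (@strip_cancel F l gg _ _ _ a b beta b_beta beta_dec) //.
- rewrite b_beta eqz_nat eq_sym; congr (_ *+ _).
  apply: eq_ip => // A _; apply: eq_schur => -[a' p] /=.
  rewrite /shift_bead /shiftc /=; case: eqP => // _.
  by case: unliftP => [p'|] // _; rewrite b_beta -addn1 PoszD.
- by move=> b1 b2 e; apply: eq_ip => // A _; apply: eq_schur.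
- by move=> b1 i neg; apply: ip0l => A _; apply: schur_neg neg.
move=> b1 i j nij ij; rewrite /gg -mulN1r.
rewrite -ipZl; apply: eq_ip => // A uA; rewrite mulN1r.
exact: schur_tperm.
Qed.

Lemma srt_lam_ge0 b i : srt b -> 0 <= lam b i.
Proof.
case: i => a p [b_ge0 b_dec]; rewrite /lam /pos subr_ge0 /=.
have b_ge q m : (q + m = l)%N -> m%:Z <= b (a, q).
  elim: m q => [|m IH] q e; first exact: b_ge0.
  have ltq : (q.+1 < l.+1)%N by lia.
  have h1 : m%:Z <= b (a, Ordinal ltq) by apply: IH; rewrite /= addSnnS.
  have h2 := b_dec a q (Ordinal ltq) (ltnSn q).
  by rewrite -lezD1 in h2; apply: le_trans h2; rewrite -addn1 PoszD lerD2r.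
by apply: b_ge; rewrite subnKC // -ltnS.
Qed.

Lemma shiftc_srt a b : srt b -> srt (shiftc a b).
Proof.
case=> b_ge0 b_dec; split=> [i|a' p q ltpq]; rewrite /shiftc /=.
  case: eqP => // _; case: unliftP => [p _|//].
  by rewrite addr_ge0 ?b_ge0.
case: eqP => [ea|_]; last exact: b_dec.
case: (unliftP ord_max p) => [p' ep|ep]; last first.
  by have := leq_ord q; rewrite leqNgt; move: ltpq; rewrite ep /= => ->.
case: unliftP => [q' eq|_]; last by rewrite ltzD1 b_ge0.
rewrite ltrD2r; apply: b_dec; rewrite !lift0 ltnS.
by move: ltpq; rewrite ep eq !lift_max.
Qed.

Lemma iter_shiftcE t a b p : iter t (shiftc a) b (a, p) =
  if (p + t <= l)%N then b (a, inord (p + t)) + t%:Z else (l - p)%N%:Z.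
Proof.
elim: t p => [|t IH] p /=.
  by rewrite addn0 -ltnS ltn_ord inord_val addr0.
rewrite {1}/shiftc /= eqxx; case: unliftP => [p' ep|ep].
  rewrite IH lift0 ep lift_max addSnnS; case: leqP => lt.
    by rewrite -[t.+1]addn1 PoszD addrA.
  by rewrite -[1]/(Posz 1) -PoszD addn1 subnSK.
by rewrite ep /= subnn; case: leqP => // lt; lia.
Qed.

Lemma iter_shiftc_other t a b i : i.1 != a -> iter t (shiftc a) b i = b i.
Proof. by move=> /negPf ne; elim: t => //= t IH; rewrite {1}/shiftc ne IH. Qed.

Lemma iter_shiftc_srt t a b : srt b -> srt (iter t (shiftc a) b).
Proof. by move=> sb; elim: t => //= t; apply: shiftc_srt. Qed.

Lemma drop_enum_ord t : (t <= l)%N ->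
  drop t (enum 'I_l.+1) = inord t :: drop t.+1 (enum 'I_l.+1).
Proof.
move=> let_; rewrite (drop_nth ord0) ?size_enum_ord // (_ : nth _ _ _ = inord t) //.
by apply: val_inj; rewrite /= nth_enum_ord ?inordK.
Qed.

Definition brows (cs : seq colour) : seq bead := [seq (a, p) | a <- cs, p <- enum 'I_l.+1].

Lemma iter_head t a b : (t <= l)%N ->
  iter t (shiftc a) b (a, ord0) = lam b (a, inord t) + l%:Z.
Proof.
rewrite iter_shiftcE /= add0n => let_; rewrite let_ /lam /pos /= inordK ?ltnS // -subzn //.
by rewrite opprB addrA subrK.
Qed.

Lemma mem_brows cs i : (i \in brows cs) = (i.1 \in cs).
Proof.
case: i => a p; apply/allpairsP/idP => [[[a' p'] /= [? _ [-> _]]] //|acs].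
by exists (a, p); rewrite mem_enum.
Qed.

Lemma brows_cons a cs : brows (a :: cs) = [seq (a, p) | p <- drop 0 (enum 'I_l.+1)] ++ brows cs.
Proof. by rewrite drop0. Qed.

(** The entries of gam are peeled off in order. As long as they agree with the parts of b, what
    remains of b is an iterated shift; an entry smaller than the current part settles the
    comparison, and an entry at least as large must equal it by [schur_head]. *)
Lemma ip_hrow_lex cs b gam n : uniq cs -> srt b ->
  ip (schur b (n := n)) (hrow fst (brows cs) gam (n := n)) != 0 ->
  lexle (map gam (brows cs)) (map (lam b) (brows cs)).
Proof.
elim: cs b n => // a cs IH b n /= /andP[na ucs] sb; rewrite brows_cons.
have key t m : (t + m = l.+1)%N -> forall n,
  ip (schur (iter t (shiftc a) b) (n := n))
     (hrow fst ([seq (a, p) | p <- drop t (enum 'I_l.+1)] ++ brows cs) gam (n := n)) != 0 ->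
  lexle (map gam ([seq (a, p) | p <- drop t (enum 'I_l.+1)] ++ brows cs))
        (map (lam b) ([seq (a, p) | p <- drop t (enum 'I_l.+1)] ++ brows cs)).
  elim: m t => [|m IHm] t et n'.
    rewrite drop_oversize ?size_enum_ord; last by lia.
    move/IH => /(_ ucs (iter_shiftc_srt _ _ sb)) /=.
    rewrite (_ : map (lam _) _ = map (lam b) (brows cs)) //.
    apply/eq_in_map => i; rewrite mem_brows => ics; rewrite /lam iter_shiftc_other //.
    by apply: contraNneq na => <-.
  have let_ : (t <= l)%N by lia.
  rewrite drop_enum_ord //=; set i := (a, inord t); set L := _ ++ _.
  case: (gam i) => [k|k] /=; last by rewrite ip0r ?eqxx.
  have [ltnk|lekn] := ltnP n' k; first by rewrite ip0r ?eqxx // => A _; rewrite hc_ind_neg.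
  rewrite -(subnK lekn); have hd := iter_head a b let_.
  have [lt|ge] := ltP (Posz k) (lam b i); first by [].
  have le_head : iter t (shiftc a) b (a, ord0) <= (k + l)%N%:Z by rewrite hd PoszD lerD2r.
  rewrite (schur_head _ (iter_shiftc_srt t a sb) (hrow_cls _ _ _) le_head).
  rewrite hd PoszD (inj_eq (addIr _)) [lam b i == _]eq_sym.
  case: (Posz k =P lam b i) => [_|_]; last by rewrite mulr0n eqxx.
  rewrite mulr1n /= => nz; apply: (IHm t.+1 _ (n' - k)%N nz); lia.
exact: (key 0%N l.+1 erefl n).
Qed.

(** With gam = lam b every step of the peeling is the equality case of [schur_head], which ends with
    the empty partition in the colours of cs. *)
Lemma ip_hrow_lam cs b n : uniq cs -> srt b ->
  exists2 b', srt b' /\ (forall i, b' i = if i.1 \in cs then (pos i)%:Z else b i) &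
  ip (schur b (n := n + sumn [seq absz (lam b i) | i <- brows cs]))
     (hrow fst (brows cs) (lam b) (n := n + sumn [seq absz (lam b i) | i <- brows cs])) =
  ip (schur b' (n := n)) (@unit_fam F n).
Proof.
elim: cs b => [|a cs IH] b /=; first by exists b; rewrite ?addn0.
case/andP=> na ucs sb; rewrite brows_cons.
pose R t := [seq (a, p) | p <- drop t (enum 'I_l.+1)] ++ brows cs.
have key t m : (t + m = l.+1)%N ->
  ip (schur (iter t (shiftc a) b) (n := n + sumn [seq absz (lam b i) | i <- R t]))
     (hrow fst (R t) (lam b) (n := n + sumn [seq absz (lam b i) | i <- R t])) =
  ip (schur (iter l.+1 (shiftc a) b) (n := n + sumn [seq absz (lam b i) | i <- brows cs]))
     (hrow fst (brows cs) (lam b) (n := n + sumn [seq absz (lam b i) | i <- brows cs])).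
  elim: m t => [|m IHm] t et.
    have -> : t = l.+1 by lia.
    by rewrite /R drop_oversize ?size_enum_ord.
  have let_ : (t <= l)%N by lia.
  have eR : R t = (a, inord t) :: R t.+1 by rewrite /R drop_enum_ord.
  rewrite -(IHm t.+1) ?addSnnS // eR /=.
  have hd := iter_head a b let_; set i := (a, inord t) in hd *.
  have := srt_lam_ge0 i sb; case: (lam b i) hd => // k hd _ /=.
  have le_head : iter t (shiftc a) b (a, ord0) <= (k + l)%N%:Z by rewrite hd.
  rewrite addnCA addnC (schur_head _ (iter_shiftc_srt t a sb) (hrow_cls _ _ _) le_head).
  by rewrite hd eqxx.
have fin i : iter l.+1 (shiftc a) b i = if i.1 == a then (pos i)%:Z else b i.
  case: i => a' p; rewrite [(a', p).1]/=.
  case: eqVneq => [->|ne]; last by rewrite iter_shiftc_other.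
  by rewrite iter_shiftcE /pos addnS ltnNge leq_addl.
have := key 0%N l.+1 erefl; rewrite /= -/(R 0%N) => ->.
have sb' := iter_shiftc_srt l.+1 a sb.
have [b' [sb2 eb'] e] := IH _ ucs sb'.
have elam i : i \in brows cs -> lam (iter l.+1 (shiftc a) b) i = lam b i.
  rewrite mem_brows => ics; rewrite /lam iter_shiftc_other //.
  by apply: contraNneq na => <-.
exists b'.
  split=> // i; rewrite eb' fin inE.
  by case: (i.1 == a); case: (i.1 \in cs).
rewrite -e; rewrite (@eq_hrow _ _ fst _ _ (lam b) elam).
by have -> : [seq absz (lam (iter l.+1 (shiftc a) b) i) | i <- brows cs] =
             [seq absz (lam b i) | i <- brows cs] by apply/eq_in_map => i /elam ->.
Qed.

Definition rowsgt b (w : {perm bead}) : bead -> int := fun i => b i - (pos (w i))%:Z.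

(** At the first row moved by w all earlier rows are fixed, so w sends it to a later row, whose
    [pos] is smaller, and the entry grows. The diagonal term of the determinant is therefore
    lexicographically least. *)
Lemma lexle_perm b (w : {perm bead}) cs : uniq cs -> colp w ->
  lexle (map (lam b) (brows cs)) (map (rowsgt b w) (brows cs)).
Proof.
move=> + /colpP cw; elim: cs => // a cs IH /= /andP[_ ucs]; rewrite brows_cons.
have key t m : (t + m = l.+1)%N -> (forall p, (p < t)%N -> w (a, p) = (a, p)) ->
  lexle (map (lam b) ([seq (a, p) | p <- drop t (enum 'I_l.+1)] ++ brows cs))
        (map (rowsgt b w) ([seq (a, p) | p <- drop t (enum 'I_l.+1)] ++ brows cs)).
  elim: m t => [|m IHm] t et fix_t.
    by rewrite drop_oversize ?size_enum_ord; [exact: IH | lia].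
  have let_ : (t <= l)%N by lia.
  rewrite drop_enum_ord //=; set p0 : 'I_l.+1 := inord t.
  have vp0 : p0 = t :> nat by rewrite inordK.
  have [p' ew] : exists p', w (a, p0) = (a, p').
    exists (w (a, p0)).2; have := cw (a, p0).
    by case: (w (a, p0)) => a' p' /= ->.
  have lep' : (t <= p')%N.
    rewrite leqNgt; apply/negP => lt; have := fix_t _ lt; rewrite -[RHS]ew.
    by case/perm_inj => e; rewrite e vp0 ltnn in lt.
  rewrite /lam /rowsgt ew /pos /= vp0.
  have := lep'; rewrite leq_eqVlt => /orP[/eqP ep'|ltp'].
    rewrite -ep' eqxx ltxx /=; apply: IHm; first by rewrite addSnnS.
    move=> p; rewrite ltnS leq_eqVlt => /orP[/eqP ep|]; last exact: fix_t.
    have -> : p = p0 by apply: val_inj; rewrite /= vp0.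
    by rewrite ew; congr (_, _); apply: val_inj; rewrite /= vp0.
  apply/orP; left; rewrite ltrD2l ltrN2 ltz_nat.
  by have := ltn_ord p'; lia.
exact: (key 0%N l.+1 erefl).
Qed.

Lemma rowsgt_inj b (w : {perm bead}) : colp w ->
  (forall i, rowsgt b w i = lam b i) -> w = 1%g.
Proof.
move=> /colpP cw e; apply/permP => i; rewrite perm1.
have := e i; rewrite /rowsgt /lam => /addrI/oppr_inj/eqP; rewrite eqz_nat => /eqP.
have := cw i; case: (w i) => a' p'; case: i {e} => a p /= ->; rewrite /pos /= => e.
congr (_, _); apply: val_inj => /=.
by have := ltn_ord p; have := ltn_ord p'; lia.
Qed.

Lemma ip_schurr b b' n : ip (schur b (n := n)) (schur b' (n := n)) =
  \sum_(w : {perm bead} | colp w) (-1) ^+ w *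
     ip (schur b (n := n)) (hrow fst (rows F l) (rowsgt b' w) (n := n)).
Proof. by rewrite [LHS]ip_sumr; apply: eq_bigr => w _; rewrite rmorph_sign. Qed.

Lemma map_rows_inj (f g : bead -> int) :
  map f (rows F l) = map g (rows F l) -> f =1 g.
Proof. by move/eq_in_map => e i; apply: e; apply: mem_rows. Qed.

Lemma schur_lex b b' n : srt b -> ip (schur b (n := n)) (schur b' (n := n)) != 0 ->
  lexle (map (lam b') (rows F l)) (map (lam b) (rows F l)).
Proof.
move=> sb; rewrite ip_schurr => nz.
have [w /andP[cw nzw]] : exists w : {perm bead}, colp w &&
    (ip (schur b (n := n)) (hrow fst (rows F l) (rowsgt b' w) (n := n)) != 0).
  apply/existsP; rewrite -[[exists _, _]]negbK negb_exists; apply: contraNN nz => /forallP z.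
  rewrite big1 // => w cw; have := z w; rewrite cw /= negbK => /eqP ->.
  by rewrite mulr0.
apply: lexle_trans (lexle_perm _ (enum_uniq _) cw) _.
exact: ip_hrow_lex (enum_uniq _) sb nzw.
Qed.

Lemma schur_orth b b' n : srt b -> srt b' ->
  ip (schur b (n := n)) (schur b' (n := n)) != 0 -> b =1 b'.
Proof.
move=> sb sb' nz; have nz' : ip (schur b' (n := n)) (schur b (n := n)) != 0.
  by rewrite ipC conjC_eq0.
have := lexle_anti (schur_lex sb nz) (schur_lex sb' nz') => /map_rows_inj e i.
by have := e i => /addIr.
Qed.

Definition bsize b : int := \sum_i lam b i.

Lemma bsize_rows b : srt b -> bsize b = (sumn [seq absz (lam b i) | i <- rows F l])%:Z.
Proof.
move=> sb; rewrite sumnE big_map /bsize.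
rewrite (eq_bigr (fun i => (absz (lam b i))%:Z)) => [|i _]; last first.
  by rewrite gez0_abs // srt_lam_ge0.
rewrite -(big_morph Posz PoszD erefl); congr Posz.
apply: perm_big; apply: uniq_perm; [exact: index_enum_uniq|exact: rows_uniq|].
by move=> i; rewrite mem_index_enum mem_rows.
Qed.

Lemma ip0_const (x y : algC) : ip (fun _ : 'M[F]_0 => x) (fun _ : 'M[F]_0 => y) = x * y^*.
Proof. by rewrite /ip sumr_const mulrnAr -mulrnAl -[_ *+ _]mulr_natr mulVf ?mul1r ?gl_neq0. Qed.

(** A term w that pairs with [schur b] has weight at most [lam b] by [ip_hrow_lex] and at least
    [lam b] by [lexle_perm]. Only w = 1 remains, and [ip_hrow_lam] evaluates it at the empty
    partition. *)
Lemma schur_norm b n : srt b -> bsize b = n%:Z ->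
  ip (schur b (n := n)) (schur b (n := n)) = 1.
Proof.
move=> sb; rewrite bsize_rows // => -[<-]; set m := sumn _.
rewrite ip_schurr (bigD1 1%g) /=; last by apply/colpP => i; rewrite perm1.
rewrite odd_perm1 mul1r big1 ?addr0 => [|w /andP[cw w1]]; last first.
  apply/eqP; rewrite mulf_eq0 orbC; apply/orP; left; apply: contraR w1 => nz.
  have := lexle_anti (ip_hrow_lex (enum_uniq _) sb nz) (lexle_perm _ (enum_uniq _) cw).
  by move/map_rows_inj/(rowsgt_inj cw) => ->.
rewrite (@eq_hrow _ _ fst _ (rowsgt b 1%g) (lam b)) => [|i _]; last first.
  by rewrite /rowsgt perm1.
have [b' [sb' eb'] /=] := @ip_hrow_lam (enum {: colour}) b 0 (enum_uniq _) sb; rewrite add0n => ->.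
rewrite [ip _ _](_ : _ = ip (fun _ : 'M[F]_0 => 1) (fun _ : 'M[F]_0 => 1)).
  by rewrite ip0_const mul1r conjC1.
apply: eq_ip => // A _; rewrite /schur (bigD1 1%g) /=; last by apply/colpP => i; rewrite perm1.
rewrite odd_perm1 mul1r hrow_level0 (_ : all _ _); last first.
  by apply/allP => i _; rewrite perm1 eb' mem_enum subrr.
rewrite big1 ?addr0 // => w /andP[cw w1]; rewrite hrow_level0.
case: allP => [all0|]; last by rewrite mulr0.
case/eqP: w1; apply: (@rowsgt_inj b') => // i; rewrite /rowsgt /lam.
have := all0 i (mem_rows i); rewrite /= => /eqP ->.
by rewrite eb' mem_enum subrr.
Qed.

End Orthonormality.

(** * Parity of bead configurations *)

Lemma hook_neq (K u v : int) : 0 < K -> v = u - K -> u != v.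
Proof. by lia. Qed.

Lemma hook_neq_box (K u v w : int) : 1 < K -> v = u - K -> u = w + 1 -> v != w.
Proof. by lia. Qed.

Section XorSums.

Variable I : finType.

Lemma xor_diag (h : I -> I -> bool) : (forall i j, h i j = h j i) ->
  \big[addb/false]_i \big[addb/false]_j h i j = \big[addb/false]_i h i i.
Proof.
move=> hC; pose lt (i j : I) := (enum_rank i < enum_rank j)%N.
have e i : \big[addb/false]_j h i j =
    h i i (+) (\big[addb/false]_(j | lt i j) h i j (+) \big[addb/false]_(j | lt j i) h i j).
  rewrite (bigD1 i) //=; congr (_ (+) _).
  rewrite (bigID (lt i)) /=; congr (_ (+) _).
    apply: eq_bigl => j; rewrite andb_idl // => ltij.
    by apply: contraTneq ltij => ->; rewrite /lt ltnn.
  apply: eq_bigl => j; rewrite /lt -leqNgt ltn_neqAle.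
  by rewrite -(inj_eq (@enum_rank_inj I)).
rewrite (eq_bigr _ (fun i _ => e i)) !big_split /=.
rewrite [X in _ (+) (_ (+) X)](exchange_big_dep (fun _ => true)) //=.
rewrite [X in _ (+) (_ (+) X)](_ : _ = \big[addb/false]_i \big[addb/false]_(j | lt i j) h i j).
  by rewrite addbb addbF.
by apply: eq_bigr => i _; apply: eq_bigr => j _; apply: hC.
Qed.

Lemma xor_exists (P : pred I) : \big[addb/false]_i P i -> exists i, P i.
Proof.
move=> oP; apply/existsP; apply: contraTT oP; rewrite negb_exists => /forallP nP.
by rewrite big1 // => i _; apply/negbTE/nP.
Qed.

(** An odd number that is at most two is one. *)
Lemma xor_unique (P : pred I) i0 : \big[addb/false]_i P i ->
  (forall i j, P i -> P j -> i != i0 -> j != i0 -> i = j) ->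
  exists i, P i /\ forall j, P j -> j = i.
Proof.
move=> oP uP; have [i Pi] := xor_exists oP; exists i; split=> // j Pj.
apply/eqP; apply: contraTT oP => nji.
rewrite (bigD1 i) //= Pi (bigD1 j) //= Pj big1 // => t /andP[nti ntj].
apply/negbTE; apply: contraT; rewrite negbK => Pt.
have [ei|ni] := eqVneq i i0.
  by case/eqP: ntj; apply: uP; rewrite // -ei.
have [ej|nj] := eqVneq j i0.
  by case/eqP: nti; apply: uP; rewrite // -ej.
by case/eqP: nji; apply: uP.
Qed.

End XorSums.

Section Beads.

Variables (I : finType) (C : eqType) (c : I -> C).
Implicit Types (b x y : I -> int) (i j m : I).

Definition move b i (z : int) : I -> int := fun j => if j == i then b j + z else b j.

Lemma moveE b i z : move b i z i = b i + z. Proof. by rewrite /move eqxx. Qed.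

Lemma move_other b i z j : j != i -> move b i z j = b j.
Proof. by rewrite /move => /negPf ->. Qed.

Lemma eq_move b b' i z : b =1 b' -> move b i z =1 move b' i z.
Proof. by move=> e j; rewrite /move e. Qed.

Lemma moveC b i z j z' : move (move b i z) j z' =1 move (move b j z') i z.
Proof. by move=> m; rewrite /move; case: eqP => // _; case: eqP => // _; rewrite addrAC. Qed.

Lemma moveK b i z z' : z + z' = 0 -> move (move b i z) i z' =1 b.
Proof. by move=> e j; rewrite /move; case: eqP => // _; rewrite -addrA e addr0. Qed.

Lemma move_inj b i j z : z != 0 -> move b i z =1 move b j z -> i = j.
Proof.
move=> nz /(_ i); rewrite moveE; case: (eqVneq i j) => // ne.
by rewrite move_other // -[RHS]addr0 => /addrI/eqP; rewrite (negPf nz).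
Qed.

Lemma move_move b i z z' : move (move b i z) i z' =1 move b i (z + z').
Proof. by move=> m; rewrite /move; case: eqP => // _; rewrite addrA. Qed.

(** Unlike [srt], this fixes no order of the beads of a colour, since a long slide may carry a bead
    past others. *)
Definition valid b := (forall i, 0 <= b i) /\
  (forall i j, i != j -> c i = c j -> b i != b j).

Lemma valid_inj b i j : valid b -> c i = c j -> b i = b j -> i = j.
Proof. by case=> _ vb cij e; apply/eqP/contraT => /vb/(_ cij); rewrite e eqxx. Qed.

Lemma valid_move b i z : valid b -> 0 <= b i + z ->
  (forall j, j != i -> c j = c i -> b j != b i + z) -> valid (move b i z).
Proof.
move=> [b0 vb] bi nb; split=> [j|j k njk cjk].
  by rewrite /move; case: eqP => // ->.
rewrite /move; case: (eqVneq j i) => [ej|nj]; case: (eqVneq k i) => [ek|nk].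
- by rewrite ej ek eqxx in njk.
- by rewrite eq_sym ej nb // -cjk ej.
- by rewrite ek nb // cjk ek.
exact: vb.
Qed.

Lemma move_free b i z : valid (move b i z) ->
  forall j, j != i -> c j = c i -> b j != b i + z.
Proof.
by move=> [_ vb] j nj cj; have := vb j i nj cj; rewrite moveE move_other.
Qed.

Lemma valid_move_ge0 b i z : valid (move b i z) -> 0 <= b i + z.
Proof. by case=> /(_ i); rewrite moveE. Qed.

Variables (d : (I -> int) -> bool) (size : (I -> int) -> int).
Hypothesis d_ext : forall b b', b =1 b' -> d b = d b'.
Hypothesis d_valid : forall b, d b -> valid b.
Hypothesis d_tperm : forall b i j, i != j -> c i = c j -> d (b \o tperm i j) = d b.
Hypothesis size_move : forall b i z, size (move b i z) = size b + z.
Hypothesis size_ge0 : forall b, valid b -> 0 <= size b.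
Hypothesis d_rec : forall b, 0 < size b -> d b = \big[addb/false]_i d (move b i (-1)).

(* Slides at different beads commute, so they cancel in pairs when [d_rec] for 2^k is
   applied twice, leaving the slides of the same bead by 2^(k+1). *)
Lemma d_hook k b : (2 ^ k)%N%:Z <= size b ->
  d b = \big[addb/false]_i d (move b i (- (2 ^ k)%N%:Z)).
Proof.
elim: k b => [|k IH] b szb; first by apply: d_rec; rewrite expn0 in szb; lia.
set K : int := (2 ^ k)%N%:Z in IH *.
have eK : (2 ^ k.+1)%N%:Z = K + K by rewrite /K expnS mul2n -addnn PoszD.
have K_ge0 : 0 <= K by [].
rewrite IH; last by move: szb; rewrite eK; lia.
rewrite (eq_bigr (fun i => \big[addb/false]_j d (move (move b i (- K)) j (- K)))).
  rewrite xor_diag => [|i j]; last by apply/d_ext/moveC.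
  by apply: eq_bigr => i _; apply: d_ext => m; rewrite move_move eK opprD.
by move=> i _; apply: IH; rewrite size_move; move: szb; rewrite eK; lia.
Qed.

Section Hook.

Variable K : int.
Hypothesis K_gt0 : 0 < K.

(* Two different slides could be performed together, leaving a negative size. *)
Lemma hook_unique b i j : valid b -> size b < K + K ->
  valid (move b i (- K)) -> valid (move b j (- K)) -> i = j.
Proof.
move=> vb ltb vi vj; apply/eqP/contraT => nij.
suff /size_ge0 : valid (move (move b i (- K)) j (- K)) by rewrite !size_move; lia.
have nji : j != i by rewrite eq_sym.
apply: valid_move => // [|m nm cm]; first by rewrite move_other // valid_move_ge0.
rewrite (move_other _ _ nji); case: (eqVneq m i) => [em|nmi]; last first.
  by rewrite move_other // (move_free vj).
rewrite em moveE; apply/eqP => /addIr e; case/eqP: nij.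
by apply: (valid_inj vb) => //; rewrite -em.
Qed.

Lemma hook_box b h j : d b -> K < size b -> size b < K + K -> 1 < K ->
  (forall b', size b' = size b - 1 -> d b' -> exists i, d (move b' i (- K))) ->
  d (move b h (- K)) -> d (move b j (-1)) ->
  d (move (move b h (- K)) j (-1)) \/
  exists i, [/\ c i = c h, c j = c i, b i = b h + 1, b j = b i - K &
                d (move (move b j (-1)) i (- K))].
Proof.
move=> db ltK lt2K K1 hook dh dj.
have vb := d_valid db; have vh := d_valid dh; have vj := d_valid dj.
have [i di] := hook _ (size_move b j (-1)) dj.
case: (eqVneq i h) => [ei|nih].
  by left; rewrite (d_ext (moveC _ _ _ _ _)) -ei.
right; have vi := d_valid di.
have b0 : forall m, 0 <= b m by case: vb.
have nvi : ~ valid (move b i (- K)).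
  by move=> v; case/eqP: nih; apply: hook_unique v vh.
have sz_c : size (move b h (- K)) < K by rewrite size_move; lia.
have nhi : h != i by rewrite eq_sym.
have step : 0 <= b i - K - 1 ->
    (forall m, m != i -> m != h -> c m = c i -> b m != b i - K - 1) ->
    c i = c h /\ b i = b h + 1.
  move=> ge0 fr.
  have [/eqP ch|nch] := boolP (c i == c h); last first.
    have : valid (move (move b h (- K)) i (- K - 1)).
      apply: valid_move => //; first by rewrite move_other // addrA.
      move=> m nm cm; rewrite (move_other _ _ nih); case: (eqVneq m h) => [em|nmh].
        by case/eqP: nch; rewrite -em.
      by rewrite move_other // addrA fr.
    by move/size_ge0; rewrite !size_move; lia.
  split=> //; apply/eqP/contraT => nb.
  have : valid (move (move b h (- K)) i (- K - 1)).
    apply: valid_move => //; first by rewrite move_other // addrA.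
    move=> m nm cm; rewrite (move_other _ _ nih); case: (eqVneq m h) => [->|nmh].
      by rewrite moveE; apply: contraNneq nb => e; lia.
    by rewrite move_other // addrA fr.
  by move/size_ge0; rewrite !size_move; lia.
(* If i = j, [step] puts h on b i - 1, the very place to which j is to be lowered. *)
case: (eqVneq i j) => [eij|nij].
  have ge0 : 0 <= b i - K - 1.
    by have := valid_move_ge0 vi; rewrite eij moveE; lia.
  case: step => // [m nmi nmh cm|ch bh].
    have := move_free vi nmi cm; rewrite move_other -?eij // moveE.
    by apply: contraNneq => ->; lia.
  have := move_free vj (j := h); rewrite -eij nhi => /(_ isT (esym ch)).
  by rewrite bh addrK eqxx.
have vjge : 0 <= b j - 1 by have := valid_move_ge0 vj.
have bij : c j = c i /\ b j = b i - K.
  have [/existsP[m /and3P[nm /eqP cm /eqP bm]]|] :=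
      boolP [exists m, [&& m != i, c m == c i & b m == b i - K]].
    case: (eqVneq m j) => [<- //|nmj].
    by have := move_free vi nm cm; rewrite !move_other // bm eqxx.
  rewrite negb_exists => /forallP fr; case: nvi; apply: valid_move => //.
    by have := valid_move_ge0 vi; rewrite move_other.
  by move=> m nm cm; have := fr m; rewrite nm cm eqxx.
have [cj bj] := bij.
have [ch bh] : c i = c h /\ b i = b h + 1.
  apply: step => [|m nmi nmh cm]; first by move: vjge; rewrite bj.
  rewrite -bj; case: (eqVneq m j) => [->|nmj]; first by apply/eqP; lia.
  by have := move_free vj nmj; apply; rewrite cj.
by exists i.
Qed.

End Hook.

Lemma two_power_bounds (n : int) : 0 < n ->
  exists k, (2 ^ k)%N%:Z <= n /\ n < (2 ^ k)%N%:Z + (2 ^ k)%N%:Z.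
Proof.
case: n => // n n_gt0; exists (trunc_log 2 n); rewrite lez_nat -PoszD ltz_nat.
have /andP[le lt] := trunc_log_bounds (isT : 1 < 2)%N (n_gt0 : 0 < n)%N.
by rewrite le addnn -mul2n -expnS.
Qed.

(** The number of odd children is odd by [d_rec], so it is enough to name one bead such that at most
    one other bead gives an odd child. *)
Lemma odd_child b : d b -> 0 < size b ->
  exists i, d (move b i (-1)) /\ forall j, d (move b j (-1)) -> j = i.
Proof.
have [n] := ubnP (absz (size b)); elim: n b => // n IH b ltn db sz.
have [k [leK ltK]] := two_power_bounds sz; set K : int := (2 ^ k)%N%:Z in leK ltK.
have K_gt0 : 0 < K by rewrite /K ltz_nat expn_gt0.
have vb := d_valid db.
have [h dh] := xor_exists (etrans (esym (d_hook leK)) db).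
have vh := d_valid dh; rewrite -/K in dh vh.
have oJ : \big[addb/false]_i d (move b i (-1)) by rewrite -d_rec.
have hook b' : size b' = size b - 1 -> K < size b -> d b' -> exists i, d (move b' i (- K)).
  move=> sz' lt db'; apply: xor_exists; rewrite -d_hook // sz' -/K; lia.
move: leK; rewrite le_eqVlt => /orP[/eqP eK|ltKb].
  (* Here size b = K and the slide of h leaves size 0. Any other child m must be blocked after that
     slide, so b m - 1 is the landing place of h, and this determines m. *)
  apply: (xor_unique (i0 := h) oJ) => i j di dj nih njh.
  have key m : m != h -> d (move b m (-1)) -> c m = c h /\ b m - 1 = b h - K.
    move=> nmh /d_valid vm.
    have bad : (forall t, t != m -> c t = c m -> move b h (- K) t != b m - 1) -> False.
      move=> fr; suff /size_ge0 : valid (move (move b h (- K)) m (-1)).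
        by rewrite !size_move; lia.
      apply: valid_move => //; rewrite (move_other _ _ nmh) //.
      exact: valid_move_ge0 vm.
    have nhm : h != m by rewrite eq_sym.
    have [/eqP cm|nc] := boolP (c m == c h); last first.
      case: bad => t ntm ct; case: (eqVneq t h) => [et|nth].
        by case/eqP: nc; rewrite -et.
      by rewrite move_other // (move_free vm).
    split=> //; apply/eqP/contraT => ne; case: bad => t ntm ct.
    case: (eqVneq t h) => [->|nth]; first by rewrite moveE eq_sym.
    by rewrite move_other // (move_free vm).
  have [[ci bi] [cj bj]] := (key i nih di, key j njh dj).
  apply: (valid_inj vb); first by rewrite ci cj.
  by apply: (@addIr _ (-1)); rewrite bi bj.
have K1 : 1 < K.
  rewrite ltNge; apply/negP; move: ltKb ltK K_gt0; move: (size b) (K) => u v; lia.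
have [h' [dh' uh']] : exists i, d (move (move b h (- K)) i (-1)) /\
    forall j, d (move (move b h (- K)) j (-1)) -> j = i.
  apply: IH; rewrite ?size_move //; move: ltn ltKb K_gt0; move: (size b) (K) => u v; lia.
(* Here h' is the odd child, given by induction, of b after the slide of h. A child m other than h'
   is in the exceptional case of [hook_box], where b m = b h + 1 - K determines m. *)
apply: (xor_unique (i0 := h') oJ) => i j di dj nih njh.
have key m : m != h' -> d (move b m (-1)) ->
    exists i', [/\ c i' = c h, c m = c i', b i' = b h + 1 & b m = b i' - K].
  move=> nm dm.
  have hk b' : size b' = size b - 1 -> d b' -> exists i, d (move b' i (- K)) by move=> e; apply: hook.
  case: (hook_box K_gt0 db ltKb ltK K1 hk dh dm) => [/uh' e|[i' [? ? ? ? _]]].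
    by rewrite e eqxx in nm.
  by exists i'.
have [i1 [c1 c2 b1 b2]] := key i nih di; have [i2 [c1' c2' b1' b2']] := key j njh dj.
have e12 : i1 = i2 by apply: (valid_inj vb); rewrite ?c1 ?c1' ?b1 ?b1'.
by apply: (valid_inj vb); rewrite ?c2 ?c2' ?b2 ?b2' e12.
Qed.

(** If two beads of a colour could move up, consider the bead next above the lower one: the place
    just below it is free, and moving it there would make the size negative. *)
Lemma ground_up y i j : valid y -> size y = 0 ->
  valid (move y i 1) -> valid (move y j 1) -> c i = c j -> i = j.
Proof.
move=> vy sz vi vj cij.
wlog lt : i j vi vj cij / y i <= y j.
  by move=> wl; have [/wl|/ltW/wl e] := leP (y i) (y j); [apply | apply/esym/e].
apply/eqP/contraT => nij.
have lt' : y i < y j.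
  by rewrite lt_neqAle lt andbT; apply: contraNneq nij => e; apply/eqP/(valid_inj vy).
have Pj : (c j == c i) && (y i < y j) by rewrite cij eqxx.
case: (@Order.TotalTheory.arg_minP _ _ I j (fun m => (c m == c i) && (y i < y m)) y Pj) => m /andP[/eqP cm ltm] minm.
have y0 : forall t, 0 <= y t by case: vy.
suff /size_ge0 : valid (move y m (-1)) by rewrite size_move; lia.
apply: valid_move => //; first by have := y0 i; lia.
move=> t ntm ct; apply/eqP => e.
have [ti|nti] := eqVneq t i.
  have nmi : m != i by rewrite -ti eq_sym.
  by have := move_free vi nmi cm; rewrite -ti e subrK eqxx.
have : y i <= y t by rewrite e; lia.
rewrite le_eqVlt => /orP[/eqP eit|ltit].
  by case/eqP: nti; apply/esym/(valid_inj vy); rewrite // ct cm.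
by have := minm t; rewrite ct cm eqxx ltit => /(_ isT); rewrite e; lia.
Qed.

(** Induction along the slide of y by K. Each odd parent of y is carried to an odd parent, of the
    same colour, of the slid configuration, whose size is smaller and of the same parity; the final
    case analysis recovers the original parent. *)
Lemma odd_parent_unique y i j : d y -> odd (absz (size y + 1)) ->
  d (move y i 1) -> d (move y j 1) -> c i = c j -> i = j.
Proof.
have [n] := ubnP (absz (size y)); elim: n y i j => // n IH y i j ltn dy oy di dj cij.
have vy := d_valid dy; have sz0 := size_ge0 vy.
have [e0|nz] := eqVneq (size y) 0.
  exact: ground_up vy e0 (d_valid di) (d_valid dj) cij.
have szy : 2 <= size y.
  have : size y != 1 by apply: contraTneq oy => ->.
  by move=> n1; lia.
have x_gt0 : 0 < size y + 1 by lia.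
have [k [leK ltK]] := two_power_bounds x_gt0; set K : int := (2 ^ k)%N%:Z in leK ltK.
have evK : (0 < k)%N.
  by rewrite lt0n; apply/eqP => k0; move: ltK; rewrite /K k0 expn0; lia.
have [K' eK] : exists K' : nat, K = K'.*2%:Z.
  by exists (2 ^ k.-1)%N; rewrite /K -mul2n -expnS prednK.
have K1 : 1 < K.
  by rewrite /K ltz_nat -(expn0 2) ltn_exp2l.
(* Parity enters here: K is even and size y + 1 is odd, so K <= size y, and both y and its odd
   parents have an odd slide by K. *)
have ltKx : K < size y + 1.
  rewrite lt_neqAle leK andbT; apply/eqP => e; move: oy.
  by rewrite -e eK /= odd_double.
have K_gt0 : 0 < K by lia.
have leKy : (2 ^ k)%N%:Z <= size y by rewrite -/K; lia.
have [h dh] := xor_exists (etrans (esym (d_hook leKy)) dy); rewrite -/K in dh.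
have vh := d_valid dh.
have key m : d (move y m 1) ->
  exists m', [/\ c m' = c m, d (move (move y h (- K)) m' 1) &
    m' = m \/ [/\ y h = y m' + 1, h != m', c h = c m' & y m = y h - K - 1]].
  move=> dm; set x := move y m 1 in dm.
  have szx : size x = size y + 1 by rewrite size_move.
  have leKx : (2 ^ k)%N%:Z <= size x by rewrite szx.
  have [hx dhx] := xor_exists (etrans (esym (d_hook leKx)) dm); rewrite -/K in dhx.
  have back : move x m (-1) =1 y.
    by move=> t; rewrite /x move_move subrr /move addr0; case: eqP.
  have dxm : d (move x m (-1)) by rewrite (d_ext back).
  have hk b' : size b' = size x - 1 -> d b' -> exists i, d (move b' i (- K)).
    by move=> sz' db'; apply: xor_exists; rewrite -d_hook // sz' szx -/K; lia.
  have moveback t : move (move x m (-1)) t (- K) =1 move y t (- K).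
    exact: eq_move back.
  have [||gen|[i' [ci' cm' bi' bm' di']]] := hook_box K_gt0 dm _ _ K1 hk dhx dxm.
  - by rewrite szx.
  - by rewrite szx.
  - exists m; split=> //; last by left.
    have e : hx = h.
      have vhx : valid (move y hx (- K)).
        by apply/d_valid; rewrite -(d_ext (moveback hx)) (d_ext (moveC _ _ _ _ _)).
      by apply: (hook_unique K_gt0 vy) vhx vh; lia.
    have : d (move y hx (- K)) by rewrite -(d_ext (moveback hx)) (d_ext (moveC _ _ _ _ _)).
    move=> dhy; rewrite (d_ext (moveC _ _ _ _ _)) -/x -e; exact: dhx.
  have ei : i' = h.
    have vi' : valid (move y i' (- K)) by apply/d_valid; rewrite -(d_ext (moveback i')).
    by apply: (hook_unique K_gt0 vy) vi' vh; lia.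
  subst i'.
  have nhm : h != m by apply/eqP => e; have /eqP := hook_neq K_gt0 bm'; rewrite e.
  have nhhx : h != hx by apply/eqP => e; have /eqP := hook_neq ltr01 (esym (canLR (addrK _) bi')); rewrite e.
  have nmhx : m != hx by apply/eqP => e; have /eqP := hook_neq_box K1 bm' bi'; rewrite e.
  have nmh : m != h by rewrite eq_sym.
  have nhxh : hx != h by rewrite eq_sym.
  have nhxm : hx != m by rewrite eq_sym.
  have xh : x h = y h by rewrite /x move_other.
  have xhx : x hx = y hx by rewrite /x move_other //.
  have xm : x m = y m + 1 by rewrite /x moveE.
  (* Both configurations put the three beads h, hx and m on the places y h, y h - K and y h - K - 1,
     so two transpositions turn one into the other. *)
  exists hx; split; first by rewrite -ci' cm'.
    rewrite -(d_ext (b := (move x hx (- K) \o tperm h hx) \o tperm h m)).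
      by rewrite d_tperm ?cm' // d_tperm.
    move=> t /=; case: (tpermP h m t) => [->|->|nth ntm].
    - rewrite tpermD // (move_other x _ nmhx) (move_other _ _ nhhx) moveE.
      by rewrite -xh.
    - rewrite tpermL moveE (move_other _ _ nmhx) (move_other _ _ nmh).
      by rewrite -[y m](addrK 1) -xm bm' bi'; ring.
    case: (tpermP h hx t) => [//|et|_ nthx].
      by rewrite et (move_other x _ nhhx) moveE (move_other _ _ nhxh) bi' xhx.
    have [/eqP th /eqP tm /eqP thx] := And3 nth ntm nthx.
    by rewrite (move_other x _ thx) (move_other _ _ thx) (move_other _ _ th) /x (move_other _ _ tm).
  right; split=> //; first by rewrite -xh -xhx.
  by rewrite -[LHS](addrK 1) -xm bm' xh.
have [i' [ci di' hi]] := key i di; have [j' [cj dj' hj]] := key j dj.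
have eij : i' = j'.
  apply: (IH (move y h (- K))) => //; rewrite ?size_move ?ci ?cj //.
    by move: ltn; lia.
  have -> : size y - K + 1 = (size y + 1) - K by ring.
  by move: oy; rewrite eK; lia.
(* In the mixed cases a bead that moves up would meet h on the place y h; two exceptional beads both
   lie on y h - K - 1. *)
subst j'; case: hi => [ei|[h1 h2 h3 h4]]; case: hj => [ej|[g1 g2 g3 g4]].
- by rewrite -ei.
- subst i'; have := move_free (d_valid di) g2 g3.
  by rewrite g1 eqxx.
- subst i'; have := move_free (d_valid dj) h2 h3.
  by rewrite h1 eqxx.
by apply: (valid_inj vy); rewrite // h4 g4.
Qed.

End Beads.

(** * The Pieri rule *)

Section Pieri.

Variable F : finFieldType.
Local Notation colour := (colour F).
Local Notation fam := (forall n, 'M[F]_n -> algC).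
Variable l : nat.
Local Notation bead := (bead F l).
Implicit Types (b y : bead -> int) (a : colour) (p q : 'I_l.+1) (i j : bead).

Lemma schur_adjoint1 b a (g : fam) n : cls g ->
  ip (schur b (n := n + 1)) (hc_ind 1 a g (n := n + 1)) =
  \sum_(i : bead | i.1 == a) ip (schur (move b i (-1)) (n := n)) (@g n).
Proof.
move=> cg; rewrite (schur_adjoint _ _ _ (leqnn 1) cg).
pose x0 (i : bead) : {ffun bead -> 'I_2} := [ffun j => inord (j == i)].
have x0E i j : x0 i j = (j == i) :> nat by rewrite ffunE inordK //; case: eqP.
have sx0 i : strip fst (rows F l) a 1 (x0 i) = (i.1 == a).
  apply/andP/idP => [[/forallP/(_ i)]|ia].
    by rewrite mem_rows -val_eqE /= x0E eqxx.
  split; last first.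
    by rewrite (bigD1 i) //= x0E eqxx big1 // => j /negPf ne; rewrite x0E ne.
  apply/forallP => j; rewrite mem_rows -val_eqE /= x0E.
  by case: (eqVneq j i) => // ->; rewrite ia.
have inj0 : injective x0.
  by move=> i j /ffunP/(_ i)/(congr1 (@nat_of_ord _)); rewrite !x0E eqxx; case: eqVneq.
rewrite -(eq_bigl _ _ sx0) [LHS](_ : _ = \sum_(x in [set x0 i | i : bead & strip fst (rows F l) a 1 (x0 i)])
   ip (schur (lower b x) (n := n)) (@g n)); last first.
  apply: eq_bigl => x; apply/idP/imsetP => [sx|[i + ->]]; last by rewrite inE.
  have [/forallP sup /eqP sum1] := andP sx.
  have [i xi] : exists i, x i != ord0.
    apply/existsP; apply: contraPT sum1; rewrite negb_exists => /forallP z.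
    by rewrite big1 // => i _; have := z i; rewrite negbK => /eqP ->.
  have ex : x = x0 i.
    apply/ffunP => j; apply: val_inj; rewrite /= x0E.
    move: sum1; rewrite (bigD1 i) //=; have : (0 < x i)%N by rewrite lt0n.
    case: (eqVneq j i) => [-> x1 /= e|ne x1].
      by apply/eqP; rewrite eqn_leq x1 andbT -[leqRHS]e leq_addr.
    rewrite (bigD1 j) //= addnA => e; apply/eqP.
    by rewrite -leqn0 -(leq_add2l (x i)) addn0 (leq_trans _ x1) // -[leqRHS]e leq_addr.
  by exists i; rewrite // inE -ex.
rewrite big_imset /=; last by move=> i j _ _; apply: inj0.
apply: eq_big => [i|i _]; first by rewrite inE.
apply: eq_ip => // A _; apply: eq_schur => j.
by rewrite /lower /move x0E; case: eqP; rewrite ?subr0.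
Qed.

(** Rows with an addable, respectively removable, box. *)
Definition up y i := ((i.2 == ord0) || (y i + 1 < y (i.1, inord i.2.-1))).
Definition down y i := if (i.2 : nat) == l then 0 < y i else y (i.1, inord i.2.+1) < y i - 1.

Lemma srt_up y i : srt y -> up y i -> srt (move y i 1).
Proof.
case=> y_ge0 y_dec; case: i => a p; rewrite /up /= => upp; split=> [i|a' p1 p2 lt].
  by rewrite /move; case: eqP => // _; rewrite addr_ge0.
rewrite /move; case: ((a', p2) =P (a, p)) => [[ea2 e2]|_]; case: ((a', p1) =P (a, p)) => [[ea e1]|_].
- by rewrite e2 e1 ltnn in lt.
- move: upp; rewrite -val_eqE /= -e2 -ea2 => /orP[/eqP z|]; first by rewrite z in lt.
  move/lt_le_trans; apply.
  have : (p1 <= p2.-1)%N by lia.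
  rewrite leq_eqVlt => /orP[/eqP <-|lt']; first by rewrite inord_val.
  by apply/ltW/y_dec; rewrite inordK //; have := ltn_ord p2; lia.
- by rewrite (lt_trans (y_dec _ _ _ lt)) // ltrDl.
by rewrite y_dec.
Qed.

Lemma srt_down y i : srt y -> down y i -> srt (move y i (-1)).
Proof.
case=> y_ge0 y_dec; case: i => a p; rewrite /down /= => dp; split=> [i|a' p1 p2 lt].
  rewrite /move; case: eqP => // ->; move: dp; case: ifP => [_|_].
    by rewrite subr_ge0 gtz0_ge1.
  by move=> lt; apply/ltW; apply: le_lt_trans lt.
rewrite /move; case: ((a', p2) =P (a, p)) => [[ea2 e2]|_]; case: ((a', p1) =P (a, p)) => [[ea e1]|_].
- by rewrite e2 e1 ltnn in lt.
- by rewrite (lt_trans _ (y_dec _ _ _ lt)) // gtrDl.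
- move: dp; rewrite -ea -e1; have := ltn_ord p2; case: eqP => [|ne] ltp2; first by lia.
  apply: le_lt_trans.
  have : (p1.+1 <= p2)%N by lia.
  rewrite leq_eqVlt => /orP[/eqP ->|lt']; first by rewrite inord_val.
  by apply/ltW/y_dec; rewrite inordK //; lia.
by rewrite y_dec.
Qed.

Lemma schur_ndown y i n (A : 'M_n) : srt y -> ~~ down y i -> A \in unitmx ->
  schur (move y i (-1)) A = 0.
Proof.
case=> y_ge0 y_dec; case: i => a p; rewrite /down /=; case: eqP => [el|ne] nd uA.
  by rewrite (@schur_neg _ _ _ (a, p)) // moveE; move: nd; rewrite -leNgt subr_lt0 => /le_lt_trans; apply.
have ltp : (p.+1 < l.+1)%N by have := ltn_ord p; lia.
have e : y (a, inord p.+1) = y (a, p) - 1.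
  apply/eqP; rewrite eq_le [_ - 1 <= _]leNgt nd andbT -ltzD1 subrK.
  by apply: y_dec; rewrite inordK.
have neq : (a, inord p.+1) != (a, p) :> bead.
  by rewrite xpair_eqE eqxx -val_eqE /= inordK // gtn_eqF.
by rewrite (schur_rep neq) // moveE (move_other _ _ neq) e.
Qed.

Lemma ip_down y i j n : srt y -> bsize y = (n + 1)%N%:Z ->
  ip (schur (move y i (-1)) (n := n)) (schur (move y j (-1)) (n := n)) =
  ((i == j) && down y i)%:R.
Proof.
move=> sy zy; have [di|ndi] := boolP (down y i); last first.
  by rewrite andbF ip0l // => A uA; apply: schur_ndown.
have [dj|ndj] := boolP (down y j); last first.
  by rewrite ip0r => [|A uA]; [case: eqP => // e; rewrite -e di in ndj | apply: schur_ndown].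
rewrite andbT; have [si sj] := (srt_down sy di, srt_down sy dj).
case: eqVneq => [<-|ne].
  apply: schur_norm => //; rewrite /bsize (bigD1 i) //= /lam moveE.
  rewrite (eq_bigr (fun j => lam y j)) => [|i' ne]; last by rewrite /lam move_other.
  move: zy; rewrite /bsize (bigD1 i) //= {1}/lam PoszD => e.
  by apply: (@addIr _ 1); rewrite -e; ring.
apply/eqP/contraT => nz; have /(_ i) := schur_orth si sj nz.
by rewrite moveE move_other // -[RHS]addr0 => /addrI.
Qed.

Lemma bsize_move y i z : bsize (move y i z) = bsize y + z.
Proof.
rewrite /bsize (bigD1 i) //= [in RHS](bigD1 i) //= /lam moveE.
rewrite (eq_bigr (fun j => lam y j)) => [|i' ne]; last by rewrite /lam move_other.
by rewrite /lam; ring.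
Qed.

Lemma srt_bsize_ge0 y : srt y -> 0 <= bsize y.
Proof. by move=> sy; apply: sumr_ge0 => i _; apply: srt_lam_ge0. Qed.

Lemma up_down y a (p : 'I_l) : up y (a, lift ord0 p) = down y (a, lift ord_max p).
Proof.
have v0 := lift0 p; have v1 := lift_max p.
move: (lift ord0 p) (lift ord_max p) v0 v1 => p0 p1 v0 v1.
rewrite /up /down -val_eqE /= v0 v1 /= (ltn_eqF (ltn_ord p)).
have -> : inord p = p1 by apply: val_inj; rewrite /= inordK ?v1 // ltnS ltnW.
have -> : inord p.+1 = p0 by apply: val_inj; rewrite /= inordK ?v0 // ltnS.
by rewrite ltrBrDr.
Qed.

(* Each removable box of a colour lies above exactly one addable box, and the first row
   always has another one. *)
Lemma card_up y a : y (a, ord_max) = 0 ->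
  \sum_(i : bead | i.1 == a) (up y i)%:R =
  1 + \sum_(i : bead | i.1 == a) (down y i)%:R :> algC.
Proof.
have toI (f : bead -> algC) : \sum_(i : bead | i.1 == a) f i = \sum_p f (a, p).
  transitivity (\sum_(a' | a' == a) \sum_p f (a', p)); last by rewrite big_pred1_eq.
  by rewrite pair_big_dep /=; apply: eq_big => [[? ?]|[? ?] _] //=; rewrite andbT.
move=> y0; rewrite !toI big_ord_recl {1}/up /= [in RHS]big_ord_recr /=; congr (_ + _).
rewrite {2}/down /= eqxx y0 ltxx addr0; apply: eq_bigr => p _; rewrite up_down.
by congr (down _ (_, _))%:R; apply: val_inj; rewrite /= /bump leqNgt ltn_ord.
Qed.

(** Call the two sides X and S. The pairings of X and S with themselves and with each other all
    equal the number N of addable boxes of colour a, so X - S has norm 0. The last row has to be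
    empty to leave room for a box that starts a new row. *)
Lemma pieri1 y a n (A : 'M_(n + 1)) : srt y -> bsize y = n%:Z -> y (a, ord_max) = 0 ->
  A \in unitmx ->
  hc_ind 1 a (schur y) A = \sum_(i : bead | (i.1 == a) && up y i) schur (move y i 1) A.
Proof.
move=> sy zy y0 uA; apply/eqP; rewrite -subr_eq0; apply/eqP.
pose X : fam := hc_ind 1 a (schur y).
pose S : fam := fun n A => \sum_(i : bead | (i.1 == a) && up y i) 1 * schur (move y i 1) A.
have cy := schur_cls y; have cX : cls X := hc_ind_cls _ _ _.
have cS : cls S by apply: (cls_sum _ _ (fun=> 1)) => i; apply: schur_cls.
pose N := \sum_(i : bead | i.1 == a) (up y i)%:R : algC.
have norm1 : ip (schur y (n := n)) (schur y (n := n)) = 1 by apply: schur_norm.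
have XS i : i.1 = a -> up y i -> ip (schur (move y i 1) (n := n + 1)) (@X (n + 1)%N) = 1.
  move=> ia ui; rewrite schur_adjoint1 // (bigD1 i) ?ia //= big1 ?addr0 => [|j /andP[_ ne]].
    rewrite -[RHS]norm1; apply: eq_ip => // B _; apply: eq_schur; apply: moveK.
    by rewrite subrr.
  have sx := srt_up sy ui.
  have zx : bsize (move y i 1) = (n + 1)%N%:Z by rewrite bsize_move zy PoszD.
  rewrite -[RHS](_ : ((j == i) && down (move y i 1) j)%:R = 0); last by rewrite (negPf ne).
  rewrite -(ip_down j i sx zx); apply: eq_ip => // B _; apply: eq_schur => x.
  by rewrite moveK ?subrr.
pose P i := (i.1 == a) && up y i.
have eN : N = \sum_(i | P i) 1.
  rewrite /N [RHS]big_mkcondr; apply: eq_bigr => i _.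
  by case: (up y i).
have SX : ip (@S (n + 1)%N) (@X (n + 1)%N) = N.
  rewrite [LHS]ip_suml eN; apply: eq_bigr => i /andP[/eqP ia ui].
  by rewrite mul1r XS.
have rN : N^* = N by rewrite eN rmorph_sum; apply: eq_bigr => i _; rewrite rmorph1.
have XSs : ip (@X (n + 1)%N) (@S (n + 1)%N) = N by rewrite ipC SX rN.
have SS : ip (@S (n + 1)%N) (@S (n + 1)%N) = N.
  rewrite [LHS]ip_suml eN; apply: eq_bigr => i Pi; have /andP[_ ui] := Pi.
  rewrite mul1r [LHS]ip_sumr (bigD1 i) //= conjC1 mul1r big1 => [|j /andP[/andP[_ uj] ne]].
    by rewrite addr0 schur_norm; [|exact: srt_up|rewrite bsize_move zy PoszD].
  apply/eqP; rewrite ?conjC1 mul1r; apply/contraT => nz.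
  have /(_ j) := schur_orth (srt_up sy ui) (srt_up sy uj) nz.
  by rewrite moveE move_other // -[LHS]addr0 => /addrI.
(* The Mackey formula has two terms: j = 1 gives the norm of [schur y], which is 1, and j = 0 gives
   the number of removable boxes. By [card_up] the total is N. *)
have XX : ip (@X (n + 1)%N) (@X (n + 1)%N) = N.
  rewrite /N card_up // /X (mackey_ip a a cy cy erefl) big_mkcond.
  rewrite big_ord_recl big_ord_recl big_ord0 /= addr0 addrC.
  rewrite eqxx andbT (_ : 1 - bump 0 0 = 0)%N // !subn0; congr (_ + _).
    by rewrite -[RHS]norm1; apply: eq_ip => B uB; rewrite hc_res0.
  case: n zy A uA {norm1 XS S cS eN SX XSs SS} => [|n] zy A uA.
    rewrite /= big1 // => i _; case: (boolP (down y i)) => // di.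
    have := srt_down sy di => /srt_bsize_ge0; rewrite bsize_move zy; lia.
  rewrite subn1 /= frobenius_l //.
  have e1 : (n.+1 = n + 1)%N by rewrite addn1.
  have cHd : cls (hc_res 1 a (schur y)) by apply: hc_res_cls.
  rewrite schur_adjoint1 //; apply: eq_bigr => i ia.
  rewrite ipC frobenius_l // schur_adjoint1 ?rmorph_sum //=; last exact: schur_cls.
  rewrite (bigD1 i) //= big1 ?addr0 => [|j /andP[_ ne]].
    by rewrite (ip_down i i sy) ?eqxx ?conjC_nat // zy e1.
  by rewrite (ip_down j i sy) ?(negPf ne) ?conjC0 // zy e1.
transitivity (@X (n + 1)%N A - @S (n + 1)%N A).
  by congr (_ - _); apply: eq_bigr => i _; rewrite mul1r.
apply: (ip_eq0 (f := fun A => @X (n + 1)%N A - @S (n + 1)%N A)) => //.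
by rewrite ipBl !ipBr XX XSs SX SS !subrr.
Qed.

End Pieri.

(** * Irreducible characters of general linear groups *)

Section Bridge.

Variable F : finFieldType.
Local Notation colour := (colour F).
Local Notation fam := (forall n, 'M[F]_n -> algC).

(** Being a character, stated on matrices so that it is also correct at n = 0, where ['GL_0[F]] is a
    group of matrices of size 1. *)
Definition afforded n (f : 'M[F]_n -> algC) := exists d (rho : 'M[F]_n -> 'M[algC]_d),
  [/\ rho 1%:M = 1%:M,
      forall A B, A \in unitmx -> B \in unitmx -> rho (A *m B) = rho A *m rho B &
      forall A, A \in unitmx -> f A = \tr (rho A)].

Lemma afforded0 n (f : 'M[F]_n -> algC) : (forall A, A \in unitmx -> f A = 0) -> afforded f.
Proof.
move=> f0; exists 0%N, (fun=> 0); split=> [|A B _ _|A uA]; last by rewrite f0 ?mxtrace0.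
  by rewrite [RHS]flatmx0.
by rewrite mul0mx.
Qed.

Lemma eq_afforded n (f f' : 'M[F]_n -> algC) : (forall A, A \in unitmx -> f A = f' A) ->
  afforded f -> afforded f'.
Proof.
by move=> e [d [rho [r1 rM rT]]]; exists d, rho; split=> // A uA; rewrite -e ?rT.
Qed.

Variable k : nat.
Local Notation G := ('GL_(k.+1)[F])%G.
Local Notation gT := {'GL_(k.+1)[F]}.
Implicit Types (x y : gT).

Definition glmx (A : 'M[F]_k.+1) : gT := insubd (1%g : gT) A.

Lemma glmxK x : glmx (GLval x) = x. Proof. exact: valKd. Qed.

Lemma val_glmx A : A \in unitmx -> GLval (glmx A) = A.
Proof. by move=> uA; apply: insubdK. Qed.

Lemma GLval_unit x : GLval x \in unitmx. Proof. exact: GL_unitmx. Qed.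

Lemma sum_GL (R : nmodType) (f : 'M[F]_k.+1 -> R) :
  \sum_(x in G) f (GLval x) = \sum_(A | A \in unitmx) f A.
Proof.
rewrite [RHS](reindex_onto (@GLval k.+1 F) glmx) /=; last by move=> A; apply: val_glmx.
by apply: eq_bigl => x; rewrite glmxK eqxx inE GLval_unit.
Qed.

Lemma card_GLE : #|G| = gl F k.+1.
Proof. by rewrite -sum1_card (sum_GL (fun=> 1%N)) sum1_card. Qed.

Lemma cfdot_ip (phi psi : 'CF(G)) (f g : 'M[F]_k.+1 -> algC) :
  (forall x, phi x = f (GLval x)) -> (forall x, psi x = g (GLval x)) ->
  '[phi, psi] = ip f g.
Proof.
move=> ef eg; rewrite cfdotE card_GLE /ip; congr (_ * _).
by rewrite -(sum_GL (fun A => f A * (g A)^*)); apply: eq_bigr => x _; rewrite ef eg.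
Qed.

Lemma afforded_char (phi : 'CF(G)) : phi \is a character ->
  afforded (fun A => phi (glmx A)).
Proof.
case/char_reprP=> rG ->; exists (rdegree rG), (fun A => rG (glmx A)).
split=> [|A B uA uB|A uA]; last by rewrite cfunE inE mulr1n.
  by rewrite -[1%:M]/(GLval (1%g : gT)) glmxK repr_mx1.
rewrite -repr_mxM ?inE //; congr (rG _); apply: val_inj.
by rewrite -[LHS]/(GLval _) -[RHS]/(GLval _) GL_MxE !val_glmx ?unitmx_mul ?uA.
Qed.

Section Parabolic.

Variables (m r : nat) (Z0 : 'M[F]_(m + r, k.+1)).
Hypothesis fZ0 : frame Z0.

Definition para_set : {set gT} := [set x : gT | para (conj_mx Z0 (GLval x))].

Lemma para_set_group : group_set para_set.
Proof.
apply/group_setP; split=> [|x y]; first by rewrite inE GL_1E conj_mx_id // para1.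
by rewrite !inE GL_MxE conj_mx_mul //; apply: para_mul.
Qed.
Canonical para_group := Group para_set_group.

Lemma card_para_group : #|para_group| = Psize F m r.
Proof.
rewrite -card_para -!sum1_card.
rewrite [RHS](reindex_onto (fun x : gT => conj_mx Z0 (GLval x))
   (fun Y => glmx (conj_mx (frinv Z0) Y))) /=.
  by apply: eq_bigl => x; rewrite (conj_mxK fZ0) glmxK eqxx andbT !inE.
move=> Y /para_frame; rewrite frame_square => uY.
by rewrite val_glmx ?conj_mxKV // conj_mx_unit // frame_frinv.
Qed.

Lemma para_blocks (x y : gT) : x \in para_set -> y \in para_set ->
  ulsubmx (conj_mx Z0 (GLval (x * y)%g)) =
    ulsubmx (conj_mx Z0 (GLval x)) *m ulsubmx (conj_mx Z0 (GLval y)) /\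
  drsubmx (conj_mx Z0 (GLval (x * y)%g)) =
    drsubmx (conj_mx Z0 (GLval x)) *m drsubmx (conj_mx Z0 (GLval y)).
Proof.
rewrite !inE GL_MxE conj_mx_mul // => /paraP[A [X [B [uA uB ->]]]] /paraP[A' [X' [B' [uA' uB' ->]]]].
by rewrite mulmx_block !block_mxKul !block_mxKdr !(mul0mx, mulmx0, addr0, add0r).
Qed.

Lemma para_unit_blocks x : x \in para_set ->
  (ulsubmx (conj_mx Z0 (GLval x)) \in unitmx) /\ (drsubmx (conj_mx Z0 (GLval x)) \in unitmx).
Proof.
by rewrite inE => /paraP[A [X [B [uA uB ->]]]]; rewrite block_mxKul block_mxKdr.
Qed.

Lemma pfun_char a (f : 'M[F]_m -> algC) : afforded f ->
  exists2 psi : 'CF(para_group), psi \is a character &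
    forall x, x \in para_group -> psi x = pfun a f (conj_mx Z0 (GLval x)).
Proof.
case=> d [rho [r1 rM rT]].
pose rG (x : gT) := ch a (\det (drsubmx (conj_mx Z0 (GLval x)))) *:
                    rho (ulsubmx (conj_mx Z0 (GLval x))).
have rGP : mx_repr para_group rG.
  split=> [|x y Px Py].
    rewrite /rG GL_1E conj_mx_id // scalar_mx_block block_mxKul block_mxKdr det1 ch1 scale1r.
    exact: r1.
  have [eul edr] := para_blocks Px Py.
  have [[u1 v1] [u2 v2]] := (para_unit_blocks Px, para_unit_blocks Py).
  rewrite /rG eul edr rM // det_mulmx chM -?unitfE -?unitmxE //.
  by rewrite -scalemxAl -scalemxAr scalerA.
exists (cfRepr (MxRepresentation rGP)); first exact: cfRepr_char.
move=> x Px; rewrite cfunE Px mulr1n /= /rG mxtraceZ mulrC -rT; last by case: (para_unit_blocks Px).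
by rewrite /pfun; move: Px; rewrite inE => /andP[_ ->].
Qed.

Lemma hc_ind_at_Ind a (f : 'M[F]_m -> algC) (psi : 'CF(para_group)) :
  (forall x, x \in para_group -> psi x = pfun a f (conj_mx Z0 (GLval x))) ->
  forall x, 'Ind[G] psi x = hc_ind_at r a f (GLval x).
Proof.
move=> epsi x; rewrite cfIndE ?subsetT // card_para_group /hc_ind_at; congr (_ * _).
pose h (A : 'M[F]_k.+1) := psi (x ^ glmx A)%g.
rewrite (eq_bigr (fun y => h (GLval y))) => [|y _]; last by rewrite /h glmxK.
rewrite sum_GL -(sum_frame_frinv (fun Z => pfun a f (conj_mx Z (GLval x)))).
rewrite -(sum_frame_mulr _ (frame_frinv fZ0)).
apply: eq_big => [A|A uA]; first by rewrite frame_square.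
rewrite frinv_mul ?frame_square ?frame_frinv // frinvK // /h.
have -> : conj_mx (Z0 *m frinv A) (GLval x) = conj_mx Z0 (GLval (x ^ glmx A)%g).
  rewrite conj_mxM ?frame_frinv ?frame_square //; congr conj_mx.
  rewrite /conj_mx frinvK ?frame_square // conjgE !GL_MxE GL_VxE val_glmx // mulmxA.
  congr (_ *m _ *m _); apply/esym/frame_inv_unique; rewrite ?frame_square //.
  exact: mulmxV.
have [Px|nPx] := boolP ((x ^ glmx A)%g \in para_group); first by rewrite epsi.
rewrite cfun0 // /pfun; case: ifP => // u0; case/negP: nPx.
by rewrite inE /para u0 conj_mx_unit // GLval_unit.
Qed.

Lemma hc_ind_at_char a (f : 'M[F]_m -> algC) : afforded f ->
  exists2 phi : 'CF(G), phi \is a character & forall x, phi x = hc_ind_at r a f (GLval x).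
Proof.
case/(pfun_char a) => psi cpsi epsi; exists ('Ind[G] psi); first exact: cfInd_char.
exact: hc_ind_at_Ind.
Qed.

End Parabolic.

End Bridge.

Section SchurCharacters.

Variable F : finFieldType.
Local Notation colour := (colour F).
Local Notation fam := (forall n, 'M[F]_n -> algC).

Lemma frame_exists (m n : nat) : m = n -> exists Z : 'M[F]_(m, n), frame Z.
Proof. by move->; exists 1%:M; apply: frame1. Qed.

Lemma hc_indz_afforded z (a : colour) (f : fam) :
  cls f -> (forall n, afforded (@f n)) -> forall n, afforded (@hc_indz F z a f n).
Proof.
move=> cf af n; case: z => [r|r] /=; last exact: afforded0.
have [ltnr|lern] := ltnP n r; first by apply: afforded0 => A _; apply: hc_ind_neg.
case: n lern => [|k] lern.
  have -> : r = 0%N by case: r lern.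
  by apply: eq_afforded (af 0%N) => A uA; rewrite hc_ind0.
have [Z0 fZ0] := frame_exists (subnK lern).
have [phi cphi ephi] := hc_ind_at_char fZ0 a (af (k.+1 - r)%N).
apply: eq_afforded (afforded_char cphi) => A uA.
by rewrite ephi val_glmx.
Qed.

Lemma hrow_afforded (I : finType) (c : I -> colour) L gam n : afforded (hrow c L gam (n := n)).
Proof.
elim: L n => [|i L IH] n; last exact: hc_indz_afforded (hrow_cls _ _ _) IH _.
rewrite /= /unit_fam; case: n => [|n]; last exact: afforded0.
exists 1%N, (fun=> 1%:M); split=> // [A B|A] _; first by rewrite mulmx1.
by rewrite mxtrace1.
Qed.

Variables (k l : nat).
Local Notation G := ('GL_(k.+1)[F])%G.
Local Notation gT := {'GL_(k.+1)[F]}.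

Lemma char_afforded (f : 'M[F]_k.+1 -> algC) : afforded f ->
  exists2 phi : 'CF(G), phi \is a character & forall x, phi x = f (GLval x).
Proof.
case=> d [rho [r1 rM rT]].
have rGP : mx_repr G (fun x : gT => rho (GLval x)).
  by split=> [|x y _ _]; rewrite ?GL_1E ?GL_MxE ?rM ?GLval_unit.
exists (cfRepr (MxRepresentation rGP)); first exact: cfRepr_char.
by move=> x; rewrite cfunE inE mulr1n rT ?GLval_unit.
Qed.

Lemma schur_vchar (b : bead F l -> int) :
  exists2 phi : 'CF(G), phi \in 'Z[irr G]%g & forall x, phi x = schur b (GLval x).
Proof.
pose g (w : {perm bead F l}) := hrow fst (rows F l) (fun i => b i - (pos (w i))%:Z) (n := k.+1).
have ex w : exists phi : 'CF(G), (phi \in 'Z[irr G]%g) && [forall x, phi x == g w (GLval x)].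
  have [phi cphi ephi] := char_afforded (hrow_afforded fst (rows F l) (fun i => b i - (pos (w i))%:Z) k.+1).
  exists phi; rewrite char_vchar //; apply/forallP => x; rewrite ephi; exact: eqxx.
exists (\sum_(w | colp w) (-1) ^+ w *: xchoose (ex w)).
  apply: rpred_sum => w _; rewrite rpredZsign.
  by case/andP: (xchooseP (ex w)).
move=> x; rewrite sum_cfunE; apply: eq_bigr => w _; rewrite cfunE.
by case/andP: (xchooseP (ex w)) => _ /forallP/(_ x)/eqP ->.
Qed.

Lemma schur_irr (b : bead F l -> int) : srt b -> bsize b = (k.+1)%:Z ->
  exists i (eps : bool), forall x, schur b (GLval x) = (-1) ^+ eps * ('chi[G]_i x).
Proof.
move=> sb zb; have [phi zphi ephi] := schur_vchar b.
have n1 : '[phi] = 1 by rewrite (cfdot_ip ephi ephi) schur_norm.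
have [eps [i ephi']] := vchar_norm1P zphi n1; exists i, eps => x.
by rewrite -ephi ephi' cfunE.
Qed.

End SchurCharacters.

(** * Parity of degrees and fixed points of the unipotent radical *)

Definition par (x : algC) : bool := ~~ (2%N %| x)%C.

Lemma par_int (z : int) : par z%:~R = odd `|z|%N.
Proof. by rewrite /par dvdC_int ?rpred_int // intrKfloor dvdn2 negbK. Qed.

Lemma parD x y : x \is a Num.int -> y \is a Num.int -> par (x + y) = par x (+) par y.
Proof. by move=> /intrP[m ->] /intrP[n ->]; rewrite -intrD !par_int; lia. Qed.

Lemma parM x y : x \is a Num.int -> y \is a Num.int -> par (x * y) = par x && par y.
Proof. by move=> /intrP[m ->] /intrP[n ->]; rewrite -intrM !par_int; rewrite abszM oddM. Qed.

Lemma par_nat n : par n%:R = odd n.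
Proof. exact: (par_int n). Qed.

Lemma parN x : x \is a Num.int -> par (- x) = par x.
Proof. by move=> /intrP[m ->]; rewrite -intrN !par_int; lia. Qed.

Lemma par_sum (I : finType) (P : pred I) (f : I -> algC) :
  (forall i, P i -> f i \is a Num.int) ->
  par (\sum_(i | P i) f i) = \big[addb/false]_(i | P i) par (f i).
Proof.
move=> fi; suff [] : (\sum_(i | P i) f i) \is a Num.int /\
  par (\sum_(i | P i) f i) = \big[addb/false]_(i | P i) par (f i) by [].
apply: (big_rec2 (fun x b => x \is a Num.int /\ par x = b)).
  by split; rewrite ?rpred0 // (par_nat 0).
by move=> i b x Pi [xi <-]; rewrite rpredD ?fi // parD ?fi.
Qed.

(* Pairing each u <> 1 of U with its inverse writes |U| <phi, 1>_U as phi(1) plus twice an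
   algebraic integer. *)
Lemma par_fixed (gT : finGroupType) (X U : {group gT}) t (phi : 'CF(X)) :
  U \subset X -> t \in X -> odd #|U| -> {in U, forall u, (u ^ t = u^-1)%g} ->
  phi \in 'Z[irr X]%g -> par (phi 1%g) = par '['Res[U] phi, 1].
Proof.
move=> sUX Xt oU ut zphi; set m := '[_, _].
have mi : m \is a Num.int by rewrite /m -irr0 Cint_cfdot_vchar_irr // cfRes_vchar.
pose lt (u v : gT) := (enum_rank u < enum_rank v)%N.
pose al := \sum_(u in U | lt u u^-1%g) phi u.
have phiV u : u \in U -> phi u^-1%g = phi u by move=> Uu; rewrite -ut // cfunJ.
have e : #|U|%:R * m = phi 1%g + 2 * al.
  rewrite /m cfdotE mulrA mulfV ?neq0CG // mul1r.
  rewrite (eq_bigr phi) => [|u Uu]; last by rewrite cfResE // cfun1E Uu rmorph1 mulr1.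
  rewrite (bigD1 1%g) //=; congr (_ + _).
  rewrite (bigID (fun u => lt u u^-1%g)) /= mulrDl mul1r; congr (_ + _).
    apply: eq_bigl => u; rewrite -andbA; congr (_ && _).
    by rewrite andb_idl // => h; apply: contraTneq h => ->; rewrite invg1 /lt ltnn.
  rewrite (reindex_inj invg_inj) /=.
  apply: eq_big => [u|u /andP[/andP[]]]; last by rewrite groupV => Uu _ _; rewrite phiV.
  rewrite groupV invg_eq1 invgK /lt -leqNgt -andbA; apply: andb_id2l => Uu.
  rewrite leq_eqVlt; case: (eqVneq u 1%g) => [->|nu] /=; first by rewrite invg1 ltnn.
  rewrite (inj_eq val_inj) (inj_eq enum_rank_inj); case: eqP => //= euV.
  case/eqP: nu; have u2 : (u ^+ 2 = 1)%g by rewrite expgS expg1 {1}euV mulVg.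
  apply/eqP; rewrite -order_eq1; have := order_dvdG Uu.
  have := order_dvdn u 2; rewrite u2 eqxx => /dvdn_leq-/(_ isT).
  by case: #[u]%g (order_gt0 u) oU => [|[|[|]]] // _ oU _; rewrite dvdn2 oU.
(* As a sum of character values al is an algebraic integer, and the identity [e] shows that it is
   rational. *)
have ai : al \is a Num.int.
  rewrite Cint_rat_Aint //; last by apply: rpred_sum => u _; apply: Aint_vchar.
  have -> : al = 2^-1 * (#|U|%:R * m - phi 1%g) by rewrite e; field.
  have ic x : x \is a Num.int -> x \in Crat by case/intrP=> z ->; apply: rpred_int.
  clearbody m; apply: rpredM; first by rewrite rpredV rpred_nat.
  by apply: rpredB; apply: ic; rewrite ?Cint_vchar1 ?rpredM ?rpred_nat.
clearbody m; have := congr1 par e.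
rewrite parM ?rpred_nat // par_nat oU /= => ->.
rewrite parD ?Cint_vchar1 ?rpredM ?rpred_nat // parM ?rpred_nat // (par_nat 2) /= addbF.
by [].
Qed.

Section Unipotent.

Variable F : finFieldType.
Local Notation colour := (colour F).
Local Notation fam := (forall n, 'M[F]_n -> algC).
Variables (k m r : nat) (Z0 : 'M[F]_(m + r, k.+1)).
Hypothesis fZ0 : frame Z0.
Local Notation G := ('GL_(k.+1)[F])%G.
Local Notation gT := {'GL_(k.+1)[F]}.
Local Notation P := (para_group fZ0).

Definition parael (A : 'M[F]_m) (X : 'M[F]_(r, m)) (B : 'M[F]_r) : gT :=
  glmx (conj_mx (frinv Z0) (block_mx A 0 X B)).

Lemma parael_val A X B : A \in unitmx -> B \in unitmx ->
  conj_mx Z0 (GLval (parael A X B)) = block_mx A 0 X B.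
Proof.
move=> uA uB; rewrite val_glmx ?conj_mxKV // conj_mx_unit ?frame_frinv //.
by rewrite unitmx_lblock uA.
Qed.

Lemma parael_para A X B : A \in unitmx -> B \in unitmx -> parael A X B \in P.
Proof. by move=> uA uB; rewrite inE parael_val // para_lblock uA. Qed.

Lemma parael_mul A X B A' X' B' : A \in unitmx -> B \in unitmx -> A' \in unitmx -> B' \in unitmx ->
  (parael A X B * parael A' X' B')%g = parael (A *m A') (X *m A' + B *m X') (B *m B').
Proof.
move=> uA uB uA' uB'; set x := (_ * _)%g.
rewrite -(glmxK x) -(conj_mxK fZ0 (GLval x)) /x; congr (glmx (conj_mx _ _)).
by rewrite GL_MxE conj_mx_mul // !parael_val // mulmx_block !(mul0mx, mulmx0, addr0, add0r).
Qed.

Lemma parael1 : parael 1%:M 0 1%:M = 1%g.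
Proof.
by rewrite /parael -scalar_mx_block conj_mx_id ?frame_frinv // -[1%:M]/(GLval (1%g : gT)) glmxK.
Qed.

Lemma parael_inj A X B A' X' B' : A \in unitmx -> B \in unitmx -> A' \in unitmx -> B' \in unitmx ->
  parael A X B = parael A' X' B' -> [/\ A = A', X = X' & B = B'].
Proof.
move=> uA uB uA' uB' e; have := congr1 (fun x : gT => conj_mx Z0 (GLval x)) e.
by rewrite !parael_val // => /eq_block_mx[-> _ -> ->].
Qed.

Definition unip_set : {set gT} := [set parael 1%:M X 1%:M | X : 'M[F]_(r, m)].

Lemma unip_group_set : group_set unip_set.
Proof.
apply/group_setP; split=> [|_ _ /imsetP[X _ ->] /imsetP[Y _ ->]].
  by apply/imsetP; exists 0; rewrite ?parael1.
by apply/imsetP; exists (X + Y); rewrite // parael_mul ?unitmx1 // !mulmx1 mul1mx.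
Qed.
Canonical unip_group := Group unip_group_set.

Lemma unip_inj : injective (fun X => parael 1%:M X 1%:M).
Proof. by move=> X Y /parael_inj; rewrite !unitmx1; case. Qed.

Lemma card_unip : #|unip_group| = (#|F| ^ (r * m))%N.
Proof. by rewrite card_imset; [rewrite card_mx | apply: unip_inj]. Qed.

Lemma sum_unip (f : gT -> algC) : \sum_(u in unip_group) f u = \sum_X f (parael 1%:M X 1%:M).
Proof. by rewrite big_imset //= => X Y _ _; apply: unip_inj. Qed.

Lemma sub_unip_para : unip_group \subset P.
Proof. by apply/subsetP => _ /imsetP[X _ ->]; rewrite parael_para ?unitmx1. Qed.

Lemma unip_inverted : {in unip_group, forall u, (u ^ parael 1%:M 0 (- 1%:M) = u^-1)%g}.
Proof.
have uN : (- 1%:M : 'M[F]_r) \in unitmx by rewrite -scaleN1r unitmxZ ?unitrN1 ?unitmx1.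
move=> _ /imsetP[X _ ->]; rewrite /conjg; apply: (canLR (mulKg _)).
apply: (canRL (mulgK _)); rewrite !parael_mul ?unitmx1 ?mul1mx ?mulmx1 //.
  by rewrite addr0 mulNmx mul1mx subrr.
exact: unitmx1.
Qed.

Lemma par_unip (X : {group gT}) (phi : 'CF(X)) : odd #|F| -> P \subset X ->
  phi \in 'Z[irr X]%g -> par (phi 1%g) = par '['Res[unip_group] phi, 1].
Proof.
move=> oq sPX; apply: par_fixed unip_inverted.
- exact: subset_trans sub_unip_para sPX.
- by apply: (subsetP sPX); rewrite parael_para ?unitmx1 // -scaleN1r unitmxZ ?unitrN1 ?unitmx1.
- by rewrite card_unip oddX oq orbT.
Qed.

Lemma cfdot_unip1 (X : {group gT}) (phi : 'CF(X)) : P \subset X ->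
  '['Res[unip_group] phi, 1] = (#|F| ^ (r * m))%:R^-1 * \sum_Y phi (parael 1%:M Y 1%:M).
Proof.
move=> sPX; rewrite cfdotE card_unip; congr (_ * _); rewrite -sum_unip; apply: eq_bigr => u Uu.
by rewrite cfun1E Uu rmorph1 mulr1 cfResE // (subset_trans sub_unip_para).
Qed.

End Unipotent.

Section FixedPoints.

Variable F : finFieldType.
Local Notation colour := (colour F).
Local Notation fam := (forall n, 'M[F]_n -> algC).

Lemma sum_unitmx1 (R : nmodType) (g : 'M[F]_1 -> R) :
  \sum_(B | B \in unitmx) g B = \sum_(x | x != 0) g x%:M.
Proof.
rewrite (reindex_onto (@scalar_mx F 1) (fun B => B 0 0)) /= => [|B _]; last first.
  by rewrite -mx11_scalar.
apply: eq_bigl => x; rewrite mxE !eqxx !andbT.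
by rewrite unitmxE det_scalar1 unitfE.
Qed.

Lemma gl1 : gl F 1 = #|F|.-1.
Proof.
have -> : gl F 1 = (\sum_(B : 'M[F]_1 | B \in unitmx) 1)%N by rewrite sum1_card.
rewrite sum_unitmx1 sum1_card -(cardC1 (0 : F)).
by apply: eq_card => x; rewrite !inE.
Qed.

(** Summing over all colours eliminates GL_1: by [sum_ch_colour] only B = 1 survives, which leaves
    the average over the unipotent radical. *)
Lemma sum_hc_res1 (f : fam) m :
  \sum_(a : colour) hc_res 1 a f (1%:M : 'M_m) =
  (#|F| ^ (1 * m))%:R^-1 * \sum_(X : 'M_(1, m)) f (m + 1)%N (block_mx 1%:M 0 X 1%:M).
Proof.
rewrite /hc_res -big_distrr /= exchange_big /= sum_unitmx1 (bigD1 1) ?oner_neq0 //=.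
rewrite [X in _ + X]big1 ?addr0 => [|x /andP[x0 nx1]]; last first.
  rewrite exchange_big big1 // => X _; rewrite -mulr_suml -rmorph_sum det_scalar1.
  by rewrite sum_ch_colour // (negPf nx1) mulr0n rmorph0 mul0r.
rewrite exchange_big /= natrM invfM -mulrA mulrCA; congr (_ * _).
rewrite mulr_sumr; apply: eq_bigr => X _; rewrite -mulr_suml -rmorph_sum det1.
rewrite sum_ch_colour ?oner_neq0 // eqxx mulr1n rmorph_nat mulrA gl1 mulVf ?mul1r //.
by rewrite -gl1 gl_neq0.
Qed.

Variable k : nat.
Local Notation G := ('GL_(k.+1)[F])%G.
Local Notation gT := {'GL_(k.+1)[F]}.

(* pid_mx is the identity at level k.+1 and only serves to type the other levels. *)
Definition ext (phi : 'CF(G)) : fam := fun n A =>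
  if n == k.+1 then phi (glmx (conj_mx (pid_mx n : 'M_(k.+1, n)) A)) else 0.

Lemma extE phi A : @ext phi k.+1 A = phi (glmx A).
Proof. by rewrite /ext eqxx pid_mx_1 conj_mx1. Qed.

Lemma ext_val phi x : ext phi (GLval x) = phi x.
Proof. by rewrite extE glmxK. Qed.

Lemma ext_cls phi : cls (ext phi).
Proof.
move=> p n Z A fZ uA; have e := frame_dim fZ; subst p; rewrite /ext; case: eqP => // e; subst n.
rewrite pid_mx_1 !conj_mx1 -[A in RHS](val_glmx uA) glmxK.
have uZ : Z \in unitmx by rewrite -frame_square.
rewrite -(cfunJ phi (glmx A) (in_setT (glmx Z)^-1%g)); congr (phi _).
rewrite conjgE invgK; apply: val_inj; rewrite -[LHS]/(GLval _) -[RHS]/(GLval _).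
rewrite val_glmx ?conj_mx_unit // !GL_MxE GL_VxE !val_glmx // /conj_mx mulmxA.
by congr (_ *m _); apply/esym/frame_inv_unique => //; apply: mulmxV.
Qed.

Variable Z0 : 'M[F]_(k + 1, k.+1).
Hypothesis fZ0 : frame Z0.
Local Notation P := (para_group fZ0).

Lemma parael_fam (f : fam) A X B : cls f -> A \in unitmx -> B \in unitmx ->
  f k.+1 (GLval (parael Z0 A X B)) = f (k + 1)%N (block_mx A 0 X B).
Proof.
move=> cf uA uB; have uX : block_mx A 0 X B \in unitmx by rewrite unitmx_lblock uA.
by rewrite val_glmx ?conj_mx_unit ?frame_frinv // cf ?frame_frinv.
Qed.

Lemma cfdot_unip_hc_res (phi : 'CF(G)) (f : fam) : cls f -> (forall x, phi x = f k.+1 (GLval x)) ->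
  '['Res[unip_group fZ0] phi, 1] = \sum_(a : colour) hc_res 1 a f (1%:M : 'M_k).
Proof.
move=> cf ef; rewrite cfdot_unip1 ?subsetT // sum_hc_res1; congr (_ * _).
by apply: eq_bigr => X _; rewrite ef parael_fam ?unitmx1.
Qed.

Lemma par_hc_res (phi : 'CF(G)) (f : fam) : odd #|F| -> cls f ->
  (forall x, phi x = f k.+1 (GLval x)) -> phi \in 'Z[irr G]%g ->
  par (f k.+1 1%:M) = par (\sum_(a : colour) hc_res 1 a f (1%:M : 'M_k)).
Proof.
move=> oq cf ef zphi; rewrite -(cfdot_unip_hc_res cf ef) -par_unip ?subsetT //.
by rewrite ef GL_1E.
Qed.

Lemma ip_cast (f g : fam) m n : m = n -> ip (@f m) (@g m) = ip (@f n) (@g n).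
Proof. by move->. Qed.

Lemma frobenius_char a (f g : fam) : cls f ->
  ip (@hc_res _ 1 a f k) (@g k) = ip (@f k.+1) (@hc_ind _ 1 a g k.+1).
Proof. by move=> cf; rewrite frobenius_l // (ip_cast f (hc_ind 1 a g) (addn1 k)). Qed.

End FixedPoints.

Lemma uniq_sumn_ge (s : seq nat) : uniq s -> (\sum_(i < size s) i <= sumn s)%N.
Proof.
move zs: (size s) => m us; elim: m s zs us => [|m IH] s zs us; first by rewrite big_ord0.
have [x sx gex] : exists2 x, x \in s & (m <= x)%N.
  apply/hasP; apply: contraT => /hasPn nge.
  have /(uniq_leq_size us) : {subset s <= iota 0 m}.
    by move=> x /nge; rewrite -ltnNge mem_iota.
  by rewrite zs size_iota ltnn.
have zr := size_rem sx; rewrite zs /= in zr.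
rewrite big_ord_recr /= (perm_sumn (perm_to_rem sx)) /= addnC.
by apply: leq_add => //; apply: IH; rewrite ?zr ?rem_uniq.
Qed.

Section Families.

Variable F : finFieldType.
Local Notation colour := (colour F).
Local Notation fam := (forall n, 'M[F]_n -> algC).

Lemma fam_cfun k (f : fam) : cls f ->
  exists phi : 'CF('GL_(k.+1)[F]), forall x, phi x = f k.+1 (GLval x).
Proof.
move=> cf; pose h (x : {'GL_(k.+1)[F]}) := f k.+1 (GLval x).
have hP : is_class_fun <<'GL_(k.+1)[F]>>%g (finfun h).
  apply: intro_class_fun => [x y _ _|x]; last by case/negP; rewrite mem_gen ?inE.
  have e : conj_mx (GLval y^-1%g) (GLval x) = GLval (x ^ y)%g.
    rewrite /conj_mx conjgE !GL_MxE mulmxA; congr (_ *m _); apply/esym/frame_inv_unique.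
      by rewrite frame_square GLval_unit.
    by rewrite -GL_MxE mulVg.
  by rewrite /h -e cf // ?frame_square GLval_unit.
by exists (Cfun 0 hP) => x; rewrite cfunE.
Qed.

(** By adjunction each multiplicity is an inner product of two characters of the larger group, hence
    a natural number; this replaces the construction of a module of fixed points. *)
Lemma hc_res_char k a (f : fam) (phi : 'CF('GL_(k.+2)[F])) : cls f -> phi \is a character ->
  (forall x, phi x = f k.+2 (GLval x)) ->
  exists2 psi : 'CF('GL_(k.+1)[F]), psi \is a character &
    forall x, psi x = hc_res 1 a f (GLval x).
Proof.
move=> cf cphi ephi; have [psi epsi] := fam_cfun k (hc_res_cls 1 a cf); exists psi => //.
have nat i : '[psi, 'chi_i] \is a Num.nat.
  rewrite (cfdot_ip (g := @ext F k 'chi_i k.+1) epsi); last by move=> x; rewrite ext_val.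
  rewrite (@frobenius_char F k.+1 a _ _ cf).
  have [Z0 fZ0] := frame_exists F (addn1 k.+1).
  have af : afforded (@ext F k 'chi_i k.+1).
    apply: eq_afforded (afforded_char (irr_char i)) => A uA.
    by rewrite -{2}(val_glmx uA) ext_val.
  have [Phi cPhi ePhi] := hc_ind_at_char fZ0 a af.
  rewrite -(cfdot_ip (psi := Phi) ephi); first exact: Cnat_cfdot_char.
  by move=> x; rewrite ePhi (hc_indE _ _ _ (addn1 k.+1)).
rewrite [psi]cfun_sum_cfdot; apply: rpred_sum => i _.
by have /natrP[m ->] := nat i; rewrite scaler_nat rpredMn ?irr_char.
Qed.

Variable l : nat.
Local Notation bead := (bead F l).
Implicit Types (b y : bead -> int) (i j : bead).

Lemma sum_bead (R : nmodType) (f : bead -> R) : \sum_i f i = \sum_(a : colour) \sum_p f (a, p).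
Proof. by rewrite pair_bigA; apply: eq_bigr => -[]. Qed.

Lemma schur_int b n : schur b (1%:M : 'M_n) \is a Num.int.
Proof.
apply: rpred_sum => w _; rewrite rpredM ?rpredX ?rpredN1 //.
have [d [rho [r1 _ rT]]] := hrow_afforded fst (rows F l) (fun i => b i - (pos (w i))%:Z) n.
by rewrite rT ?unitmx1 // r1 mxtrace1 rpred_nat.
Qed.

(** [schur_adjoint1] gives the pairing of the two sides with every class function, in particular
    with their difference. *)
Lemma hc_res_schur a b n (A : 'M_n) : A \in unitmx ->
  hc_res 1 a (schur b) A = \sum_(i : bead | i.1 == a) schur (move b i (-1)) A.
Proof.
move=> uA; apply/eqP; rewrite -subr_eq0; apply/eqP.
pose S : fam := fun n A => \sum_(i : bead | i.1 == a) 1 * schur (move b i (-1)) A.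
pose d : fam := fun n A => hc_res 1 a (schur b) A - S n A.
have cS : cls S by apply: (cls_sum _ _ (fun=> 1)) => i; apply: schur_cls.
have cH : cls (hc_res 1 a (schur b)) by apply/hc_res_cls/schur_cls.
have cd : cls d by move=> p k Z B fZ uB; rewrite /d (cH _ _ _ _ fZ uB) (cS _ _ _ _ fZ uB).
transitivity (d n A).
  by congr (_ - _); apply: eq_bigr => i _; rewrite mul1r.
apply: (ip_eq0 (f := @d n)) => //; rewrite [LHS]ipBl.
rewrite frobenius_l; last exact: schur_cls.
rewrite schur_adjoint1 // [X in _ - X]ip_suml; apply/eqP; rewrite subr_eq0; apply/eqP.
by apply: eq_bigr => i _; rewrite mul1r.
Qed.

(** The degree is taken in the size given by the number of boxes; for valid b this number is not
    negative, by [bsize_ge0]. *)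
Definition parity b : bool := par (schur b (1%:M : 'M_(absz (bsize b)))).

Lemma parityE b n : bsize b = n%:Z -> parity b = par (schur b (1%:M : 'M_n)).
Proof. by rewrite /parity => ->. Qed.

Lemma eq_bsize b b' : b =1 b' -> bsize b = bsize b'.
Proof. by move=> e; apply: eq_bigr => i _; rewrite /lam e. Qed.

Lemma eq_parity b b' : b =1 b' -> parity b = parity b'.
Proof. by move=> e; rewrite /parity (eq_bsize e) (eq_schur e). Qed.

Lemma par0 : par 0 = false. Proof. exact: (par_nat 0). Qed.

Lemma parity_valid b : parity b -> valid fst b.
Proof.
move=> pb; split=> [i|i j nij cij].
  by rewrite leNgt; apply: contraTN pb => bi; rewrite /parity (schur_neg _ bi) par0.
apply: contraTneq pb => bij.
by rewrite /parity (schur_rep nij cij bij) ?unitmx1 ?par0.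
Qed.

Lemma bsize_perm b i j : bsize (b \o tperm i j) = bsize b.
Proof.
rewrite /bsize /lam !big_split /=; congr (_ + _).
by rewrite [RHS](reindex_inj (@perm_inj _ (tperm i j))).
Qed.

Lemma parity_tperm b i j : i != j -> i.1 = j.1 -> parity (b \o tperm i j) = parity b.
Proof.
move=> nij cij; rewrite /parity bsize_perm schur_tperm ?unitmx1 // parN //.
exact: schur_int.
Qed.

(** The beads of one colour are distinct natural numbers, so their sum is at least 0 + 1 + ... + l,
    which is the sum of their [pos]. *)
Lemma bsize_ge0 b : valid fst b -> 0 <= bsize b.
Proof.
case=> b0 bi; rewrite /bsize sum_bead.
apply: sumr_ge0 => a _; rewrite /lam sumrB subr_ge0.
pose s := [seq absz (b (a, p)) | p <- enum 'I_l.+1].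
have us : uniq s.
  rewrite map_inj_in_uniq ?enum_uniq // => p p' _ _ e; apply/eqP; apply: contraT => npp.
  have /eqP[] : b (a, p) != b (a, p') by apply: bi => //; apply: contra npp => /eqP[->].
  by rewrite -(gez0_abs (b0 (a, p))) -(gez0_abs (b0 (a, p'))) e.
have /uniq_sumn_ge := us; rewrite size_map size_enum_ord sumnE big_map big_enum /= => le.
rewrite [X in _ <= X](eq_bigr (fun p => (absz (b (a, p)))%:Z)) => [|p _]; last by rewrite gez0_abs.
rewrite -!(big_morph Posz PoszD erefl) lez_nat (leq_trans _ le) //.
rewrite (reindex_inj rev_ord_inj) /= leq_sum // => p _.
by rewrite /pos /= subSS subKn // -ltnS.
Qed.

Lemma parity_rec b : odd #|F| -> 0 < bsize b ->
  parity b = \big[addb/false]_i parity (move b i (-1)).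
Proof.
move=> oq; case zb: (bsize b) => [[|n]|//] // _.
have [Z0 fZ0] := frame_exists F (addn1 n).
have [phi zphi ephi] := schur_vchar n b.
rewrite (parityE zb) (par_hc_res fZ0 oq (schur_cls b) ephi zphi).
rewrite par_sum => [|a _]; last first.
  by rewrite hc_res_schur ?unitmx1 //; apply: rpred_sum => i _; apply: schur_int.
rewrite [RHS](partition_big fst xpredT) //=; apply: eq_bigr => a _.
rewrite hc_res_schur ?unitmx1 // par_sum => [|i _]; last exact: schur_int.
apply: eq_bigr => i _; rewrite (@parityE _ n) // bsize_move zb; lia.
Qed.

(** If the last bead is positive, so are all l + 1 parts of colour a. Lowering the whole colour by
    one keeps [srt] but removes l + 1 boxes, more than there are. *)
Lemma srt_last y a : srt y -> bsize y <= l%:Z -> y (a, ord_max) = 0.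
Proof.
move=> sy zy; apply/eqP; apply: contraT => nz; have [y0 yd] := sy.
pose y' i := y i - (i.1 == a)%:Z.
have sy' : srt y'.
  split=> [[a' p]|a' p q lt]; last by rewrite /y' ltrD2r yd.
  rewrite /y' /=; case: eqP => [->|_]; last by rewrite subr0.
  have lmax : 0 < y (a, ord_max) by rewrite lt_def nz y0.
  have [->|np] := eqVneq p ord_max; first by rewrite subr_ge0.
  have ltp : (p < (ord_max : 'I_l.+1))%N.
    by move: np; rewrite -val_eqE /= => np; rewrite ltn_neqAle np -ltnS ltn_ord.
  have := yd a _ _ ltp; lia.
have := srt_bsize_ge0 sy'; rewrite /bsize.
rewrite (eq_bigr (fun i => lam y i - (i.1 == a)%:Z)) => [|i _]; last by rewrite /lam /y' addrAC.
rewrite sumrB -/(bsize y) sum_bead /=.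
rewrite (bigD1 a) //= eqxx sumr_const card_ord big1 => [|a' /negPf ->]; last by rewrite big1.
by lia.
Qed.

Lemma srt_ground : srt (fun i : bead => (pos i)%:Z) /\ bsize (fun i : bead => (pos i)%:Z) = 0.
Proof.
split; last by rewrite /bsize big1 // => i _; rewrite /lam subrr.
by split=> // a p q lt; rewrite /pos ltz_nat /=; have := ltn_ord q; lia.
Qed.

(** By adjunction the pairing is that of f with the function induced from [schur y], which the Pieri
    rule expands; some term must be nonzero. *)
Lemma lift_schur n a (f : fam) y : cls f -> srt y -> bsize y = n%:Z -> (n <= l)%N ->
  ip (@hc_res _ 1 a f n) (schur y (n := n)) != 0 ->
  exists y', [/\ srt y', bsize y' = n.+1%:Z & ip (f n.+1) (schur y' (n := n.+1)) != 0].
Proof.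
move=> cf sy zy len; rewrite frobenius_l //.
have y0 : y (a, ord_max) = 0 by apply: srt_last; rewrite ?zy.
rewrite (eq_ip (f' := @f (n + 1)%N)
   (g' := fun A => \sum_(i | (i.1 == a) && up y i) 1 * schur (move y i 1) A)) //; last first.
  by move=> A uA; rewrite pieri1 //; apply: eq_bigr => i _; rewrite mul1r.
rewrite ip_sumr => nz.
have [i /andP[_ ui] nzi] : exists2 i, (i.1 == a) && up y i &
    ip (f (n + 1)%N) (schur (move y i 1) (n := n + 1)) != 0.
  apply/exists_inP; apply: contraNT nz; rewrite negb_exists_in => /forall_inP z.
  by rewrite big1 // => i /z; rewrite negbK => /eqP ->; rewrite mulr0.
exists (move y i 1); split; [exact: srt_up | by rewrite bsize_move zy; lia |].
by rewrite -(ip_cast f (schur (move y i 1)) (addn1 n)).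
Qed.

Lemma odd_schur k (f : fam) (phi : 'CF('GL_(k.+1)[F])) : odd #|F| -> (k <= l)%N ->
  cls f -> phi \is a character -> (forall x, phi x = f k.+1 (GLval x)) -> par (phi 1%g) ->
  exists y, [/\ srt y, bsize y = k.+1%:Z & ip (f k.+1) (schur y (n := k.+1)) != 0].
Proof.
move=> oq; elim: k f phi => [|k IH] f phi lekl cf cphi ephi ophi.
  have [Z0 fZ0] := frame_exists F (addn1 0).
  move: ophi; rewrite ephi GL_1E (par_hc_res fZ0 oq cf ephi (char_vchar cphi)) => oS.
  have [a nz] : exists a, hc_res 1 a f (1%:M : 'M_0) != 0.
    apply/existsP; apply: contraTT oS; rewrite negb_exists => /forallP z.
    by rewrite big1 ?par0 // => a _; apply/eqP; rewrite -[_ == _]negbK z.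
  have [sy zy] := srt_ground; apply: (lift_schur (a := a) cf sy zy lekl).
  have one_unit (g h : 'M[F]_0 -> algC) : ip g h = (gl F 0)%:R^-1 * (g 1%:M * (h 1%:M)^*).
    rewrite /ip (big_pred1 1%:M) // => A; rewrite /= (flatmx0 A) -(flatmx0 1%:M) unitmx1.
    exact/esym/eqP.
  (* In size 0 the determinant of the ground configuration is a constant, nonzero because its norm
     is 1. *)
  have := schur_norm sy zy; rewrite !one_unit mulf_eq0 negb_or => n1.
  rewrite invr_eq0 gl_neq0 mulf_neq0 //; apply: contra_eq_neq n1 => ->.
  by rewrite mulr0 mulr0 eq_sym oner_neq0.
have [Z0 fZ0] := frame_exists F (addn1 k.+1).
move: ophi; rewrite ephi GL_1E (par_hc_res fZ0 oq cf ephi (char_vchar cphi)).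
have cH a : exists2 psi : 'CF('GL_(k.+1)[F]), psi \is a character &
    forall x, psi x = hc_res 1 a f (GLval x) by apply: hc_res_char cf cphi ephi.
have iH a : hc_res 1 a f (1%:M : 'M_k.+1) \is a Num.int.
  by have [psi cpsi epsi] := cH a; 
  rewrite -[1%:M]/(GLval (1%g : {'GL_(k.+1)[F]})) -epsi Cint_vchar1 ?char_vchar.
rewrite par_sum // => oS.
have [a oa] : exists a, par (hc_res 1 a f (1%:M : 'M_k.+1)).
  apply/existsP; apply: contraTT oS; rewrite negb_exists => /forallP z.
  by rewrite big1 // => a _; apply/negbTE.
have [psi cpsi epsi] := cH a.
have opsi : par (psi 1%g) by rewrite epsi GL_1E.
have [y [sy zy nz]] := IH _ _ (ltnW lekl) (hc_res_cls 1 a cf) cpsi epsi opsi.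
exact: lift_schur cf sy zy lekl nz.
Qed.

Lemma odd_irr_schur k (i : Iirr 'GL_(k.+1)[F]) : odd #|F| -> (k <= l)%N -> par ('chi_i 1%g) ->
  exists y (eps : bool), [/\ srt y, bsize y = k.+1%:Z &
    forall x, schur y (GLval x) = (-1) ^+ eps * 'chi_i x].
Proof.
move=> oq lekl oi; have eE x : 'chi_i x = ext 'chi_i (GLval x) by rewrite ext_val.
have [y [sy zy nz]] := odd_schur oq lekl (ext_cls 'chi_i) (irr_char i) eE oi.
have [j [eps ej]] := schur_irr sy zy; exists y, eps; split=> // x; rewrite ej.
congr (_ * 'chi_ _ x).
have ej' z : ((-1) ^+ eps *: 'chi_j) z = schur y (GLval z) by rewrite ej cfunE.
move: nz; rewrite -(cfdot_ip eE ej') cfdotZr cfdot_irr.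
by case: (eqVneq i j) => [->|_]; rewrite ?mulr0 ?eqxx.
Qed.

Lemma parity_irr y k (i : Iirr 'GL_(k.+1)[F]) (eps : bool) : bsize y = k.+1%:Z ->
  (forall x, schur y (GLval x) = (-1) ^+ eps * 'chi_i x) -> parity y = par ('chi_i 1%g).
Proof.
move=> zy e; rewrite (parityE zy) -[1%:M]/(GLval (1%g : {'GL_(k.+1)[F]})) e.
by case: eps {e}; rewrite ?mul1r // mulN1r parN // Cint_vchar1 ?irr_vchar.
Qed.

End Families.

(** * Characters of the parabolic subgroup *)

Section Inflation.

Variables (F : finFieldType) (k : nat) (Z0 : 'M[F]_(k.+1 + 1, k.+2)).
Hypothesis fZ0 : frame Z0.
Local Notation colour := (colour F).
Local Notation fam := (forall n, 'M[F]_n -> algC).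
Local Notation G := ('GL_(k.+2)[F])%G.
Local Notation M := ('GL_(k.+1)[F])%G.
Local Notation gT := {'GL_(k.+2)[F]}.
Local Notation P := (para_group fZ0).
Implicit Types (i : Iirr G) (j : Iirr P) (e : Iirr M) (a : colour).

Lemma sum_paragroup (f : gT -> algC) :
  \sum_(x in P) f x = \sum_(A : 'M_k.+1 | A \in unitmx) \sum_(B : 'M_1 | B \in unitmx)
    \sum_(X : 'M_(1, k.+1)) f (parael Z0 A X B).
Proof.
rewrite -(sum_para (fun Y => f (glmx (conj_mx (frinv Z0) Y)))).
rewrite [RHS](reindex_onto (fun x : gT => conj_mx Z0 (GLval x))
   (fun Y => glmx (conj_mx (frinv Z0) Y))) /=.
  by apply: eq_big => [x|x _]; rewrite (conj_mxK fZ0) glmxK ?eqxx ?andbT ?inE.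
move=> Y /para_frame; rewrite frame_square => uY.
by rewrite val_glmx ?conj_mxKV // conj_mx_unit // frame_frinv.
Qed.

Lemma card_P : #|P| = (gl F k.+1 * #|F|.-1 * #|F| ^ (1 * k.+1))%N.
Proof. by rewrite card_para_group /Psize gl1. Qed.

Definition infl_fun e a (x : gT) : algC :=
  pfun a (fun A => 'chi_e (glmx A)) (conj_mx Z0 (GLval x)).

Lemma infl_fun_parael e a A X B : A \in unitmx -> B \in unitmx ->
  infl_fun e a (parael Z0 A X B) = 'chi_e (glmx A) * ch a (\det B).
Proof. by move=> uA uB; rewrite /infl_fun parael_val // pfun_lblock. Qed.

Lemma infl_fun_dot e a e' a' :
  #|P|%:R^-1 * (\sum_(x in P) infl_fun e a x * (infl_fun e' a' x)^*) =
  ((e == e') && (a == a'))%:R.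
Proof.
pose s (A : 'M_k.+1) : algC := 'chi_e (glmx A) * ('chi_e' (glmx A))^*.
pose t (x : F) := ch a x * (ch a' x)^*.
have -> : \sum_(x in P) infl_fun e a x * (infl_fun e' a' x)^* =
    (\sum_(A : 'M_k.+1 | A \in unitmx) s A) * (\sum_(x | x != 0) t x) * (#|F| ^ (1 * k.+1))%:R.
  rewrite sum_paragroup mulr_suml mulr_suml; apply: eq_bigr => A uA.
  rewrite mulr_sumr mulr_suml sum_unitmx1; apply: eq_bigr => x x0.
  have ux : (x%:M : 'M_1) \in unitmx by rewrite unitmxE det_scalar1 unitfE.
  under eq_bigr => X _ do rewrite !infl_fun_parael // det_scalar1.
  by rewrite sumr_const card_mx mulr_natr /s /t rmorphM /=; congr (_ *+ _); ring.
have eS : \sum_(A : 'M_k.+1 | A \in unitmx) s A = (gl F k.+1)%:R * (e == e')%:R.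
  rewrite -cfdot_irr cfdotE card_GLE mulrA mulfV ?gl_neq0 // mul1r -sum_GL.
  by apply: eq_bigr => x _; rewrite /s glmxK.
rewrite eS sum_ch card_P !natrM -gl1.
have := gl_neq0 F k.+1; have := gl_neq0 F 1.
have q0 : (#|F| ^ (1 * k.+1))%:R != 0 :> algC by rewrite pnatr_eq0 expn_eq0 negb_and -lt0n q_gt0.
move: (gl F 1)%:R (gl F k.+1)%:R (_ ^ _)%:R q0 => x y z z0 x0 y0.
case: (e == e'); case: (a == a'); rewrite ?mulr0n ?mulr1n ?mulr0 ?mul0r ?mulr0 //.
by field; rewrite x0 y0 z0.
Qed.

Lemma infl_exists e a : exists j : Iirr P, [forall x in P, 'chi_j x == infl_fun e a x].
Proof.
have [psi cpsi epsi] := pfun_char fZ0 a (afforded_char (irr_char e)).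
have /irrP[j ej] : psi \in irr P.
  rewrite irrEchar cpsi cfdotE.
  rewrite (eq_bigr (fun x => infl_fun e a x * (infl_fun e a x)^*)) => [|x Px]; last by rewrite epsi.
  by rewrite infl_fun_dot !eqxx.
by exists j; apply/forall_inP => x Px; rewrite -ej epsi.
Qed.

Definition infl e a : Iirr P := xchoose (infl_exists e a).

Lemma inflE e a x : x \in P -> 'chi_(infl e a) x = infl_fun e a x.
Proof. by have /forall_inP/(_ x) h := xchooseP (infl_exists e a) => /h/eqP. Qed.

Lemma infl1 e a : 'chi_(infl e a) 1%g = 'chi_e 1%g.
Proof.
rewrite inflE ?group1 // -(parael1 fZ0) infl_fun_parael ?unitmx1 // det1 ch1 mulr1.
by rewrite -[1%:M]/(GLval (1%g : {'GL_(k.+1)[F]})) glmxK.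
Qed.

Lemma cfdot_Res_infl i e a (f : fam) : cls f -> (forall x, 'chi_i x = f k.+2 (GLval x)) ->
  '['Res[P] 'chi_i, 'chi_(infl e a)] = ip (@hc_res _ 1 a f k.+1) (@ext F k 'chi_e k.+1).
Proof.
move=> cf ef; rewrite (@frobenius_char F k.+1 a _ _ cf) cfdot_Res_l.
apply: cfdot_ip => // x.
rewrite (hc_indE _ _ _ (addn1 k.+1)); apply: hc_ind_at_Ind => y Py; rewrite inflE //.
by rewrite /infl_fun /pfun extE.
Qed.

(* The sum of chi(1) times the inflation of chi (x) a is the regular character of P / U. *)
Lemma sum_infl j :
  \sum_e \sum_a 'chi_e 1%g * '['chi_j, 'chi_(infl e a)] = '['Res[unip_group fZ0] 'chi_j, 1].
Proof.
pose g x := \sum_e \sum_a 'chi_e 1%g * (infl_fun e a x)^*.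
have gE A B X : A \in unitmx -> B \in unitmx ->
    g (parael Z0 A X B) = (gl F k.+1 * #|F|.-1)%:R *+ ((A == 1%:M) && (B == 1%:M)).
  move=> uA uB; rewrite /g; transitivity
      ((\sum_(e : Iirr M) 'chi_e 1%g * ('chi_e (glmx A))^*) * (\sum_(a : colour) ch a (\det B))^*).
    rewrite mulr_suml; apply: eq_bigr => e _; rewrite rmorph_sum mulr_sumr.
    by apply: eq_bigr => a _; rewrite infl_fun_parael // rmorphM mulrA.
  rewrite sum_ch_colour -?unitfE -?unitmxE //.
  have Mx : glmx A \in M by rewrite inE.
  have -> := second_orthogonality_relation 1%g Mx.
  rewrite (setIidPl _) ?card_GLE ?(class_sym M 1%g); last by rewrite cent11T subsetT.
  rewrite class1G inE -[(glmx A == _)](inj_eq val_inj) -[val (glmx A)]/(GLval _) val_glmx //.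
  have -> : (B == 1%:M) = (\det B == 1).
    apply/eqP/eqP => [->|dB]; first exact: det1.
    by rewrite [B]mx11_scalar -dB det_mx11.
  by rewrite rmorphMn /= rmorph_nat; do 2 case: eqP => _; rewrite ?mulr0n ?mul0r ?mulr0 // -natrM.
have -> : \sum_e \sum_a 'chi_e 1%g * '['chi_j, 'chi_(infl e a)] =
    #|P|%:R^-1 * \sum_(x in P) 'chi_j x * g x.
  under [in RHS]eq_bigr => x _ do rewrite /g mulr_sumr.
  rewrite [in RHS]exchange_big /= [RHS]mulr_sumr; apply: eq_bigr => e _ /=.
  under [in RHS]eq_bigr => x _ do rewrite mulr_sumr.
  rewrite [in RHS]exchange_big /= [RHS]mulr_sumr; apply: eq_bigr => a _ /=.
  rewrite cfdotE mulrCA mulr_sumr; congr (_ * _).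
  by apply: eq_bigr => x Px; rewrite inflE // mulrCA.
rewrite cfdot_unip1 // sum_paragroup (bigD1 1%:M) ?unitmx1 //= [X in _ + X]big1 ?addr0; last first.
  move=> A /andP[uA nA]; rewrite big1 // => B uB; rewrite big1 // => X _.
  by rewrite gE // (negPf nA) mulr0.
rewrite (bigD1 1%:M) ?unitmx1 //= [X in _ + X]big1 ?addr0; last first.
  by move=> B /andP[uB nB]; rewrite big1 // => X _; rewrite gE ?unitmx1 // (negPf nB) andbF mulr0.
under eq_bigr => X _ do rewrite gE ?unitmx1 // !eqxx.
rewrite -mulr_suml mulrCA mulrC card_P natrM invfM.
congr (_ * _); rewrite /= mulr1n mulrAC mulVf ?mul1r //.
by rewrite -gl1 natrM mulf_neq0 ?gl_neq0.
Qed.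

Lemma odd_infl j : odd #|F| -> par ('chi_j 1%g) -> exists e a, j = infl e a.
Proof.
move=> oq; rewrite (par_unip oq (subxx P)) ?irr_vchar // -sum_infl => oj.
have [[e a] /= nz] : exists u : Iirr M * colour, '['chi_j, 'chi_(infl u.1 u.2)] != 0.
  apply/existsP; apply: contraTT oj; rewrite negb_exists => /forallP z.
  rewrite big1 ?par0 // => e _; rewrite big1 // => a _.
  by have := z (e, a); rewrite negbK => /eqP /= ->; rewrite mulr0.
by exists e, a; move: nz; rewrite cfdot_irr; case: (eqVneq j) => // _; rewrite eqxx.
Qed.

End Inflation.

Section Multiplicities.

Variables (p : nat) (gT : finGroupType) (G H : {group gT}).
Implicit Types (i : Iirr G) (j : Iirr H).
Hypothesis sHG : H \subset G.

Local Notation mult i j := '['Res[H] 'chi[G]_i, 'chi[H]_j].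

(** Delta is the rest of the restriction after one copy of j, so the decomposition becomes a
    condition on the multiplicities of the characters of p'-degree. *)
Lemma is_starP i j : is_star p i j <->
  j \in Irr_p' p H /\ forall j', j' \in Irr_p' p H -> mult i j' = (j' == j)%:R.
Proof.
split=> [[pj [D [eD zD]]]|[pj mj]]; split=> //.
  move=> j' pj'; rewrite eD cfdotDl cfdot_irr eq_sym.
  case: zD => [->|[cD nD]]; first by rewrite cfdot0l addr0.
  rewrite [X in _ + X](_ : _ = 0) ?addr0 //; apply/eqP; apply: contraLR pj' => nz.
  by rewrite inE negbK nD // irr_consttE.
have cR : 'Res[H] 'chi_i \is a character by rewrite cfRes_char ?irr_char.
have jR : j \in irr_constt ('Res[H] 'chi_i) by rewrite irr_consttE mj // eqxx oner_neq0.
have [D cD eD] := constt_charP j cR jR; exists D; split=> //; right; split=> // j' Dj'.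
apply: contraLR Dj' => pj'; have := mj j'; rewrite inE => /(_ pj').
rewrite eD cfdotDl cfdot_irr eq_sym -[RHS]addr0 => /addrI e.
by rewrite irr_consttE e eqxx.
Qed.

Lemma restriction_goodI :
  (forall i, i \in Irr_p' p G -> exists j, is_star p i j) -> restriction_good p G H.
Proof.
move=> ex; split=> // i /ex[j sj]; exists j; split=> // j' /is_starP[pj' mj'].
have [pj /(_ _ pj')] := (iffLR (is_starP _ _) sj); rewrite mj' // eqxx.
by case: eqP => // _ /eqP; rewrite oner_eq0.
Qed.

(** A nonzero multiplicity suffices for surjectivity: a constituent j of p'-degree of the
    restriction of i can only be the star of i. *)
Lemma restriction_canonicalI : restriction_good p G H ->
  (forall i i' j, i \in Irr_p' p G -> i' \in Irr_p' p G ->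
     is_star p i j -> is_star p i' j -> i = i') ->
  (forall j, j \in Irr_p' p H -> exists2 i, i \in Irr_p' p G & mult i j != 0) ->
  restriction_canonical p G H.
Proof.
move=> good inj sur; split=> //.
pose starb i j := (j \in Irr_p' p H) && [forall j' in Irr_p' p H, mult i j' == (j' == j)%:R].
have starbP i j : reflect (is_star p i j) (starb i j).
  apply: (iffP andP) => [[pj /forall_inP mj]|/is_starP[pj mj]].
    by apply/is_starP; split=> // j' /mj/eqP.
  by split=> //; apply/forall_inP => j' /mj ->.
pose star i := odflt 0 [pick j | starb i j].
have starP i : i \in Irr_p' p G -> is_star p i (star i).
  move=> /(proj2 good)[j [sj _]]; rewrite /star; case: pickP => [j' /starbP //|].
  by move/(_ j)/starbP.
exists star; split=> [//|i i' pi pi' e|].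
  by apply: (inj i i' (star i)) => //; [apply: starP | rewrite e; apply: starP].
apply/setP => j; apply/imsetP/idP => [[i pi ->]|pj].
  by have [] := iffLR (is_starP _ _) (starP _ pi).
have [i pi nz] := sur _ pj; exists i => //.
have [_ /(_ _ pj) e] := iffLR (is_starP _ _) (starP _ pi).
by apply/eqP; move: nz; rewrite e; case: (j == _); rewrite ?eqxx.
Qed.

End Multiplicities.

Section Standard.

Variables (F : finFieldType) (k : nat) (Z0 : 'M[F]_(k.+1 + 1, k.+2)).
Hypotheses (fZ0 : frame Z0) (oq : odd #|F|).
Local Notation colour := (colour F).
Local Notation fam := (forall n, 'M[F]_n -> algC).
Local Notation G := ('GL_(k.+2)[F])%G.
Local Notation M := ('GL_(k.+1)[F])%G.
Local Notation P := (para_group fZ0).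
Local Notation bead := (bead F k.+2).
Implicit Types (i : Iirr G) (j : Iirr P) (e : Iirr M) (a : colour) (x y : bead -> int) (s t : bead).

(** The sign is the one left open by [schur_irr]. The number of rows does not depend on n, so that
    configurations for G and for M can be compared. *)
Definition schur_of n x (i : Iirr 'GL_(n.+1)[F]) := [/\ srt x, bsize x = n.+1%:Z &
  exists eps : bool, forall g, schur x (GLval g) = (-1) ^+ eps * 'chi_i g].

Lemma schur_of_odd n (i : Iirr 'GL_(n.+1)[F]) : (n <= k.+2)%N -> par ('chi_i 1%g) ->
  exists x, schur_of x i.
Proof.
by move=> len oi; have [x [eps [sx zx ex]]] := odd_irr_schur oq len oi; exists x; split=> //; exists eps.
Qed.

Lemma schur_of_parity n x (i : Iirr 'GL_(n.+1)[F]) : schur_of x i -> parity x = par ('chi_i 1%g).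
Proof. by case=> _ zx [eps ex]; apply: parity_irr zx ex. Qed.

Lemma eq_schur_of n x (i i' : Iirr 'GL_(n.+1)[F]) : schur_of x i -> schur_of x i' -> i = i'.
Proof.
move=> [_ _ [eps ex]] [_ _ [eps' ex']]; apply/eqP.
have e : (-1) ^+ eps *: 'chi_i = (-1) ^+ eps' *: 'chi_i'.
  by apply/cfunP => g; rewrite !cfunE -ex.
have : '[(-1) ^+ eps *: 'chi_i, 'chi_i'] != 0.
  by rewrite e cfdotZl cfnorm_irr mulr1 signr_eq0.
by rewrite cfdotZl cfdot_irr; case: (i == i') => //; rewrite mulr0 eqxx.
Qed.

Lemma eq_schur_of_l n x x' (i : Iirr 'GL_(n.+1)[F]) : x =1 x' -> schur_of x i -> schur_of x' i.
Proof.
move=> e [[x0 xd] zx [eps ex]]; split.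
- by split=> [s|a p q lt]; rewrite -!e; [apply: x0 | apply: xd].
- by rewrite -(eq_bsize e).
by exists eps => g; rewrite -(eq_schur e).
Qed.

Lemma mult_schur i e a x y : schur_of x i -> schur_of y e ->
  exists eps : bool, '['Res[P] 'chi_i, 'chi_(infl fZ0 e a)] =
    (-1) ^+ eps * \sum_(s : bead | s.1 == a) ip (schur (move x s (-1)) (n := k.+1)) (schur y (n := k.+1)).
Proof.
move=> [_ _ [eps ex]] [_ _ [eps' ey]]; exists (eps (+) eps').
pose f : fam := fun n A => (-1) ^+ eps * schur x A.
have cf : cls f by move=> p n Z A fZ uA; rewrite /f schur_cls.
rewrite (cfdot_Res_infl fZ0 _ _ cf) => [|g]; last by rewrite /f ex mulrA -signr_addb addbb mul1r.
rewrite (eq_ip (f' := fun A => \sum_(s : bead | s.1 == a) (-1) ^+ eps * schur (move x s (-1)) A)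
   (g' := fun A => \sum_(t <- [:: tt]) (-1) ^+ eps' * schur y A)).
- rewrite ip_sumr big_seq1 rmorph_sign ip_suml -mulr_sumr mulrA -signr_addb.
  by rewrite addbC.
- move=> A uA; rewrite -mulr_sumr -hc_res_schur // /hc_res mulrCA; congr (_ * _).
  rewrite mulr_sumr; apply: eq_bigr => B _; rewrite mulr_sumr; apply: eq_bigr => X _.
  by rewrite /f mulrCA.
by move=> A uA; rewrite big_seq1 extE -{2}(val_glmx uA) ey mulrA -signr_addb addbb mul1r.
Qed.

Lemma ip_move_neq0 x y s : srt x -> srt y ->
  ip (schur (move x s (-1)) (n := k.+1)) (schur y (n := k.+1)) != 0 ->
  down x s /\ move x s (-1) =1 y.
Proof.
move=> sx sy nz; have ds : down x s.
  by apply: contraNT nz => nd; rewrite ip0l // => A uA; apply: schur_ndown.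
by split=> //; apply: schur_orth nz => //; apply: srt_down.
Qed.

Lemma mult_neq0 i e a x y : schur_of x i -> schur_of y e ->
  '['Res[P] 'chi_i, 'chi_(infl fZ0 e a)] != 0 ->
  exists2 s : bead, s.1 = a & move x s (-1) =1 y.
Proof.
move=> hx hy; have [eps ->] := mult_schur a hx hy; rewrite mulf_eq0 signr_eq0 /= => nz.
have [s /eqP sa nzs] : exists2 s : bead, s.1 == a &
    ip (schur (move x s (-1)) (n := k.+1)) (schur y (n := k.+1)) != 0.
  apply/exists_inP; apply: contraNT nz; rewrite negb_exists_in => /forall_inP z.
  by rewrite big1 // => s /z; rewrite negbK => /eqP.
exists s => //; have [[sx _ _] [sy _ _]] := (hx, hy).
by have [] := ip_move_neq0 sx sy nzs.
Qed.

(** Orthogonality leaves a single term, equal to a sign, and a multiplicity is not negative. *)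
Lemma mult_child i e x s : schur_of x i -> schur_of (move x s (-1)) e ->
  '['Res[P] 'chi_i, 'chi_(infl fZ0 e s.1)] = 1.
Proof.
move=> hx hy; have [eps em] := mult_schur s.1 hx hy.
have := Cnat_cfdot_char (cfRes_char P (irr_char i)) (irr_char (infl fZ0 e s.1)).
rewrite em (bigD1 s) //= schur_norm ?[X in _ + X]big1; try by case: hy.
  by rewrite addr0 mulr1; case: (eps) => //; rewrite expr1 => /natr_ge0; rewrite lerNr oppr0 ler10.
move=> t /andP[_ ne]; apply/eqP; apply: contraT => nz.
have [[sx _ _] [sy _ _]] := (hx, hy).
by have [_ /(move_inj (isT : (-1 : int) != 0))/eqP] := ip_move_neq0 sx sy nz; rewrite (negPf ne).
Qed.

Lemma size_child x s n : srt x -> bsize x = n.+2%:Z -> bsize (move x s (-1)) = n.+1%:Z.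
Proof. by move=> _ zx; rewrite bsize_move zx; lia. Qed.

Lemma odd_mem_G i : (i \in Irr_p' 2 G) = par ('chi_i 1%g). Proof. by rewrite inE. Qed.
Lemma odd_mem_P j : (j \in Irr_p' 2 P) = par ('chi_j 1%g). Proof. by rewrite inE. Qed.

Lemma sub_P : P \subset G. Proof. exact: subsetT. Qed.

(** The inflation attached to the odd child is a constituent of multiplicity 1. Any other
    constituent of odd degree is also an inflation and comes from an odd child, so [odd_child]
    identifies the two. *)
Lemma odd_star i : i \in Irr_p' 2 G -> exists j, is_star 2 i j.
Proof.
rewrite odd_mem_G => oi; have [x hx] := schur_of_odd (leqnSn _) oi.
have px := oi; rewrite -(schur_of_parity hx) in px.
have [sx zx _] := hx; have zx0 : 0 < bsize x by rewrite zx.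
have [s [ps us]] := odd_child (c := fst) (d := @parity F k.+2) (@eq_parity F k.+2)
  (@parity_valid F k.+2) (@bsize_move F k.+2)
  (@bsize_ge0 F k.+2) (fun b => @parity_rec F k.+2 b oq) px zx0.
rewrite -/(move x s (-1)) in ps.
have zy := size_child s sx zx.
have sy : srt (move x s (-1)).
  apply: srt_down => //; apply: contraTT ps => nd.
  by rewrite (parityE zy) schur_ndown ?unitmx1 ?par0.
have [e [eps ee]] := schur_irr sy zy.
have hy : schur_of (move x s (-1)) e by split=> //; exists eps.
have oe : par ('chi_e 1%g) by rewrite -(schur_of_parity hy).
exists (infl fZ0 e s.1); apply/is_starP.
split=> [|j]; rewrite odd_mem_P ?infl1 // => oj.
case: (eqVneq j (infl fZ0 e s.1)) => [->|nj]; first by rewrite (mult_child hx hy).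
apply/eqP; apply: contraNT nj => nz; have [e' [a ej]] := odd_infl oq oj; subst j.
rewrite infl1 in oj; have [y hy'] := schur_of_odd (leq_trans (leqnSn _) (leqnSn _)) oj.
have [t ta ty] := mult_neq0 hx hy' nz.
have ts : t = s.
  by apply: us; rewrite -/(move x t (-1)) (eq_parity ty) (schur_of_parity hy').
rewrite -ta ts (eq_schur_of hy (eq_schur_of_l _ hy')) ?eqxx // => u.
by rewrite -ty ts.
Qed.

Lemma standard_good : restriction_good 2 G P.
Proof. exact: (restriction_goodI sub_P odd_star). Qed.

Lemma star_parent i e a x y : schur_of x i -> schur_of y e -> is_star 2 i (infl fZ0 e a) ->
  exists2 s : bead, s.1 = a & x =1 move y s 1.
Proof.
move=> hx hy /is_starP[oj mj].
have [|s sa xy] := mult_neq0 (a := a) hx hy; first by rewrite mj // eqxx oner_neq0.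
exists s => // t; rewrite /move -xy /move.
by case: eqP => // _; rewrite subrK.
Qed.

(** The colour a of the inflated character j records the colour of the box removed, so two preimages
    of j are odd parents of y of the same colour. *)
Lemma star_inj i i' j : odd k.+2 -> i \in Irr_p' 2 G -> i' \in Irr_p' 2 G ->
  is_star 2 i j -> is_star 2 i' j -> i = i'.
Proof.
rewrite !odd_mem_G => on oi oi' sj sj'.
have [x hx] := schur_of_odd (leqnSn _) oi; have [x' hx'] := schur_of_odd (leqnSn _) oi'.
have oj : par ('chi_j 1%g) by case: sj => [+ _]; rewrite odd_mem_P.
have [e [a ej]] := odd_infl oq oj; subst j; rewrite infl1 in oj.
have [y hy] := schur_of_odd (leq_trans (leqnSn _) (leqnSn _)) oj.
have [s sa xs] := star_parent hx hy sj; have [t ta xt] := star_parent hx' hy sj'.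
have py := oj; rewrite -(schur_of_parity hy) in py.
have zy : bsize y = k.+1%:Z by case: hy.
have st : s = t.
  apply: (odd_parent_unique (c := fst) (d := @parity F k.+2) (@eq_parity F k.+2)
    (@parity_valid F k.+2) (@parity_tperm F k.+2) (@bsize_move F k.+2)
    (@bsize_ge0 F k.+2) (fun b => @parity_rec F k.+2 b oq) py).
  - by rewrite zy -PoszD addn1.
  - by rewrite -/(move y s 1) -(eq_parity xs) (schur_of_parity hx).
  - by rewrite -/(move y t 1) -(eq_parity xt) (schur_of_parity hx').
  - by rewrite sa ta.
apply: (eq_schur_of (x := x)) => //; apply: eq_schur_of_l hx' => u.
by rewrite xt xs st.
Qed.

Lemma gl_rec n : gl F n.+2 = (gl F n.+1 * #|F| ^ n.+1 * (#|F| ^ n.+2 - 1))%N.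
Proof.
rewrite -!card_GLE !card_GL // big_nat_recr //= binS bin1 expnD.
by rewrite !mulnA; congr (_ * _)%N; rewrite mulnAC.
Qed.

Lemma indexP : #|G : P|%g = (\sum_(i < k.+2) #|F| ^ i)%N.
Proof.
have := Lagrange sub_P; rewrite card_GLE gl_rec card_P mul1n subn1 predn_exp => e.
have q1 : (0 < #|F|.-1)%N by rewrite -gl1 gl_gt0.
have c_gt0 : (0 < gl F k.+1 * #|F|.-1 * #|F| ^ k.+1)%N.
  by rewrite !muln_gt0 gl_gt0 q1 expn_gt0 q_gt0.
apply/eqP; rewrite -(eqn_pmul2l c_gt0) e; apply/eqP.
by rewrite mulnA; congr (_ * _)%N; rewrite mulnAC.
Qed.

Lemma odd_indexP : odd #|G : P|%g = odd k.+2.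
Proof.
rewrite indexP; elim: (k.+2) => [|n IH]; first by rewrite big_ord0.
by rewrite big_ord_recr /= oddD IH oddX oq orbT addbT.
Qed.

(** The index of P is a sum of k + 2 odd powers of q, hence odd, so the character induced from j has
    odd degree and therefore a constituent of odd degree; Frobenius reciprocity gives the
    multiplicity. *)
Lemma star_onto j : odd k.+2 -> j \in Irr_p' 2 P ->
  exists2 i, i \in Irr_p' 2 G & '['Res[P] 'chi_i, 'chi_j] != 0.
Proof.
rewrite odd_mem_P => on oj; pose phi := 'Ind[G] 'chi_j.
have cphi : phi \is a character by rewrite cfInd_char ?irr_char.
have : par (phi 1%g).
  rewrite cfInd1 ?sub_P // parM ?rpred_nat ?Cint_vchar1 ?irr_vchar //.
  by rewrite par_nat odd_indexP on oj.
have mi i : '[phi, 'chi_i] * 'chi_i 1%g \is a Num.int.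
  by rewrite rpredM ?Cint_cfdot_vchar_irr ?Cint_vchar1 ?irr_vchar ?char_vchar.
have -> : phi 1%g = \sum_i '[phi, 'chi_i] * 'chi_i 1%g.
  by rewrite {1}[phi]cfun_sum_cfdot sum_cfunE; apply: eq_bigr => i _; rewrite cfunE.
rewrite par_sum // => oS.
have [i] : exists i, par ('[phi, 'chi_i] * 'chi_i 1%g).
  apply/existsP; apply: contraTT oS; rewrite negb_exists => /forallP z.
  by rewrite big1 // => i _; apply/negbTE.
rewrite parM ?Cint_cfdot_vchar_irr ?Cint_vchar1 ?irr_vchar ?char_vchar // => /andP[nz oi].
exists i; rewrite ?odd_mem_G // cfdot_Res_l cfdotC conjC_eq0 -/phi.
by apply: contraTneq nz => ->; rewrite par0.
Qed.

Lemma standard_canonical : odd k.+2 -> restriction_canonical 2 G P.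
Proof.
move=> on; apply: restriction_canonicalI standard_good _ _ => [i i' j|j].
  exact: star_inj.
exact: star_onto.
Qed.

End Standard.

(** * General parabolic subgroups *)

Section Transport.

Variables (p : nat) (aT rT : finGroupType) (G H : {group aT}) (R S : {group rT}).
Variables (f : {morphism G >-> rT}) (g : {morphism H >-> rT}).
Hypotheses (isoG : isom G R f) (isoH : isom H S g) (eq_hg : {in H, g =1 f}).
Hypothesis sHG : H \subset G.

Lemma isom_Irr_p' (aT' rT' : finGroupType) (X : {group aT'}) (Y : {group rT'})
    (h : {morphism X >-> rT'}) (isoX : isom X Y h) i :
  (isom_Iirr isoX i \in Irr_p' p Y) = (i \in Irr_p' p X).
Proof. by rewrite !inE isom_IirrE cfIsom1. Qed.

Lemma is_star_isom i j :
  is_star p i j <-> is_star p (isom_Iirr isoG i) (isom_Iirr isoH j).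
Proof.
have mE j' : '['Res[S] 'chi_(isom_Iirr isoG i), 'chi_(isom_Iirr isoH j')] =
             '['Res[H] 'chi_i, 'chi_j'].
  by rewrite !isom_IirrE (cfResIsom isoG isoH eq_hg sHG) cfIsom_iso.
split=> /is_starP[pj mj]; apply/is_starP.
  split=> [|j']; first by rewrite isom_Irr_p'.
  rewrite -(isom_IirrKV isoH j') isom_Irr_p' => pj'.
  by rewrite mE mj // (inj_eq (@isom_Iirr_inj _ _ _ _ _ isoH)).
rewrite isom_Irr_p' in pj; split=> // j' pj'.
by rewrite -mE mj ?isom_Irr_p' // (inj_eq (@isom_Iirr_inj _ _ _ _ _ isoH)).
Qed.

Lemma restriction_good_isom : restriction_good p R S -> restriction_good p G H.
Proof.
case=> sSR good; apply: restriction_goodI => // i pi.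
have [|j [sj _]] := good (isom_Iirr isoG i); first by rewrite isom_Irr_p'.
exists (isom_Iirr (isom_sym isoH) j); apply/is_star_isom.
by rewrite isom_IirrKV.
Qed.

Lemma restriction_canonical_isom : restriction_canonical p R S -> restriction_canonical p G H.
Proof.
case=> good [star [starP star_inj star_im]].
have [_ uniq] := good.
apply: (restriction_canonicalI (restriction_good_isom good)) => [i i' j pi pi' sij si'j|j pj].
  apply: (@isom_Iirr_inj _ _ _ _ _ isoG); apply: star_inj; rewrite ?isom_Irr_p' //.
  have starE u : u \in Irr_p' p G -> is_star p u j -> star (isom_Iirr isoG u) = isom_Iirr isoH j.
    move=> pu /is_star_isom sj; have pu' : isom_Iirr isoG u \in Irr_p' p R by rewrite isom_Irr_p'.
    have [t [_ ut]] := uniq _ pu'; by rewrite -(ut _ sj) (ut _ (starP _ pu')).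
  by rewrite !starE.
have : isom_Iirr isoH j \in star @: Irr_p' p R by rewrite star_im isom_Irr_p'.
case/imsetP=> i pi ej; exists (isom_Iirr (isom_sym isoG) i).
  by rewrite -(isom_Irr_p' isoG) isom_IirrKV.
have /is_starP[_ /(_ _ pj)->] : is_star p (isom_Iirr (isom_sym isoG) i) j.
  by apply/is_star_isom; rewrite isom_IirrKV ej; apply: starP.
by rewrite eqxx oner_neq0.
Qed.

End Transport.

Section Stabilisers.

Variable F : finFieldType.

Lemma col_stab m r n (Zu : 'M[F]_(m, n)) (Zl : 'M_(r, n)) A : frame (col_mx Zu Zl) ->
  ((ursubmx (conj_mx (col_mx Zu Zl) A) == 0) = (Zu *m A <= Zu)%MS) *
  ((dlsubmx (conj_mx (col_mx Zu Zl) A) == 0) = (Zl *m A <= Zl)%MS).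
Proof.
move=> fZ; set Z := col_mx Zu Zl in fZ *; set Y := conj_mx Z A.
have eYZ : Y *m Z = Z *m A by rewrite /Y /conj_mx -mulmxA frameK // mulmx1.
have [eu ed] : ulsubmx Y *m Zu + ursubmx Y *m Zl = Zu *m A /\
               dlsubmx Y *m Zu + drsubmx Y *m Zl = Zl *m A.
  by move: eYZ; rewrite -{1}(submxK Y) mul_block_col mul_col_mx => /eq_col_mx.
have [Vu Vd] : Zu *m frinv Z = row_mx 1%:M 0 /\ Zl *m frinv Z = row_mx 0 1%:M.
  have := frameV fZ; rewrite mul_col_mx scalar_mx_block block_mxEv => /eq_col_mx.
  by [].
have [Yu Yd] : Zu *m A *m frinv Z = usubmx Y /\ Zl *m A *m frinv Z = dsubmx Y.
  by rewrite /Y /conj_mx mul_col_mx mul_col_mx col_mxKu col_mxKd.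
split; apply/eqP/submxP => [u0|[D eD]].
- by exists (ulsubmx Y); rewrite -eu u0 mul0mx addr0.
- by rewrite /ursubmx -Yu eD -mulmxA Vu mul_mx_row mulmx0 row_mxKr.
- by exists (drsubmx Y); rewrite -ed u0 mul0mx add0r.
by rewrite /dlsubmx -Yd eD -mulmxA Vd mul_mx_row mulmx0 row_mxKl.
Qed.

Lemma stab_para k (U : 'M[F]_k.+2) : \rank U = k.+1 ->
  exists (Z0 : 'M_(k.+1 + 1, k.+2)) (fZ0 : frame Z0), GLstab (n := k.+2) U = para_group fZ0.
Proof.
move=> rU; have [Zu _ eZu] := row_base_rank rU.
have rC : \rank (U^C)%MS = 1%N by rewrite mxrank_compl rU subSnn.
have [Zl _ eZl] := row_base_rank rC.
have fZ : frame (col_mx Zu Zl).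
  apply: frame_full; first by rewrite addn1.
  by rewrite -sub1mx -addsmxE (adds_eqmx eZu eZl) sub1mx addsmx_compl_full.
exists (col_mx Zu Zl), fZ; apply/setP => x; rewrite !inE /para conj_mx_unit // GLval_unit /=.
by rewrite (col_stab _ fZ) -(eqmxMr _ eZu) (eqmx_sym eZu).
Qed.

Section Levi.

Variables (k : nat) (U W : 'M[F]_k.+1).
Hypotheses (UW1 : (U + W :=: 1%:M)%MS) (dUW : mxdirect (U + W)).
Local Notation r := (\rank U).
Local Notation s := (\rank W).
Local Notation Z := (col_mx (row_base U) (row_base W)).

Lemma levi_rank : (r + s)%N = k.+1.
Proof. by rewrite -(mxdirectP dUW) /= UW1 mxrank1. Qed.

Lemma levi_frame : frame Z.
Proof.
apply: frame_full; first exact: levi_rank.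
by rewrite -sub1mx -addsmxE (adds_eqmx (eq_row_base U) (eq_row_base W)) UW1.
Qed.

Lemma card_levi : #|GLstab (n := k.+1) U :&: GLstab (n := k.+1) W| = (gl F r * gl F s)%N.
Proof.
pose D : {set 'M[F]_r * 'M[F]_s} := setX [set A | A \in unitmx] [set B | B \in unitmx].
have -> : (gl F r * gl F s)%N = #|D| by rewrite cardsX !cardsE.
have fZ := levi_frame.
pose h (u : 'M[F]_r * 'M[F]_s) : {'GL_(k.+1)[F]} :=
  glmx (conj_mx (frinv Z) (block_mx u.1 0 0 u.2)).
have hZ u : u \in D -> conj_mx Z (GLval (h u)) = block_mx u.1 0 0 u.2.
  rewrite !inE => /andP[u1 u2]; rewrite val_glmx ?conj_mxKV // conj_mx_unit ?frame_frinv //.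
  by rewrite unitmx_lblock u1.
rewrite -(card_in_imset (f := h) (D := D)).
  apply: eq_card => x; rewrite !inE.
  have -> : (U *m GLval x <= U)%MS = (row_base U *m GLval x <= row_base U)%MS.
    by rewrite (eqmxMr _ (eq_row_base U)) (eq_row_base U).
  have -> : (W *m GLval x <= W)%MS = (row_base W *m GLval x <= row_base W)%MS.
    by rewrite (eqmxMr _ (eq_row_base W)) (eq_row_base W).
  rewrite -!(col_stab (GLval x) fZ); apply/andP/imsetP => [[/eqP ur /eqP dl]|[u Du ->]]; last first.
    by rewrite hZ // block_mxKur block_mxKdl.
  set Y := conj_mx Z (GLval x) in ur dl.
  have eY : Y = block_mx (ulsubmx Y) 0 0 (drsubmx Y) by rewrite -ur -dl submxK.
  exists (ulsubmx Y, drsubmx Y).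
    by rewrite !inE -(unitmx_lblock _ 0) -eY conj_mx_unit // GLval_unit.
  by rewrite /h /= -eY conj_mxK // glmxK.
move=> [A B] [A' B'] Du Dv e; have := hZ _ Dv; rewrite -e hZ //.
by case/eq_block_mx=> /= -> _ _ ->.
Qed.

End Levi.

Lemma logn_gl p n : prime p -> (p %| #|F|)%N -> logn p (gl F n.+1) = ('C(n.+1, 2) * logn p #|F|)%N.
Proof.
move=> pp pq.
have cop m : logn p (#|F| ^ m.+1 - 1) = 0%N.
  apply: logn_coprime; rewrite prime_coprime // dvdn_subr ?expn_gt0 ?q_gt0 //.
    by rewrite dvdn1; case: eqP pp => // ->.
  by rewrite expnS dvdn_mulr.
have gt m : (0 < #|F| ^ m.+1 - 1)%N by rewrite subn_gt0 -(exp1n m.+1) ltn_exp2r // finNzRing_gt1.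
elim: n => [|n IH]; first by rewrite gl1 -subn1 -(expn1 #|F|) cop.
rewrite gl_rec !lognM ?muln_gt0 ?gl_gt0 ?expn_gt0 ?q_gt0 ?gt //.
by rewrite IH cop addn0 lognX [in RHS]binS bin1 mulnDl.
Qed.

Lemma bin2_add m n : 'C((m + n).+1, 2) = ('C(m.+1, 2) + 'C(n.+1, 2) + m * n)%N.
Proof.
have binS2 i : 'C(i.+2, 2) = ('C(i.+1, 2) + i.+1)%N by rewrite binS bin1.
elim: n => [|n IH]; first by rewrite addn0 muln0 !addn0.
by rewrite addnS !binS2 IH mulnS; lia.
Qed.

(* On q-parts the orders agree iff C(r,2) + C(s,2) = C(r+s-1,2), i.e. (r-1)(s-1) = 0. *)
Lemma levi_ranks k r s : (0 < r)%N -> (0 < s)%N -> (r + s = k.+2)%N ->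
  (gl F r * gl F s = gl F k.+1 * gl F 1)%N -> (r == 1%N) || (s == 1%N).
Proof.
case: r s => [|r] [|s] // _ _; rewrite addSn addnS => -[e] ec.
have [p pp pq] : exists2 p, prime p & (p %| #|F|)%N.
  by exists (pdiv #|F|); rewrite ?pdiv_prime ?pdiv_dvd ?finNzRing_gt1.
have lq : (0 < logn p #|F|)%N by rewrite logn_gt0 mem_primes pp pq q_gt0.
have := congr1 (logn p) ec; rewrite !lognM ?gl_gt0 // !logn_gl // -!mulnDl => /eqP.
rewrite eqn_pmul2r // -e bin2_add (_ : 'C(1, 2) = 0%N) // addn0.
by rewrite -[X in X == _]addn0 eqn_add2l eq_sym muln_eq0.
Qed.

End Stabilisers.

Section Duality.

Variables (F : finFieldType) (k : nat).
Local Notation G := ('GL_(k.+1)[F])%G.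
Local Notation gT := {'GL_(k.+1)[F]}.

Definition dual (x : gT) : gT := glmx (GLval x^-1%g)^T.

Lemma dual_val x : GLval (dual x) = (GLval x^-1%g)^T.
Proof. by rewrite val_glmx // unitmx_tr GLval_unit. Qed.

Lemma dualM : {morph dual : x y / (x * y)%g >-> (x * y)%g}.
Proof.
move=> x y; apply: val_inj; rewrite -[LHS]/(GLval _) -[RHS]/(GLval _).
by rewrite GL_MxE !dual_val invMg GL_MxE trmx_mul.
Qed.

Lemma dualK : involutive dual.
Proof.
move=> x; have dualV y : dual y^-1%g = (dual y)^-1%g.
  by apply: (mulgI (dual y)); rewrite -dualM !mulgV; apply: (mulgI (dual 1%g)); rewrite -dualM !mulg1.
apply: val_inj; rewrite -[LHS]/(GLval _) -[RHS]/(GLval _) dual_val -dualV dual_val invgK.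
by rewrite trmxK.
Qed.

Lemma dualM_in (X : {group gT}) : {in X &, {morph dual : x y / (x * y)%g}}.
Proof. by move=> x y _ _; apply: dualM. Qed.
Canonical dual_morphism (X : {group gT}) := Morphism (@dualM_in X).

Lemma dual_isom (X Y : {group gT}) : (forall x, (x \in Y) = (dual x \in X)) ->
  isom X Y (dual_morphism X).
Proof.
move=> XY; apply/eqP/setP => y /=; rewrite -{1}(dualK y) mem_imset ?inE ?XY; last exact: inv_inj dualK.
congr (_ && _); apply/negb_inj; rewrite !negbK; apply/eqP/eqP => [e|->].
  by rewrite -(dualK y) e; apply: (mulgI (dual 1%g)); rewrite -dualM !mulg1.
by apply: (mulgI (dual 1%g)); rewrite -dualM !mulg1.
Qed.

Lemma submx_ker m (V : 'M[F]_(m, k.+1)) (U : 'M_k.+1) :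
  (V <= U)%MS = (V *m (kermx U^T)^T == 0).
Proof.
set K := kermx U^T; have UK : U *m K^T = 0 by rewrite -[U]trmxK -trmx_mul mulmx_ker trmx0.
have rU : \rank (kermx K^T) = \rank U.
  by rewrite mxrank_ker mxrank_tr mxrank_ker mxrank_tr subKn // rank_leq_row.
have /eqmxP eU : (U == kermx K^T)%MS by rewrite -(mxrank_leqif_eq (introT sub_kermxP UK)).2 rU.
by rewrite eU sub_kermx.
Qed.

Lemma stabV (K : 'M[F]_k.+1) (x : gT) : x \in GLstab (n := k.+1) K -> x^-1%g \in GLstab (n := k.+1) K.
Proof.
rewrite !inE => Kx; have /eqmxP/eqmx_sym e : (K *m GLval x == K)%MS.
  by rewrite -(mxrank_leqif_eq Kx).2 mxrankMfree // row_free_unit GLval_unit.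
by rewrite (eqmxMr _ e) -mulmxA -[GLval x *m _]/(GLval (x * x^-1)%g) mulgV mulmx1.
Qed.

(** The rows of [kermx U^T] span the annihilator of U, and a matrix stabilises it exactly when its
    transpose stabilises U. Applying this to the inverse of x, which lies in the same stabiliser as
    x, produces [dual x]. *)
Lemma dual_stab (U : 'M[F]_k.+1) x :
  (x \in GLstab (n := k.+1) (kermx U^T)) = (dual x \in GLstab (n := k.+1) U).
Proof.
have -> : (x \in GLstab (n := k.+1) (kermx U^T)) = (x^-1%g \in GLstab (n := k.+1) (kermx U^T)).
  by apply/idP/idP => /stabV //; rewrite invgK.
rewrite !inE dual_val sub_kermx submx_ker -(inj_eq (@trmx_inj _ _ _)).
by rewrite !trmx_mul !trmxK trmx0 mulmxA.
Qed.

End Duality.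

Section Main.

Variables (F : finFieldType) (k : nat).
Hypothesis oq : odd #|F|.
Local Notation G := ('GL_(k.+2)[F])%G.

Lemma good_hyperplane (U : 'M[F]_k.+2) (P : {group {'GL_(k.+2)[F]}}) :
  \rank U = k.+1 -> P :=: GLstab (n := k.+2) U ->
  restriction_good 2 G P /\ (odd k.+2 -> restriction_canonical 2 G P).
Proof.
move=> rU eP; have [Z0 [fZ0 eU]] := stab_para rU.
have -> : P = para_group fZ0 by apply: val_inj; rewrite /= eP eU.
by split; [apply: standard_good | apply: standard_canonical].
Qed.

Lemma good_line (U : 'M[F]_k.+2) (P : {group {'GL_(k.+2)[F]}}) :
  \rank U = 1%N -> P :=: GLstab (n := k.+2) U ->
  restriction_good 2 G P /\ (odd k.+2 -> restriction_canonical 2 G P).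
Proof.
move=> rU eP; pose K := kermx U^T.
have rK : \rank K = k.+1 by rewrite mxrank_ker mxrank_tr rU subn1.
have [Z0 [fZ0 eK]] := stab_para rK.
have [good can] := good_hyperplane (P := para_group fZ0) rK (esym eK).
have iG : isom G G (dual_morphism G) by apply: dual_isom => x; rewrite !inE.
have iP : isom P (para_group fZ0) (dual_morphism P).
  by apply: dual_isom => x; rewrite -eK dual_stab eP.
have sPG : P \subset G by apply: subsetT.
have e : {in P, dual_morphism P =1 dual_morphism G} by [].
split; first exact: restriction_good_isom iG iP e sPG good.
by move/can; apply: restriction_canonical_isom iG iP e sPG.
Qed.

End Main.

Local Close Scope ring_scope.

Theorem theoremA (n q : nat) (F : finFieldType) (P L : {group {'GL_n[F]}}) :
  1 < n -> #|F| = q -> odd q ->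
  maximal_parabolic P ->
  levi_subgroup P L ->
  (L \isog setX 'GL_(n.-1)[F] 'GL_1[F])%g ->
  restriction_good 2 'GL_n[F]%G P /\
  (odd n -> restriction_canonical 2 'GL_n[F]%G P).
Proof.
case: n P L => [|[|k]] // P L _ <- oq _ [U [W [/andP[rU0 rUn] UW dUW eP eL]]] isoL.
have rUW := levi_rank UW dUW.
have rW0 : (0 < \rank W)%N by rewrite -(ltn_add2l (\rank U)) addn0 rUW.
have eC : (gl F (\rank U) * gl F (\rank W) = gl F k.+1 * gl F 1)%N.
  rewrite -(card_levi UW dUW) -eL (card_isog isoL) cardsX.
  by rewrite -(card_GLE F k) -(card_GLE F 0).
have /orP[/eqP rU|/eqP rW] := levi_ranks rU0 rW0 rUW eC.
  exact: (@good_line F k oq U P rU eP).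
have rU : \rank U = k.+1 by apply/eqP; rewrite -(eqn_add2r (\rank W)) rUW rW addn1.
exact: (@good_hyperplane F k oq U P rU eP).
Qed.
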